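(* Let $X$ be a complex linear algebraic group of dimension at least two, equipped with a volume form $\omega$. Then $[\mathcal{L}_0(X),\mathcal{L}_0(X)]=\mathcal{L}_J(X)$.
   Context: $X$ is regarded as a non-singular affine algebraic variety over $\mathbb{C}$ of dimension $n$, with ring of regular functions $\mathbb{C}[X]$. A volume form $\omega$ on $X$ is a nowhere vanishing algebraic $n$-form. $\Omega^k$ is the space of algebraic $k$-forms on $X$, with exterior differential $d$. By $V$ we denote the Lie algebra of algebraic vector fields on $X$ (derivations of $\mathbb{C}[X]$). The divergence $\operatorname{div}_\omega v\in\mathbb{C}[X]$ of $v\in V$ is defined by $L_v\omega=(\operatorname{div}_\omega v)\,\omega$, where $L_v$ is the Lie derivative. $\mathcal{L}_0(X)\subset V$ is the Lie algebra of algebraic vector fields of zero divergence with respect to $\omega$. The map $\mu:V\to\Omega^{n-1}$, $\mu(v)=i_v\omega$ (contraction), is an isomorphism of $\mathbb{C}[X]$-modules, under which $\mathcal{L}_0(X)$ corresponds to the closed $(n-1)$-forms. $\mathcal{L}_J(X)=\mu^{-1}(d\Omega^{n-2})$, a Lie subalgebra of $\mathcal{L}_0(X)$. $[\mathcal{L}_0(X),\mathcal{L}_0(X)]$ is the derived subalgebra (linear span of brackets). *)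

(* Defs.v *)
From HB Require Import structures.
From mathcomp Require Import all_boot all_order all_algebra.
From mathcomp Require Import boolp classical_sets functions reals.
From mathcomp Require Import complex ring.
From mathcomp Require Import mpoly.

Set Implicit Arguments.
Unset Strict Implicit.
Unset Printing Implicit Defensive.

Import GRing.Theory.

Local Open Scope classical_set_scope.
Local Open Scope ring_scope.

Section DifferentialCalculus.
Variables (K : fieldType) (A : comAlgType K).

Definition is_derivation (D : A -> A) : Prop :=
  (forall (c : K) (f g : A), D (c *: f + g) = c *: D f + D g) /\
  (forall f g : A, D (f * g) = D f * g + f * D g).

Definition derivations : {pred A -> A^o} := fun D => `[< is_derivation D >].

Lemma derivations_submod_closed : submod_closed derivations.
Proof.
split=> [|a D E /asboolP[Dl DM] /asboolP[El EM]]; apply/asboolP.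
  split=> [c f g|f g] /=; first by rewrite scaler0 addr0.
  by rewrite mul0r mulr0 addr0.
have DEE f : (a *: D + E : A -> A^o) f = a * (D f : A) + (E f : A) by [].
split=> [c f g|f g]; rewrite !DEE ?Dl ?El ?DM ?EM.
  by rewrite mulrDr -scalerAr scalerDr addrACA.
by rewrite mulrDr mulrDl mulrDr addrACA -mulrA [f * (a * _)]mulrCA.
Qed.

HB.instance Definition _ :=
  GRing.isSubmodClosed.Build A (A -> A^o) derivations derivations_submod_closed.

(* Sums and multiples by elements of A are pointwise. *)
Record vfield := VField { vfield_fun : A -> A^o; _ : vfield_fun \in derivations }.

HB.instance Definition _ := [isSub of vfield for vfield_fun].
HB.instance Definition _ := [Choice of vfield by <:].
HB.instance Definition _ := [SubChoice_isSubLmodule of vfield by <:].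

Definition vapp (v : vfield) : A -> A := val v.
Coercion vapp : vfield >-> Funclass.

Lemma vfieldP (v : vfield) : is_derivation v.
Proof. exact/asboolP/(valP v). Qed.

Lemma lie_bracket_subproof (v w : vfield) :
  (fun f => v (w f) - w (v f) : A^o) \in derivations.
Proof.
have [vl vM] := vfieldP v; have [wl wM] := vfieldP w.
have vD f g : v (f + g) = v f + v g by rewrite -[f]scale1r vl !scale1r.
have wD f g : w (f + g) = w f + w g by rewrite -[f]scale1r wl !scale1r.
apply/asboolP; split=> [c f g|f g].
  by rewrite wl vl vl wl scalerBr opprD addrACA.
rewrite wM vM vD wD !vM !wM; ring.
Qed.

Definition lie_bracket (v w : vfield) : vfield :=
  VField (lie_bracket_subproof v w).

(* Arbitrary maps; the k-forms are singled out by is_form.                    *)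
Definition cochain (k : nat) : Type := ('I_k -> vfield) -> A.

Definition subst_arg k (w : 'I_k -> vfield) (i : 'I_k) (u : vfield) :
    'I_k -> vfield :=
  fun j => if j == i then u else w j.

Definition cons_arg k (v : vfield) (w : 'I_k -> vfield) : 'I_k.+1 -> vfield :=
  fun j => if unlift ord0 j is Some j' then w j' else v.

(* On a non-singular affine variety with ring of functions A, the k-forms are *)
(* the alternating A-multilinear maps from k vector fields to A.              *)
Definition is_form k (eta : cochain k) : Prop :=
  (forall w i (a : A) (u v : vfield),
     eta (subst_arg w i (a *: u + v)) =
     a * eta (subst_arg w i u) + eta (subst_arg w i v)) /\
  (forall w (i j : 'I_k), i != j -> w i = w j -> eta w = 0).

Definition contract k (v : vfield) (omega : cochain k.+1) : cochain k :=
  fun w => omega (cons_arg v w).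

Definition lie_derive k (v : vfield) (omega : cochain k) : cochain k :=
  fun w => v (omega w) -
           \sum_(i < k) omega (subst_arg w i (lie_bracket v (w i))).

(* The invariant formula                                                      *)
(*   d eta (w_0, .., w_k) = sum_i (-1)^i w_i (eta (.., ^w_i, ..))             *)
(*     + sum_(i < j) (-1)^(i+j) eta ([w_i, w_j], .., ^w_i, .., ^w_j, ..)      *)
(* in which [w_i, w_j] has been moved to the place of w_j, past j - 1         *)
(* arguments, so that the sign of the second sum becomes - (-1)^i.            *)
(* Here l ranges over the positions left after deleting the i-th one, and     *)
(* j = lift i l; one has i < j exactly when i <= l.                           *)
Definition ext_diff k (eta : cochain k) : cochain k.+1 :=
  fun w => \sum_(i < k.+1)
    (-1) ^+ i *
    (w i (eta (w \o lift i)) -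
     \sum_(l < k | (i <= l)%N)
        eta (subst_arg (w \o lift i) l (lie_bracket (w i) (w (lift i l))))).

Definition is_divergence k (omega : cochain k) (v : vfield) (f : A) : Prop :=
  lie_derive v omega = (fun w => f * omega w).

Definition L0 k (omega : cochain k) : set vfield :=
  [set v | is_divergence omega v 0].

(* mu^-1 (d Omega^(n-2)) for n = k + 2 and mu v the contraction i_v omega.    *)
Definition LJ k (omega : cochain k.+2) : set vfield :=
  [set v | exists2 eta : cochain k, is_form eta & contract v omega = ext_diff eta].

(* The K-span of the brackets; c%:A *: v is the multiple of v by c in K.      *)
Definition derived (L : set vfield) : set vfield :=
  [set u | exists (r : nat) (c : 'I_r -> K) (v w : 'I_r -> vfield),
     (forall i, L (v i) /\ L (w i)) /\
     u = \sum_(i < r) (c i)%:A *: lie_bracket (v i) (w i)].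

Definition alg_independent k (f : 'I_k -> A) : Prop :=
  forall p : {mpoly K[k]}, mmap (in_alg A) f p = 0 -> p = 0.

Definition transcendence_degree (n : nat) : Prop :=
  (exists f : 'I_n -> A, alg_independent f) /\
  (forall f : 'I_n.+1 -> A, ~ alg_independent f).

End DifferentialCalculus.

Section LinearAlgebraicGroups.
Variables (K : fieldType) (m : nat).

(* The coordinate ring of GL_m is generated by the m * m matrix entries       *)
(* together with 1 / det.                                                     *)
Definition gl_coord (g : 'M[K]_m) : 'I_(m * m + 1) -> K :=
  row_mx (mxvec g) (\det g)^-1%:M 0.

Definition zariski_closed (G : set 'M[K]_m) : Prop :=
  exists S : set {mpoly K[m * m + 1]},
    G = [set g | g \in unitmx /\ forall p, S p -> p.@[gl_coord g] = 0].

Record linAlgGroup := LinAlgGroup {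
  lag_set :> set 'M[K]_m;
  lag_closed : zariski_closed lag_set;
  lag_one : lag_set 1%:M;
  lag_mul : forall g h, lag_set g -> lag_set h -> lag_set (g *m h);
  lag_inv : forall g, lag_set g -> lag_set (invmx g) }.

Variable X : linAlgGroup.

Definition point : Type := {g : 'M[K]_m | g \in lag_set X}.

HB.instance Definition _ := Choice.on point.
HB.instance Definition _ :=
  isPointed.Build point (exist _ 1%:M (mem_set (lag_one X))).

Definition is_regular (f : point -> K) : Prop :=
  exists p : {mpoly K[m * m + 1]}, forall x, f x = p.@[gl_coord (val x)].

Definition regular_functions : {pred point -> K^o} := fun f => `[< is_regular f >].

Lemma regular_subring_closed : subring_closed regular_functions.
Proof.
split=> [|f g /asboolP[p fp] /asboolP[q gq]|f g /asboolP[p fp] /asboolP[q gq]].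
- by apply/asboolP; exists 1 => x; rewrite meval1.
- by apply/asboolP; exists (p - q) => x; rewrite mevalB -fp -gq.
- by apply/asboolP; exists (p * q) => x; rewrite mevalM -fp -gq.
Qed.

Lemma regular_submod_closed : submod_closed regular_functions.
Proof.
split=> [|c f g /asboolP[p fp] /asboolP[q gq]].
  by apply/asboolP; exists 0 => x; rewrite meval0.
by apply/asboolP; exists (c *: p + q) => x; rewrite mevalD mevalZ -fp -gq.
Qed.

HB.instance Definition _ := GRing.isSubringClosed.Build (point -> K^o)
  regular_functions regular_subring_closed.
HB.instance Definition _ := GRing.isSubmodClosed.Build K (point -> K^o)
  regular_functions regular_submod_closed.

Record coordRing :=
  CoordRing { cr_fun : point -> K^o; _ : cr_fun \in regular_functions }.

HB.instance Definition _ := [isSub of coordRing for cr_fun].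
HB.instance Definition _ := [Choice of coordRing by <:].
HB.instance Definition _ := [SubChoice_isSubComNzRing of coordRing by <:].
HB.instance Definition _ := [SubZmodule_isSubLmodule of coordRing by <:].

Lemma coordRing_scalerAl (c : K) (f g : coordRing) : c *: (f * g) = c *: f * g.
Proof. by apply/val_inj/funext => x; apply: mulrA. Qed.
HB.instance Definition _ :=
  GRing.Lmodule_isLalgebra.Build K coordRing coordRing_scalerAl.

Lemma coordRing_scalerAr (c : K) (f g : coordRing) : c *: (f * g) = f * (c *: g).
Proof. by apply/val_inj/funext => x; apply: mulrCA. Qed.
HB.instance Definition _ :=
  GRing.Lalgebra_isAlgebra.Build K coordRing coordRing_scalerAr.

Definition eval_at (f : coordRing) (x : point) : K := val f x.

(* For X irreducible this is the transcendence degree of the function field;  *)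
(* in general it is the largest dimension of an irreducible component.        *)
Definition has_dimension (n : nat) : Prop := transcendence_degree coordRing n.

(* Vector fields span every tangent space of a non-singular affine variety,   *)
(* so omega vanishes at x if and only if all functions omega w vanish at x.   *)
Definition volume_form n (omega : cochain coordRing n) : Prop :=
  is_form omega /\
  forall x : point, exists w, eval_at (omega w) x != 0.

End LinearAlgebraicGroups.

(* Main.v *)
From HB Require Import structures.
From mathcomp Require Import all_boot all_order all_algebra perm.
From mathcomp Require Import boolp classical_sets functions reals.
From mathcomp Require Import complex ring lra mpoly ring_quotient.
Require Import Defs.

Set Implicit Arguments.
Unset Strict Implicit.
Unset Printing Implicit Defensive.

Import Order.TTheory GRing.Theory Num.Theory.
Local Open Scope classical_set_scope.
Local Open Scope ring_scope.

(** Let omega be the volume form. For vector fields a and b put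
      curl a b = [a, b] + div a b - div b a.
    Cartan's formulas give d (i_b i_a omega) = - i_(curl a b) omega. Every form of
    degree n - 2 is a sum of forms i_b i_a omega (form_codim2), so the fields curl a b
    span LJ; and curl a b = [a, b] when a and b are divergence-free. This gives one
    inclusion, and reduces the other to showing that every curl a b is a sum of
    brackets of divergence-free fields (derived_eq_LJ).

    The group provides a frame e of left invariant fields, and omega e is invertible,
    say t (omega e) = 1 (volume_unit). A right invariant field r commutes with the
    frame, so it preserves t omega and the field t r is divergence-free
    (right_inv_L0). Thus divergence-free fields generate all fields over the ring
    of functions. Moreover the dual frame is spanned by exact forms over that ring
    (left_invariant_frame). For the existence of the frame, smoothness of the group
    is obtained from generic smoothness: independent functions have independent
    differentials at some point (jacobian_point), which can be moved to any other.
    Generic points come from a Nullstellensatz for uncountable fields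
    (nullstellensatz).

    In dimension at least three the rest is algebra (derived_curl_high). A
    divergence-free w acts on curls by [w, curl a b] = curl [w, a] b + curl a [w, b].
    For p and q divergence-free, the fields w_h = curl (h p) q are divergence-free
    for all functions h, and they depend on h through a first order operator. A
    combination of the brackets of w_(gh), w_g, w_h and w_1 with suitable curls
    leaves only the terms of order one in g and in h
    (derived_twist_L). These terms are linear over functions in all data, so that
    p, q, a, b can be taken from the frame; two independent directions and a third
    one that they share then yield all curl (e_i) (f e_j).

    In dimension two curl a b is, up to sign, the Hamiltonian field H(f) of
    f = omega (a, b), and
    [v, H(g)] = H(v g) for v divergence-free. With v = t r it is enough that some
    right invariant field r is surjective on functions, which settles all cases but
    one (two_dim_cases). If the Lie algebra is not abelian, [E, D] = kappa D with
    kappa nonzero, and D is locally nilpotent because its right invariance makes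
    everything locally finite. A locally nilpotent D is surjective if it has a slice,
    a function s with D s = 1. A slice exists as soon as D f1 is nonzero and
    D (D f1) = 0 for some f1 (exists_slice): from an eigenvector F of E one
    obtains a function killed by all fields that lies in the image of D and does not
    vanish at the neutral element, and its translates generate the unit ideal. If the
    Lie algebra is abelian without slices, as for a torus, every function is
    D0 g0 + D1 g1 + c with c locally constant, and H(t c) is itself a bracket of
    divergence-free fields (derived_curl_abelian). *)

(** * Ideals, vector fields and lists of arguments *)

Section Ideals.
Variable A : comNzRingType.
Implicit Types (I : set A).

(** Sets rather than boolean predicates, since the ideals that occur are
    given by undecidable conditions. *)
Definition is_ideal I := I 0 /\ forall a u v, I u -> I v -> I (a * u + v).

Lemma idealD I u v : is_ideal I -> I u -> I v -> I (u + v).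
Proof. by move=> [_ Il] Iu Iv; rewrite -[u]mul1r; apply: Il. Qed.

Lemma idealM I a u : is_ideal I -> I u -> I (a * u).
Proof. by move=> [I0 Il] Iu; rewrite -[_ * _]addr0; apply: Il. Qed.

Lemma idealN I u : is_ideal I -> I u -> I (- u).
Proof. by move=> Ii Iu; rewrite -mulN1r; apply: idealM. Qed.

Lemma idealB I u v : is_ideal I -> I u -> I v -> I (u - v).
Proof. by move=> Ii Iu Iv; apply: idealD => //; apply: idealN. Qed.

Lemma ideal_sum I (T : Type) (r : seq T) (Q : pred T) (F : T -> A) :
  is_ideal I -> (forall i, Q i -> I (F i)) -> I (\sum_(i <- r | Q i) F i).
Proof.
by move=> Ii IF; apply: big_ind => //; [case: Ii|move=> u v; apply: idealD].
Qed.

End Ideals.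

Section VectorFields.
Variables (K : fieldType) (A : comAlgType K).
Implicit Types (v w : vfield A) (f g : A) (c : K).

Lemma vfield_ext v w : v =1 w -> v = w.
Proof. by move=> vw; apply/val_inj/funext. Qed.

Lemma vfD v f g : v (f + g) = v f + v g.
Proof. by have [vl _] := vfieldP v; rewrite -[f]scale1r vl !scale1r. Qed.

Lemma vfM v f g : v (f * g) = v f * g + f * v g.
Proof. by have [_ ->] := vfieldP v. Qed.

Lemma vf0 v : v 0 = 0.
Proof. by apply: (addIr (v 0)); rewrite -vfD !add0r. Qed.

Lemma vfZ v c f : v (c *: f) = c *: v f.
Proof. by have [vl _] := vfieldP v; rewrite -[c *: f]addr0 vl vf0 addr0. Qed.

Lemma vfN v f : v (- f) = - v f.
Proof. by rewrite -scaleN1r vfZ scaleN1r. Qed.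

Lemma vfB v f g : v (f - g) = v f - v g.
Proof. by rewrite vfD vfN. Qed.

Lemma vf1 v : v 1 = 0.
Proof. by apply: (addIr (v 1)); rewrite add0r -[in RHS](mulr1 1) vfM mulr1 mul1r. Qed.

Lemma vf_sum v (I : Type) (r : seq I) (P : pred I) (F : I -> A) :
  v (\sum_(i <- r | P i) F i) = \sum_(i <- r | P i) v (F i).
Proof. exact: (big_morph v (vfD v) (vf0 v)). Qed.

Lemma vf_alg v c : v c%:A = 0.
Proof. by rewrite vfZ vf1 scaler0. Qed.

Lemma vaddE v w f : (v + w) f = v f + w f. Proof. by []. Qed.
Lemma voppE v f : (- v) f = - v f. Proof. by []. Qed.
Lemma vscaleE a v f : (a *: v) f = a * v f. Proof. by []. Qed.
Lemma vzeroE f : (0 : vfield A) f = 0. Proof. by []. Qed.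

Lemma vsumE (I : Type) (r : seq I) (P : pred I) (F : I -> vfield A) f :
  (\sum_(i <- r | P i) F i) f = \sum_(i <- r | P i) F i f.
Proof. exact: (big_morph (fun v => vapp v f) (fun v w => vaddE v w f) (vzeroE f)). Qed.

Definition vE := (vaddE, voppE, vscaleE, vzeroE, vsumE).

Lemma bracketE v w f : lie_bracket v w f = v (w f) - w (v f).
Proof. by []. Qed.

Lemma bracketC v w : lie_bracket v w = - lie_bracket w v.
Proof. by apply: vfield_ext => f; rewrite vE !bracketE opprB. Qed.

Lemma bracketvv v : lie_bracket v v = 0.
Proof. by apply: vfield_ext => f; rewrite bracketE subrr. Qed.

Lemma bracketDr v w w' :
  lie_bracket v (w + w') = lie_bracket v w + lie_bracket v w'.
Proof. by apply: vfield_ext => f; rewrite !(vE, bracketE) vfD; ring. Qed.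

Lemma bracketZr v a w :
  lie_bracket v (a *: w) = a *: lie_bracket v w + v a *: w.
Proof. by apply: vfield_ext => f; rewrite !(vE, bracketE) vfM; ring. Qed.

Lemma bracketDl v v' w :
  lie_bracket (v + v') w = lie_bracket v w + lie_bracket v' w.
Proof. by apply: vfield_ext => f; rewrite !(vE, bracketE) vfD; ring. Qed.

Lemma bracketZl v a w :
  lie_bracket (a *: v) w = a *: lie_bracket v w - w a *: v.
Proof. by apply: vfield_ext => f; rewrite !(vE, bracketE) vfM; ring. Qed.

Lemma bracketNr v w : lie_bracket v (- w) = - lie_bracket v w.
Proof. by apply: vfield_ext => f; rewrite !(vE, bracketE) vfN; ring. Qed.

Lemma bracketNl v w : lie_bracket (- v) w = - lie_bracket v w.
Proof. by rewrite bracketC bracketNr -bracketC. Qed.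

Lemma jacobi u v w : lie_bracket u (lie_bracket v w) =
  lie_bracket (lie_bracket u v) w + lie_bracket v (lie_bracket u w).
Proof.
by apply: vfield_ext => f; rewrite !(vE, bracketE) !(vfB, bracketE); ring.
Qed.

Lemma lin0 (F : vfield A -> A) :
  (forall a u v, F (a *: u + v) = a * F u + F v) -> F 0 = 0.
Proof. by move=> lF; have := lF (-1) 0 0; rewrite scaler0 addr0 mulN1r addNr. Qed.

End VectorFields.

Section ConsArguments.
Variables (K : fieldType) (A : comAlgType K).
Implicit Types (k : nat) (u v : vfield A).

Lemma cons_arg0 k v (w : 'I_k -> vfield A) : cons_arg v w ord0 = v.
Proof. by rewrite /cons_arg unlift_none. Qed.

Lemma cons_argS k v (w : 'I_k -> vfield A) i : cons_arg v w (lift ord0 i) = w i.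
Proof. by rewrite /cons_arg liftK. Qed.

Lemma cons_arg_eta k (w : 'I_k.+1 -> vfield A) :
  cons_arg (w ord0) (w \o lift ord0) = w.
Proof.
apply/funext=> i; case: (unliftP ord0 i) => [j|] ->.
  by rewrite cons_argS.
by rewrite cons_arg0.
Qed.

Lemma cons_arg_ext k (x y : 'I_k.+1 -> vfield A) :
  x ord0 = y ord0 -> (forall i, x (lift ord0 i) = y (lift ord0 i)) -> x = y.
Proof.
by move=> h0 hS; apply/funext=> i; case: (unliftP ord0 i) => [j|] ->.
Qed.

Lemma subst_cons0 k v (w : 'I_k -> vfield A) u :
  subst_arg (cons_arg v w) ord0 u = cons_arg u w.
Proof.
apply: cons_arg_ext => [|i]; rewrite /subst_arg.
  by rewrite eqxx cons_arg0.
by rewrite !cons_argS.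
Qed.

Lemma subst_consS k v (w : 'I_k -> vfield A) i u :
  subst_arg (cons_arg v w) (lift ord0 i) u = cons_arg v (subst_arg w i u).
Proof.
apply: cons_arg_ext => [|j]; rewrite /subst_arg ?cons_arg0 ?cons_argS //.
Qed.

Lemma cons_lift0 k v (w : 'I_k -> vfield A) : cons_arg v w \o lift ord0 = w.
Proof. by apply/funext=> i /=; rewrite cons_argS. Qed.

Lemma lift_lift0 k (i : 'I_k.+1) (l : 'I_k) :
  lift (lift ord0 i) (lift ord0 l) = lift ord0 (lift i l).
Proof. by apply/val_inj; rewrite /= /bump /= !add1n ltnS addnS. Qed.

Lemma cons_liftS k v (w : 'I_k.+1 -> vfield A) (i : 'I_k.+1) :
  cons_arg v w \o lift (lift ord0 i) = cons_arg v (w \o lift i).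
Proof.
apply: cons_arg_ext => [|j] /=; rewrite ?cons_arg0 ?cons_argS.
  suff -> : lift (lift ord0 i) ord0 = ord0 by rewrite cons_arg0.
  exact/val_inj.
by rewrite lift_lift0 cons_argS.
Qed.

Lemma subst_arg_id k (w : 'I_k -> vfield A) i : subst_arg w i (w i) = w.
Proof. by apply/funext=> j; rewrite /subst_arg; case: eqP => [->|]. Qed.

Lemma arg0_eq (w w' : 'I_0 -> vfield A) : w = w'.
Proof. by apply/funext=> -[]. Qed.

End ConsArguments.

(** * Alternating forms and Cartan's recursions *)

Section Forms.
Variables (K : numFieldType) (A : comAlgType K).
Implicit Types (u v x y : vfield A).

Lemma natrM_eq0 (n : nat) (f : A) : n.+1%:R * f = 0 -> f = 0.
Proof.
rewrite -(scaler_nat n.+1 (1 : A)) -scalerAl mul1r => h.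
have : (n.+1%:R : K)^-1 *: (n.+1%:R *: f) = 0.
  by rewrite -[RHS](scaler0 _ (n.+1%:R^-1)) -h scaler_nat.
by rewrite scalerA mulVf ?pnatr_eq0 // scale1r.
Qed.

Lemma form_cons_lin k (eta : cochain A k.+1) : is_form eta ->
  forall a u v w, eta (cons_arg (a *: u + v) w) =
                  a * eta (cons_arg u w) + eta (cons_arg v w).
Proof.
move=> [lin _] a u v w.
by have := lin (cons_arg u w) ord0 a u v; rewrite !subst_cons0.
Qed.

Lemma form_consN k (eta : cochain A k.+1) u w : is_form eta ->
  eta (cons_arg (- u) w) = - eta (cons_arg u w).
Proof.
move=> fe; apply/eqP; rewrite -addr_eq0.
have := form_cons_lin fe 1 (- u) u w.
rewrite scale1r mul1r addNr => <-.
have := form_cons_lin fe 1 0 0 w.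
by rewrite scale1r addr0 mul1r => /(canLR (addrK _)); rewrite subrr => <-.
Qed.

Lemma form_contract k (eta : cochain A k.+1) v :
  is_form eta -> is_form (contract v eta).
Proof.
move=> [lin alt]; split=> [w i a x y|w i j ij wij]; rewrite /contract.
  by rewrite -!subst_consS lin.
by apply: (alt _ (lift ord0 i) (lift ord0 j)); rewrite ?(inj_eq lift_inj) ?cons_argS.
Qed.

Lemma form_cons2 k (eta : cochain A k.+2) v w :
  is_form eta -> eta (cons_arg v (cons_arg v w)) = 0.
Proof.
move=> [_ alt]; apply: (alt _ ord0 (lift ord0 ord0)) => //.
by rewrite cons_argS !cons_arg0.
Qed.

Lemma form_consC k (eta : cochain A k.+2) u v w : is_form eta ->
  eta (cons_arg u (cons_arg v w)) = - eta (cons_arg v (cons_arg u w)).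
Proof.
move=> fe; have fl := form_cons_lin fe; apply/eqP; rewrite -addr_eq0.
have fl' x := form_cons_lin (form_contract x fe).
have := form_cons2 (u + v) w fe.
rewrite -{1}[u]scale1r fl mul1r.
have := fl' u 1 u v w; have := fl' v 1 u v w; rewrite /contract scale1r !mul1r.
by move=> -> ->; rewrite !form_cons2 // add0r addr0 => ->.
Qed.

(** Forms are built by induction on their degree: alternation only has to be
    checked on the first two arguments, the contractions being forms already. *)
Lemma form_consP k (eta : cochain A k.+2) :
  (forall v, is_form (contract v eta)) ->
  (forall u v w, eta (cons_arg u (cons_arg v w)) =
               - eta (cons_arg v (cons_arg u w))) ->
  is_form eta.
Proof.
move=> fc asym; split=> [w i a u v|].
  rewrite -[w]cons_arg_eta; set x := w ord0; set z := w \o _.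
  case: (unliftP ord0 i) => [j|] ->.
    by have [lin _] := fc x; rewrite !subst_consS; exact: lin.
  rewrite !subst_cons0 -[z]cons_arg_eta; set y := z ord0; set t := z \o _.
  rewrite asym [in X in a * X]asym [X in _ = _ + X]asym.
  have := form_cons_lin (fc y) a u v t; rewrite /contract => ->.
  by rewrite opprD mulrN.
have sq0 v w : eta (cons_arg v (cons_arg v w)) = 0.
  apply: (@natrM_eq0 1); rewrite mulr2n mulrDl mul1r.
  by apply/eqP; rewrite addr_eq0 -asym.
have alt0 w j : w ord0 = w (lift ord0 j) -> eta w = 0.
  rewrite -[w]cons_arg_eta; set x := w ord0; set z := w \o _.
  rewrite cons_arg0 cons_argS -[z]cons_arg_eta; set y := z ord0; set t := z \o _.
  case: (unliftP ord0 j) => [l|] ->; last by rewrite cons_arg0 => ->; exact: sq0.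
  rewrite cons_argS => xt; rewrite asym.
  have [_ alt] := fc y.
  by rewrite [X in - X](alt _ ord0 (lift ord0 l)) ?oppr0 // cons_arg0 cons_argS.
move=> w i j ij wij.
case: (unliftP ord0 i) ij wij => [i'|] ->; last first.
  case: (unliftP ord0 j) => [j'|] -> //.
  by move=> _; exact: alt0.
case: (unliftP ord0 j) => [j'|] -> ij wij; last by apply: (@alt0 _ i').
rewrite -[w]cons_arg_eta; have [_ alt] := fc (w ord0).
by apply: (alt _ i' j') => //; apply: contra ij => /eqP->.
Qed.

Lemma is_form1 (eta : cochain A 1) :
  (forall a u v w, eta (cons_arg (a *: u + v) w) =
                   a * eta (cons_arg u w) + eta (cons_arg v w)) ->
  is_form eta.
Proof.
move=> lin; split=> [w i a u v|w i j]; last by rewrite !ord1.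
by rewrite !ord1 -[w]cons_arg_eta !subst_cons0.
Qed.

Lemma is_form0 (eta : cochain A 0) : is_form eta.
Proof. by split=> [w []|w []]. Qed.

Lemma form_lin k (eta theta : cochain A k) (a : A) :
  is_form eta -> is_form theta -> is_form (fun w => a * eta w + theta w).
Proof.
move=> [le ae] [lt at_]; split=> [w i b u v|w i j ij wij].
  by rewrite le lt; ring.
by rewrite (ae _ _ _ ij wij) (at_ _ _ _ ij wij) mulr0 addr0.
Qed.

Lemma form_zero k : is_form (fun _ => 0 : A) (k := k).
Proof. by split=> [w i b u v|//]; rewrite mulr0 addr0. Qed.

Lemma form_sub k (eta theta : cochain A k) :
  is_form eta -> is_form theta -> is_form (fun w => eta w - theta w).
Proof.
move=> fe ft; have := form_lin (-1) ft fe.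
by congr is_form; apply/funext=> w; rewrite mulN1r addrC.
Qed.

Lemma form_sum k (I : Type) (r : seq I) (F : I -> cochain A k) :
  (forall i, is_form (F i)) -> is_form (fun w => \sum_(i <- r) F i w).
Proof.
move=> fF; elim: r => [|i r IH].
  by have := form_zero k; congr is_form; apply/funext=> w; rewrite big_nil.
have := form_lin 1 (fF i) IH; congr is_form; apply/funext=> w.
by rewrite big_cons mul1r.
Qed.

(** Cartan's formula [L_v, i_u] = i_[v,u], which turns statements about Lie
    derivatives into inductions on the degree. *)
Lemma lie_cons k (eta : cochain A k.+1) v u w :
  lie_derive v eta (cons_arg u w) =
  lie_derive v (contract u eta) w - eta (cons_arg (lie_bracket v u) w).
Proof.
rewrite /lie_derive big_ord_recl cons_arg0 subst_cons0 opprD addrA addrAC.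
congr (_ - _ - _); apply: eq_bigr => i _.
by rewrite subst_consS cons_argS.
Qed.

Lemma lie_lin0 (eta : cochain A 0) v w : lie_derive v eta w = v (eta w).
Proof. by rewrite /lie_derive big_ord0 subr0. Qed.

Lemma form_lie k (eta : cochain A k) v : is_form eta -> is_form (lie_derive v eta).
Proof.
elim: k eta => [|[|k] IH] eta fe; first exact: is_form0.
  apply: is_form1 => a x y w.
  have fl := form_cons_lin fe.
  rewrite !lie_cons !lie_lin0 /contract bracketDr bracketZr -addrA.
  rewrite !fl vfD vfM; ring.
apply: form_consP => [u|x y w].
  have := form_sub (IH _ (form_contract u fe)) (form_contract (lie_bracket v u) fe).
  by congr is_form; apply/funext=> w; rewrite [RHS]/contract lie_cons.
rewrite !lie_cons /contract.
have -> : lie_derive v (fun z => eta (cons_arg x (cons_arg y z))) w =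
        - lie_derive v (fun z => eta (cons_arg y (cons_arg x z))) w.
  rewrite /lie_derive form_consC // vfN opprB addrC; congr (_ - _).
  by rewrite -sumrN; apply: eq_bigr => i _; rewrite form_consC // opprK.
rewrite [eta (cons_arg x _)]form_consC //.
by rewrite [eta (cons_arg (lie_bracket v x) _)]form_consC //; ring.
Qed.

(** Cartan's formula i_v d + d i_v = L_v. Read as a recursion on the degree it
    determines d, and the signs and deleted arguments of the explicit formula
    are never met again. *)
Lemma ext_diff_cons k (eta : cochain A k.+1) v w :
  ext_diff eta (cons_arg v w) = lie_derive v eta w - ext_diff (contract v eta) w.
Proof.
rewrite /ext_diff big_ord_recl expr0 mul1r cons_arg0 cons_lift0.
congr (_ - _ + _).
  by apply: eq_bigr => l _; rewrite cons_argS.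
rewrite -sumrN; apply: eq_bigr => i _.
rewrite cons_argS cons_liftS lift0 exprS mulN1r mulNr; congr (- (_ * (_ - _))).
rewrite big_mkcond big_ord_recl [RHS]big_mkcond /= add0r.
apply: eq_bigr => l _; rewrite /bump /= !add1n ltnS.
by case: ifP => // _; rewrite lift_lift0 cons_argS /contract subst_consS.
Qed.

Lemma ext_diff0 (eta : cochain A 0) v w :
  ext_diff eta (cons_arg v w) = v (eta w).
Proof.
rewrite /ext_diff big_ord1 expr0 mul1r big_ord0 subr0 cons_arg0.
by rewrite (arg0_eq (_ \o _) w).
Qed.

Lemma ext_diff_lin k (eta theta : cochain A k) (a : K) w :
  ext_diff (fun z => a *: eta z + theta z) w =
  a *: ext_diff eta w + ext_diff theta w.
Proof.
rewrite /ext_diff scaler_sumr -big_split; apply: eq_bigr => i _ /=.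
rewrite vfD vfZ scalerAr -mulrDr; congr (_ * _).
by rewrite scalerBr scaler_sumr big_split opprD addrACA.
Qed.

Lemma ext_diff_zero k w : ext_diff (fun _ => 0 : A) (k := k) w = 0.
Proof.
by rewrite /ext_diff big1 // => i _; rewrite vf0 big1 // subr0 mulr0.
Qed.

Lemma ext_diffN k (eta : cochain A k) w :
  ext_diff (fun z => - eta z) w = - ext_diff eta w.
Proof.
have := ext_diff_lin eta (fun _ => 0 : A) (-1) w.
rewrite ext_diff_zero addr0 scaleN1r => <-; congr ext_diff.
by apply/funext=> z; rewrite scaleN1r addr0.
Qed.

Lemma ext_diff_sum k (I : Type) (r : seq I) (F : I -> cochain A k) w :
  ext_diff (fun z => \sum_(i <- r) F i z) w = \sum_(i <- r) ext_diff (F i) w.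
Proof.
elim: r => [|i r IH].
  rewrite big_nil -[RHS](ext_diff_zero w); congr ext_diff.
  by apply/funext=> z; rewrite big_nil.
rewrite big_cons -IH -[ext_diff (F i) w]scale1r -ext_diff_lin; congr ext_diff.
by apply/funext=> z; rewrite big_cons scale1r.
Qed.

Lemma form_ext_diff k (eta : cochain A k) : is_form eta -> is_form (ext_diff eta).
Proof.
elim: k eta => [|k IH] eta fe.
  apply: is_form1 => a u v w; by rewrite !ext_diff0.
apply: form_consP => [v|u v w].
  have := form_sub (form_lie v fe) (IH _ (form_contract v fe)).
  by congr is_form; apply/funext=> w; rewrite [RHS]/contract ext_diff_cons.
rewrite !ext_diff_cons !lie_cons.
case: k IH eta fe w => [|k] IH eta fe w.
  rewrite !ext_diff0 !lie_lin0 /contract [lie_bracket v u]bracketC.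
  rewrite form_consN //; ring.
rewrite !ext_diff_cons.
have -> : eta (cons_arg (lie_bracket v u) w) = - eta (cons_arg (lie_bracket u v) w).
  by rewrite [lie_bracket v u]bracketC form_consN.
have -> : contract u (contract v eta) = (fun z => - contract v (contract u eta) z).
  by apply/funext => z; rewrite /contract form_consC.
rewrite ext_diffN; ring.
Qed.

End Forms.

(** * Frames and forms of top degree *)

Section Frames.
Variables (K : numFieldType) (A : comAlgType K).
Implicit Types (u v x y : vfield A).

Definition wedge (c : vfield A -> A) k (beta : cochain A k) : cochain A k.+1 :=
  fun w => \sum_(i < k.+1) (-1) ^+ i * (c (w i) * beta (w \o lift i)).

Lemma wedge_cons (c : vfield A -> A) k (beta : cochain A k.+1) v w :
  wedge c beta (cons_arg v w) = c v * beta w - wedge c (contract v beta) w.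
Proof.
rewrite /wedge big_ord_recl expr0 mul1r cons_arg0 cons_lift0; congr (_ + _).
rewrite -sumrN; apply: eq_bigr => i _.
by rewrite cons_argS cons_liftS lift0 exprS mulN1r mulNr.
Qed.

Lemma wedge0 (c : vfield A -> A) (beta : cochain A 0) v w :
  wedge c beta (cons_arg v w) = c v * beta w.
Proof.
by rewrite /wedge big_ord1 expr0 mul1r cons_arg0 (arg0_eq (_ \o _) w).
Qed.

Lemma wedgeN (c : vfield A -> A) k (beta : cochain A k) w :
  wedge c (fun z => - beta z) w = - wedge c beta w.
Proof. by rewrite /wedge -sumrN; apply: eq_bigr => i _; rewrite !mulrN. Qed.

Lemma form_wedge (c : vfield A -> A) k (beta : cochain A k) :
  (forall a u v, c (a *: u + v) = a * c u + c v) ->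
  is_form beta -> is_form (wedge c beta).
Proof.
move=> cl; elim: k beta => [|k IH] beta fb.
  by apply: is_form1 => a u v w; rewrite !wedge0 cl; ring.
apply: form_consP => [v|u v w].
  have := form_sub (form_lin (c v) fb (form_zero A k.+1)) (IH _ (form_contract v fb)).
  by congr is_form; apply/funext=> w; rewrite [RHS]/contract wedge_cons addr0.
rewrite !wedge_cons.
case: k IH beta fb w => [|k] IH beta fb w; first by rewrite !wedge0 /contract; ring.
rewrite !wedge_cons.
have -> : contract u (contract v beta) = (fun z => - contract v (contract u beta) z).
  by apply/funext => z; rewrite /contract form_consC.
by rewrite wedgeN /contract; ring.
Qed.

Lemma form_consE k (eta : cochain A k.+1) : is_form eta -> forall a v w,
  eta (cons_arg (a *: v) w) = a * eta (cons_arg v w).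
Proof.
move=> fe a v w; have := form_cons_lin fe a v 0 w; rewrite addr0 => ->.
have := form_cons_lin fe (-1) 0 0 w.
by rewrite scaler0 addr0 mulN1r addNr => ->; rewrite addr0.
Qed.

Lemma form_cons_sum k (eta : cochain A k.+1) : is_form eta ->
  forall (I : Type) (r : seq I) (f : I -> A) (v : I -> vfield A) w,
  eta (cons_arg (\sum_(i <- r) f i *: v i) w) =
  \sum_(i <- r) f i * eta (cons_arg (v i) w).
Proof.
move=> fe I r f v w; elim: r => [|i r IH].
  by rewrite !big_nil -(scale0r 0) form_consE // mul0r.
by rewrite !big_cons form_cons_lin // IH.
Qed.

Lemma form_tperm k (eta : cochain A k) (w : 'I_k -> vfield A) i j :
  is_form eta -> i != j -> eta (w \o tperm i j) = - eta w.
Proof.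
move=> [lin alt] ij; set a := w i; set b := w j.
pose S x y := subst_arg (subst_arg w i x) j y.
have Sl1 x y z : eta (S (x + y) z) = eta (S x z) + eta (S y z).
  have SS t : S t z = subst_arg (subst_arg w j z) i t.
    apply/funext=> l; rewrite /S /subst_arg.
    by case: (l =P j) => [->|//]; rewrite eq_sym (negbTE ij).
  by rewrite !SS -[x]scale1r lin scale1r mul1r.
have Sl2 x y z : eta (S z (x + y)) = eta (S z x) + eta (S z y).
  by rewrite /S -[x]scale1r lin scale1r mul1r.
have S0 x : eta (S x x) = 0.
  by apply: (alt _ i j) => //; rewrite /S /subst_arg !eqxx (negbTE ij).
have -> : w \o tperm i j = S b a.
  apply/funext=> l /=; rewrite /S /subst_arg.
  case: (l =P j) => [->|/eqP lj]; first by rewrite tpermR.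
  by case: (l =P i) => [->|/eqP li]; rewrite ?tpermL // tpermD 1?eq_sym.
have -> : w = S a b.
  apply/funext=> l /=; rewrite /S /subst_arg.
  by case: (l =P j) => [->//|_]; case: (l =P i) => [->|].
apply/eqP; rewrite -addr_eq0; apply/eqP.
by have := S0 (a + b); rewrite Sl1 !Sl2 !S0 add0r addr0 addrC.
Qed.

(** A permutation changes eta w by a sign only, and an ideal does not see
    signs. *)
Lemma form_perm_ideal (I : A -> Prop) k (eta : cochain A k) (w : 'I_k -> vfield A)
    (s : {perm 'I_k}) :
  is_ideal I -> is_form eta -> I (eta w) -> I (eta (w \o s)).
Proof.
move=> iI fe; have [ts -> ntp] := prod_tpermP s.
elim: ts w ntp => [|t ts IH] w /=.
  by rewrite big_nil => _; congr (I (eta _)); apply/funext=> i /=; rewrite perm1.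
move=> /andP[nt nts] w0; rewrite big_cons.
have -> : w \o (tperm t.1 t.2 * \prod_(t <- ts) tperm t.1 t.2)%g =
          (w \o (\prod_(t <- ts) tperm t.1 t.2)%g) \o tperm t.1 t.2.
  by apply/funext=> i /=; rewrite permM.
by rewrite form_tperm //; apply: idealN => //; apply: IH.
Qed.

Variables (N : nat) (e : 'I_N -> vfield A) (co : 'I_N -> vfield A -> A).

(** A basis of the module of vector fields together with its dual basis. *)
Definition is_frame : Prop :=
  [/\ forall i a u v, co i (a *: u + v) = a * co i u + co i v,
      forall i j, co i (e j) = (i == j)%:R &
      forall v, v = \sum_i co i v *: e i].

Hypothesis frame_e : is_frame.

Let co_lin i : forall a u v, co i (a *: u + v) = a * co i u + co i v.
Proof. by case: frame_e. Qed.
Let co_e i j : co i (e j) = (i == j)%:R.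
Proof. by case: frame_e. Qed.
Let coE v : v = \sum_i co i v *: e i.
Proof. by case: frame_e. Qed.

(** Working modulo an ideal covers at once the vanishing of forms (the zero
    ideal) and their vanishing at a point (its maximal ideal). *)
Lemma form_frame_ideal (I : A -> Prop) k (eta : cochain A k) : is_ideal I ->
  is_form eta -> (forall s : 'I_k -> 'I_N, I (eta (e \o s))) -> forall w, I (eta w).
Proof.
move=> iI; elim: k eta => [|k IH] eta fe e0 w.
  rewrite (arg0_eq w (e \o (fun i : 'I_0 =>
    match i with Ordinal _ h => False_rect _ (notF h) end))); exact: e0.
rewrite -[w]cons_arg_eta [w ord0]coE form_cons_sum //.
apply: ideal_sum => // i _; apply: idealM => //.
apply: (IH (contract (e i) eta)); first exact: form_contract.
move=> s; rewrite /contract.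
have := e0 (fun j => if unlift ord0 j is Some l then s l else i).
congr (I (eta _)); apply: cons_arg_ext => [|j] /=.
  by rewrite unlift_none cons_arg0.
by rewrite liftK cons_argS.
Qed.

Lemma ideal_zero : is_ideal (fun a : A => a = 0).
Proof. by split=> // a u v -> ->; rewrite mulr0 addr0. Qed.

Lemma form_above_dim (eta : cochain A N.+1) w : is_form eta -> eta w = 0.
Proof.
move=> fe; apply: (form_frame_ideal ideal_zero) => // s.
have /injectivePn[i [j ij sij]] : ~~ injectiveb s.
  by apply/negP => /injectiveP/leq_card; rewrite !card_ord ltnn.
by case: fe => _ alt; apply: (alt _ i j) => //=; rewrite sij.
Qed.

Lemma top_form_ideal (I : A -> Prop) (eta : cochain A N) :
  is_ideal I -> is_form eta -> I (eta e) -> forall w, I (eta w).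
Proof.
move=> iI fe e0; apply: form_frame_ideal => // s.
have [/injectiveP si|/injectivePn[i [j ij sij]]] := boolP (injectiveb s); last first.
  rewrite (_ : eta _ = 0); first by case: iI.
  by case: fe => _ alt; apply: (alt _ i j) => //=; rewrite sij.
have := form_perm_ideal (perm si) iI fe e0; congr (I (eta _)).
by apply/funext=> i /=; rewrite permE.
Qed.

Lemma top_form_subst (eta : cochain A N) i v : is_form eta ->
  eta (subst_arg e i v) = co i v * eta e.
Proof.
move=> [lin alt].
have lin0 : eta (subst_arg e i 0) = 0.
  have := lin e i (-1) 0 0; rewrite scaler0 addr0 mulN1r => ->.
  by rewrite addNr.
have {lin0} linS (r : seq 'I_N) (f : 'I_N -> A) :
    eta (subst_arg e i (\sum_(j <- r) f j *: e j)) =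
    \sum_(j <- r) f j * eta (subst_arg e i (e j)).
  by elim: r => [|j r IH]; rewrite ?big_nil // !big_cons lin IH.
rewrite {1}[v]coE linS (bigD1 i) //= subst_arg_id big1 ?addr0 // => j ji.
rewrite [eta _](alt _ i j) ?mulr0 1?eq_sym //.
by rewrite /subst_arg eqxx (negbTE ji).
Qed.

(** Sum the relation i_(e_i) e^i + e^i i_(e_i) = 1 over the frame, where e^i
    stands for the exterior product with the dual form; the sum of the
    e^i i_(e_i) multiplies a form by its degree. *)
Lemma euler_wedge k (beta : cochain A k) w : is_form beta ->
  \sum_i wedge (co i) beta (cons_arg (e i) w) = N%:R * beta w - k%:R * beta w.
Proof.
have deg k' (gamma : cochain A k'.+1) z : is_form gamma ->
    \sum_i wedge (co i) (contract (e i) gamma) z = k'.+1%:R * gamma z.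
  elim: k' gamma z => [|k' IH] gamma z fg; rewrite -[z]cons_arg_eta.
    rewrite mul1r [z ord0]coE form_cons_sum // -coE.
    by apply: eq_bigr => i _; rewrite wedge0.
  set x := z ord0; set y := z \o _.
  under eq_bigr do rewrite wedge_cons.
  rewrite sumrB {1}/contract.
  rewrite -(form_cons_sum fg (index_enum _) (fun i => co i x) e y) -coE.
  under [X in _ - X]eq_bigr => i _.
    have -> : contract x (contract (e i) gamma) =
              (fun t => - contract (e i) (contract x gamma) t).
      by apply/funext=> t; rewrite /contract form_consC.
    rewrite wedgeN; over.
  rewrite sumrN opprK IH; last exact: form_contract.
  by rewrite [in RHS]mulrS mulrDl mul1r.
move=> fb; have sumN : \sum_(i < N) co i (e i) * beta w = N%:R * beta w.
  under eq_bigr do rewrite co_e eqxx mul1r.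
  by rewrite sumr_const card_ord mulr_natl.
case: k beta w fb sumN => [|k] beta w fb sumN.
  rewrite mul0r subr0 -sumN; apply: eq_bigr => i _; exact: wedge0.
under eq_bigr do rewrite wedge_cons.
by rewrite sumrB sumN deg.
Qed.

End Frames.

(** * Brackets and Lie derivatives *)

Section Derived.
Variables (K : fieldType) (A : comAlgType K) (L : set (vfield A)).
Implicit Types (u v w : vfield A).

Lemma derived0 : derived L 0.
Proof.
exists 0%N, (fun=> 0), (fun=> 0), (fun=> 0); split=> [[]//|].
by rewrite big_ord0.
Qed.

Lemma derivedD u v : derived L u -> derived L v -> derived L (u + v).
Proof.
move=> [r1 [c1 [x1 [y1 [L1 ->]]]]] [r2 [c2 [x2 [y2 [L2 ->]]]]].
exists (r1 + r2)%N,
  (fun i : 'I_(r1 + r2) => match fintype.split i with inl j => c1 j | inr j => c2 j end),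
  (fun i : 'I_(r1 + r2) => match fintype.split i with inl j => x1 j | inr j => x2 j end),
  (fun i : 'I_(r1 + r2) => match fintype.split i with inl j => y1 j | inr j => y2 j end).
split=> [i|]; first by case: (fintype.split i).
rewrite big_split_ord; congr (_ + _); apply: eq_bigr => i _.
  by rewrite (unsplitK (inl i)).
by rewrite (unsplitK (inr i)).
Qed.

Lemma derivedZ (c : K) v : derived L v -> derived L (c%:A *: v).
Proof.
move=> [r [d [x [y [Lxy ->]]]]]; exists r, (fun i => c * d i), x, y; split=> //.
rewrite scaler_sumr; apply: eq_bigr => i _.
by rewrite scalerA -scalerAl mul1r scalerA.
Qed.

Lemma derivedN v : derived L v -> derived L (- v).
Proof. by move=> /(derivedZ (-1)); rewrite scaleN1r scaleN1r. Qed.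

Lemma derivedB u v : derived L u -> derived L v -> derived L (u - v).
Proof. by move=> Du Dv; apply/derivedD/derivedN. Qed.

Lemma derived_sum (I : Type) (r : seq I) (F : I -> vfield A) :
  (forall i, derived L (F i)) -> derived L (\sum_(i <- r) F i).
Proof.
by move=> DF; apply: big_ind => // [|u v]; [exact: derived0|exact: derivedD].
Qed.

Lemma derived_bracket v w : L v -> L w -> derived L (lie_bracket v w).
Proof.
move=> Lv Lw; exists 1%N, (fun=> 1), (fun=> v), (fun=> w); split=> //.
by rewrite big_ord1 !scale1r.
Qed.

End Derived.

Section LieDerivativeBracket.
Variables (K : numFieldType) (A : comAlgType K).
Implicit Types (u v w x y : vfield A).

Lemma lieB k (eta theta : cochain A k) v (w : 'I_k -> vfield A) :
  lie_derive v (fun z => eta z - theta z) w =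
  lie_derive v eta w - lie_derive v theta w.
Proof. by rewrite /lie_derive vfB sumrB opprB !opprD opprK; ring. Qed.

Lemma form_consB k (eta : cochain A k.+1) x y (w : 'I_k -> vfield A) : is_form eta ->
  eta (cons_arg (x - y) w) = eta (cons_arg x w) - eta (cons_arg y w).
Proof.
move=> fe; rewrite -[x]scale1r form_cons_lin // mul1r scale1r.
by rewrite form_consN.
Qed.

(** The identity [L_v, L_w] = L_[v,w], by induction on the degree; the step is
    the Jacobi identity. *)
Lemma lie_bracket_derive k (eta : cochain A k) v w (z : 'I_k -> vfield A) : is_form eta ->
  lie_derive (lie_bracket v w) eta z =
  lie_derive v (lie_derive w eta) z - lie_derive w (lie_derive v eta) z.
Proof.
elim: k eta z => [|k IH] eta z fe; first by rewrite !lie_lin0 bracketE.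
rewrite -[z]cons_arg_eta; set u := z ord0; set t := z \o _.
have cl x : contract u (lie_derive x eta) =
    (fun s => lie_derive x (contract u eta) s - contract (lie_bracket x u) eta s).
  by apply/funext=> s; rewrite [LHS]/contract lie_cons.
rewrite !lie_cons !cl (lieB (lie_derive w (contract u eta))).
rewrite (lieB (lie_derive v (contract u eta))) (IH (contract u eta)); last exact: form_contract.
have -> : lie_bracket (lie_bracket v w) u =
    lie_bracket v (lie_bracket w u) - lie_bracket w (lie_bracket v u).
  by rewrite [lie_bracket v (lie_bracket w u)]jacobi addrK.
rewrite form_consB //.
ring.
Qed.

End LieDerivativeBracket.

(** * Divergence and curl for a volume form *)

Section Volume.
Variables (K : numFieldType) (A : comAlgType K) (n : nat).
Implicit Types (a b u v x y : vfield A) (f g h : A).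
Variables (e : 'I_n.+2 -> vfield A) (co : 'I_n.+2 -> vfield A -> A).
Hypothesis frame_e : is_frame e co.
Variables (omega : cochain A n.+2) (t : A).
Hypotheses (form_omega : is_form omega) (t_omega : t * omega e = 1).

(** The divergence is well defined because every form of top degree is a
    multiple of omega. *)
Definition divg v : A := t * lie_derive v omega e.

Lemma top_formE (eta : cochain A n.+2) : is_form eta ->
  forall w : 'I_n.+2 -> vfield A, eta w = t * eta e * omega w.
Proof.
move=> fe w; apply/eqP; rewrite -subr_eq0; apply/eqP.
have fd := form_sub fe (form_lin (t * eta e) form_omega (form_zero A n.+2)).
have /= top0 := top_form_ideal frame_e (ideal_zero A) fd; rewrite -[X in _ - X]addr0 top0 //.
by rewrite addr0 mulrAC t_omega mul1r subrr.
Qed.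

Lemma lie_omega v (w : 'I_n.+2 -> vfield A) : lie_derive v omega w = divg v * omega w.
Proof. by rewrite (top_formE (form_lie v form_omega)). Qed.

Lemma omega_inj f g : (forall w, f * omega w = g * omega w) -> f = g.
Proof.
by move=> /(_ e) h; rewrite -[f]mulr1 -[g]mulr1 -t_omega !(mulrCA _ t) h.
Qed.

Lemma L0P v : L0 omega v <-> divg v = 0.
Proof.
rewrite /L0 /= /is_divergence; split=> [h|v0].
  by rewrite /divg h mul0r mulr0.
by apply/funext=> w; rewrite lie_omega v0.
Qed.

Lemma divg_lin f v (w : vfield A) : divg (f *: v + w) = f * divg v + divg w + v f.
Proof.
rewrite /divg /lie_derive.
have lin := form_omega.1.
under eq_bigr => i _.
  have -> : lie_bracket (f *: v + w) (e i) =
     f *: lie_bracket v (e i) + (lie_bracket w (e i) - e i f *: v).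
    by rewrite bracketDl bracketZl addrAC addrA.
  rewrite lin (_ : _ - _ = (- e i f) *: v + lie_bracket w (e i)); last first.
    by rewrite addrC scaleNr.
  rewrite lin (top_form_subst frame_e i v form_omega); over.
rewrite big_split /= big_split /= -mulr_sumr vE vscaleE.
have -> : \sum_(i < n.+2) - e i f * (co i v * omega e) = - v f * omega e.
  have [_ _ coE] := frame_e.
  rewrite [in RHS](coE v) vE -sumrN mulr_suml; apply: eq_bigr => i _.
  by rewrite vE mulrA; congr (_ * _); rewrite mulNr mulrC.
rewrite -[X in _ = _ + X]mul1r -t_omega; ring.
Qed.

Lemma divg0 : divg 0 = 0.
Proof.
have := divg_lin (-1) 0 0; rewrite scaler0 addr0 vE addr0 mulN1r addNr.
by [].
Qed.

Lemma divgZ f v : divg (f *: v) = f * divg v + v f.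
Proof. by rewrite -[f *: v]addr0 divg_lin divg0 addr0. Qed.

Lemma divgD v (w : vfield A) : divg (v + w) = divg v + divg w.
Proof. by rewrite -{1}[v]scale1r divg_lin mul1r vf1 addr0. Qed.

Lemma divgN v : divg (- v) = - divg v.
Proof. by rewrite -scaleN1r divgZ vfN vf1 oppr0 addr0 mulN1r. Qed.

Lemma divg_bracket v (w : vfield A) : divg (lie_bracket v w) = v (divg w) - w (divg v).
Proof.
apply: omega_inj => z; rewrite -lie_omega lie_bracket_derive //.
have E x y : lie_derive x (lie_derive y omega) z =
    x (divg y) * omega z + divg y * (divg x * omega z).
  have -> : lie_derive y omega = (fun w => divg y * omega w).
    by apply/funext=> w'; rewrite lie_omega.
  rewrite -lie_omega /lie_derive vfM -addrA; congr (_ + _).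
  by rewrite mulrBr mulr_sumr.
rewrite !E; ring.
Qed.

(** The bracket of a and b, corrected so that a function can be moved from one
    argument to the other and that the result is divergence-free for all a and b.
    In dimension three this is, up to sign, the curl of the vector product of a
    and b. *)
Definition curl a b : vfield A :=
  lie_bracket a b + divg a *: b - divg b *: a.

(** Expand 0 = d omega (a, b, w) by Cartan's recursions: d omega vanishes since
    its degree exceeds the dimension. *)
Lemma ext_diff_contract2 a b :
  ext_diff (contract b (contract a omega)) = (fun w => - contract (curl a b) omega w).
Proof.
apply/funext=> w.
have := form_above_dim frame_e (cons_arg a (cons_arg b w)) (form_ext_diff form_omega).
rewrite ext_diff_cons lie_omega ext_diff_cons.
have := lie_omega b (cons_arg a w); rewrite lie_cons => /eqP; rewrite subr_eq => /eqP ->.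
move/eqP; rewrite opprB addrCA addr_eq0 => /eqP ->.
rewrite /contract /curl form_consB // [_ + divg a *: b]addrC form_cons_lin //.
rewrite form_consE // [lie_bracket a b]bracketC form_consN //; ring.
Qed.

Lemma curlDl a b v : curl (a + b) v = curl a v + curl b v.
Proof.
apply: vfield_ext => f; rewrite /curl bracketDl divgD !vE; ring.
Qed.

Lemma curlC a b : curl a b = - curl b a.
Proof. by rewrite /curl bracketC !opprD opprK addrAC. Qed.

Lemma curlvv a : curl a a = 0.
Proof. by rewrite /curl bracketvv add0r subrr. Qed.

Lemma curlZl f a b : curl (f *: a) b = f *: curl a b + a f *: b - b f *: a.
Proof.
by apply: vfield_ext => h; rewrite /curl bracketZl divgZ !(vE, bracketE); ring.
Qed.

Lemma curlZC f a b : curl (f *: a) b = curl a (f *: b).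
Proof.
apply: vfield_ext => h; rewrite curlZl [curl a (f *: b)]curlC curlZl [curl b a]curlC.
by rewrite !vE; ring.
Qed.

Lemma divg_curl a b : divg (curl a b) = 0.
Proof.
rewrite /curl !divgD divgN !divgZ divg_bracket; ring.
Qed.

Lemma curl_L0 a b : L0 omega a -> L0 omega b -> curl a b = lie_bracket a b.
Proof. by move=> /L0P a0 /L0P b0; rewrite /curl a0 b0 !scale0r subr0 addr0. Qed.

Lemma L0_curl a b : L0 omega (curl a b).
Proof. exact/L0P/divg_curl. Qed.

(** A divergence-free field preserves omega, hence the operation a, b |->
    curl a b, which is built from omega alone. *)
Lemma lie_bracket_curl w a b : L0 omega w ->
  lie_bracket w (curl a b) = curl (lie_bracket w a) b + curl a (lie_bracket w b).
Proof.
move=> /L0P w0; rewrite /curl.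
rewrite !divg_bracket w0 !vf0 !subr0.
rewrite !bracketDr bracketNr !bracketZr jacobi.
apply: vfield_ext => f; rewrite !vE; ring.
Qed.

Lemma contract_inj v v' : contract v omega = contract v' omega -> v = v'.
Proof.
move=> vv'; apply/eqP; rewrite -subr_eq0; apply/eqP.
have v0 w : omega (cons_arg (v - v') w) = 0.
  rewrite form_consB //; apply/eqP; rewrite subr_eq0.
  by have := congr1 (fun F => F w) vv'; rewrite /contract => ->.
have [_ _ coE] := frame_e; rewrite [LHS]coE big1 // => i _.
suff -> : co i (v - v') = 0 by rewrite scale0r.
rewrite -[LHS]mulr1 -t_omega mulrCA -(top_form_subst frame_e) //.
set x := subst_arg _ _ _.
have xi : x i = v - v' by rewrite /x /subst_arg eqxx.
case: (unliftP ord0 i) xi => [j|] -> xi; last by rewrite -[x]cons_arg_eta xi v0 mulr0.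
suff -> : omega x = 0 by rewrite mulr0.
apply: oppr_inj; rewrite oppr0 -(@form_tperm _ _ _ _ x ord0 (lift ord0 j)) //.
by rewrite -[x \o _]cons_arg_eta /= tpermL xi v0.
Qed.

(** Two applications of the identity euler_wedge, with coefficients
    n + 2 - n = 2 and n + 2 - (n + 1) = 1, write beta in terms of the forms
    e^j /\ e^i /\ beta, which have top degree. *)
Lemma form_codim2 (beta : cochain A n) : is_form beta ->
  exists g : 'I_n.+2 -> 'I_n.+2 -> A, forall w : 'I_n -> vfield A,
    beta w = \sum_i \sum_j contract (e i) (contract (g i j *: e j) omega) w.
Proof.
move=> fb; have [colin _ _] := frame_e.
pose b1 i := wedge (co i) beta; pose b2 i j := wedge (co j) (b1 i).
have f1 i : is_form (b1 i) by apply: form_wedge.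
have f2 i j : is_form (b2 i j) by apply: form_wedge.
exists (fun i j => (2%:R : K)^-1 *: (t * b2 i j e)) => w.
have two : 2%:R * beta w = \sum_i \sum_j b2 i j (cons_arg (e j) (cons_arg (e i) w)).
  have := euler_wedge frame_e w fb; rewrite -mulrBl.
  rewrite (_ : n.+2%:R - n%:R = 2%:R :> A); last first.
    by rewrite -addn2 natrD addrAC subrr add0r.
  move=> <-; apply: eq_bigr => i _.
  have := euler_wedge frame_e (cons_arg (e i) w) (f1 i).
  by rewrite -mulrBl (_ : n.+2%:R - n.+1%:R = 1 :> A) ?mul1r => [->|];
    rewrite // -[n.+2]addn1 natrD addrAC subrr add0r.
have -> : beta w = (2%:R : K)^-1 *: (2%:R * beta w).
  by rewrite mulr_natl -scaler_nat scalerA mulVf ?pnatr_eq0 // scale1r.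
rewrite two scaler_sumr; apply: eq_bigr => i _; rewrite scaler_sumr.
apply: eq_bigr => j _; rewrite /contract form_consE // -!scalerAl; congr (_ *: _).
exact: top_formE.
Qed.

(** By form_codim2 and ext_diff_contract2 the fields in LJ are exactly the sums
    of fields curl a b, and on divergence-free fields the curl is the bracket. *)
Lemma derived_eq_LJ : (forall a b, derived (L0 omega) (curl a b)) ->
  derived (L0 omega) = LJ omega.
Proof.
move=> Dcurl; apply/seteqP; split=> [v [r [c [x [y [Lxy ->]]]]]|v [eta feta vE]].
  exists (fun z => - \sum_i contract (y i) (contract ((c i)%:A *: x i) omega) z).
    have := form_sub (form_zero A n) (form_sum (index_enum _)
      (fun i => form_contract (y i) (form_contract ((c i)%:A *: x i) form_omega))).
    by congr is_form; apply/funext=> z; rewrite sub0r.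
  apply/funext=> z; rewrite ext_diffN ext_diff_sum -sumrN /contract.
  rewrite form_cons_sum //; apply: eq_bigr => i _.
  have [Lx Ly] := Lxy i; rewrite ext_diff_contract2 opprK /contract -curl_L0 //.
  by rewrite curlZl !vf_alg !scale0r subr0 addr0 form_consE.
have [g gE] := form_codim2 feta.
have -> : v = - \sum_i \sum_j curl (g i j *: e j) (e i).
  apply: contract_inj; rewrite vE; apply/funext=> z.
  have -> : eta = (fun w => \sum_i \sum_j contract (e i) (contract (g i j *: e j) omega) w).
    by apply/funext=> w; rewrite gE.
  rewrite ext_diff_sum /contract form_consN //.
  have := form_cons_sum form_omega (index_enum _) (fun=> 1)
    (fun i => \sum_j curl (g i j *: e j) (e i)) z.
  under eq_bigr do rewrite scale1r; move=> ->; rewrite -sumrN.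
  apply: eq_bigr => i _; rewrite ext_diff_sum mul1r.
  have := form_cons_sum form_omega (index_enum _) (fun=> 1)
    (fun j => curl (g i j *: e j) (e i)) z.
  under eq_bigr do rewrite scale1r; move=> ->; rewrite -sumrN.
  apply: eq_bigr => j _; rewrite mul1r.
  by have := ext_diff_contract2 (g i j *: e j) (e i) => ->.
by apply/derivedN/derived_sum => i; apply: derived_sum => j.
Qed.

End Volume.

(** * Dimension at least three *)

Ltac vector_ring := apply: vfield_ext => ?; rewrite !vE; ring.

Section HighDimension.
Variables (K : numFieldType) (A : comAlgType K) (n : nat).
Implicit Types (a b p q u v w x y : vfield A) (f g h : A).
Variables (curl : vfield A -> vfield A -> vfield A) (L : set (vfield A)).
Local Notation Dom := (derived L).
Hypothesis curlDl : forall a b v, curl (a + b) v = curl a v + curl b v.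
Hypothesis curlC : forall a b, curl a b = - curl b a.
Hypothesis curlvv : forall a, curl a a = 0.
Hypothesis curlZl : forall f a b,
  curl (f *: a) b = f *: curl a b + a f *: b - b f *: a.
Hypothesis L_curl : forall a b, L (curl a b).
Hypothesis lie_bracket_curl : forall w a b, L w ->
  lie_bracket w (curl a b) = curl (lie_bracket w a) b + curl a (lie_bracket w b).

Let curlDr a b v : curl v (a + b) = curl v a + curl v b.
Proof. by rewrite curlC curlDl opprD -!(curlC v). Qed.

Let curlZC f a b : curl (f *: a) b = curl a (f *: b).
Proof.
by rewrite curlZl [curl a (f *: b)]curlC curlZl [curl b a]curlC; vector_ring.
Qed.

Let curlNl a b : curl (- a) b = - curl a b.
Proof.
by rewrite -[- a]scaleN1r curlZl !vfN !vf1 oppr0 !scale0r addr0 subr0 scaleN1r.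
Qed.

Let curlNr a b : curl a (- b) = - curl a b.
Proof. by rewrite curlC curlNl -curlC. Qed.

(** The action of w on the bivector a /\ b, followed by curl. For w in L it is
    the bracket of w with curl a b. *)
Definition curl_lie w a b := curl (lie_bracket w a) b + curl a (lie_bracket w b).

Lemma derived_curl_lie w a b : L w -> Dom (curl_lie w a b).
Proof.
move=> Lw; rewrite /curl_lie -lie_bracket_curl //; exact: derived_bracket.
Qed.

Lemma curl_lieD v w a b : curl_lie (v + w) a b = curl_lie v a b + curl_lie w a b.
Proof. by rewrite /curl_lie !bracketDl curlDl curlDr addrACA. Qed.

Lemma curl_lieN v a b : curl_lie (- v) a b = - curl_lie v a b.
Proof.
by rewrite /curl_lie !bracketNl curlNl curlNr -opprD.
Qed.

(** The difference between curl (g *: a) b and g *: curl a b; also the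
    contraction of the bivector a /\ b with dg. *)
Definition twist a b g : vfield A := a g *: b - b g *: a.

Lemma curl_lieZ f w a b : curl_lie (f *: w) a b =
  curl_lie w (f *: a) b - curl w (twist a b f) - curl (w f *: a) b.
Proof.
rewrite /curl_lie /twist !bracketZl bracketZr !curlDl !curlDr !curlNl !curlNr.
rewrite (curlZC f a) (curlZC (a f) w) [curl w (b f *: a)]curlC (curlZC (b f) a).
vector_ring.
Qed.

Lemma twist_prod a b g h : twist a b (g * h) = g *: twist a b h + h *: twist a b g.
Proof. by apply: vfield_ext => f; rewrite /twist !(vE, vfM); ring. Qed.

(** The fields w_k = curl (k *: p) q lie in L, and w_k = twist p q k + k *: c
    with c = curl p q. Since twist p q is a derivation,
    w_(gh) = g *: w_h + h *: w_g - (g h) *: c. Hence in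
      curl_lie w_(gh) a b - curl_lie w_h (g a) b - curl_lie w_g (h a) b
        + curl_lie c (g h a) b
    only correction terms of curl_lieZ survive, and they add up to minus the sum
    below. *)
Lemma derived_twist_L p q a b g h : L p -> L q ->
  Dom (curl (twist p q h) (twist a b g) + curl (twist p q g) (twist a b h)).
Proof.
move=> Lp Lq.
have [c [w [Lc wE Lw ] ] ] : exists c, exists w : A -> vfield A,
    [/\ L c, forall k, w k = twist p q k + k *: c & forall k, L (w k)].
  exists (curl p q), (fun k => curl (k *: p) q); split=> [|k|k];
    try exact: L_curl.
  by rewrite curlZl /twist -addrA addrC.
have wM : w (g * h) = g *: w h + h *: w g - (g * h) *: c.
  by rewrite !wE twist_prod; apply: vfield_ext => f; rewrite !vE; ring.
have := derivedB (derivedB (derivedB (derived_curl_lie a b (Lw (g * h)))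
  (derived_curl_lie (g *: a) b (Lw h))) (derived_curl_lie (h *: a) b (Lw g)))
  (derivedN (derived_curl_lie ((g * h) *: a) b Lc)).
move/derivedN; congr (derived _ _).
rewrite wM !curl_lieD curl_lieN !curl_lieZ twist_prod.
rewrite (curlDr (g *: twist a b h)) -!(curlZC _ c).
have sc : curl (w h g *: a) b + curl (w g h *: a) b = curl (c (g * h) *: a) b.
  rewrite -(curlDl (w h g *: a)) -scalerDl; congr (curl (_ *: a) b).
  by rewrite !wE /twist vfM !vE; ring.
have E k l : curl (w k) (twist a b l) =
             curl (twist p q k) (twist a b l) + curl (k *: c) (twist a b l).
  by rewrite wE curlDl.
rewrite !E -sc; vector_ring.
Qed.

Hypothesis L_gen : forall v, exists (r : nat) (f : 'I_r -> A) (p : 'I_r -> vfield A),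
  (forall i, L (p i)) /\ v = \sum_i f i *: p i.

Let curl_suml (I : Type) (r : seq I) (F : I -> vfield A) b :
  curl (\sum_(i <- r) F i) b = \sum_(i <- r) curl (F i) b.
Proof.
elim: r => [|i r IH]; last by rewrite !big_cons curlDl IH.
by rewrite !big_nil -{1}(scale0r 0) curlZl vzeroE vf0 !scale0r subr0 addr0.
Qed.

Let curl_sumr (I : Type) (r : seq I) (F : I -> vfield A) a :
  curl a (\sum_(i <- r) F i) = \sum_(i <- r) curl a (F i).
Proof. by rewrite curlC curl_suml -sumrN; apply: eq_bigr => i _; rewrite -curlC. Qed.

Lemma twistC p q h : twist p q h = - twist q p h.
Proof. by rewrite /twist opprB. Qed.

Lemma twist_suml (I : Type) (r : seq I) (f : I -> A) (p : I -> vfield A) q h :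
  twist (\sum_(i <- r) f i *: p i) q h = \sum_(i <- r) f i *: twist (p i) q h.
Proof.
rewrite /twist vE scaler_suml scaler_sumr -sumrB; apply: eq_bigr => i _.
by apply: vfield_ext => k; rewrite !vE; ring.
Qed.

Lemma twistZl f p q h : twist (f *: p) q h = f *: twist p q h.
Proof. by apply: vfield_ext => k; rewrite /twist !vE; ring. Qed.

(** The sum in derived_twist_L is linear over functions in p and in q, once
    the coefficients are moved through curl by curlZC; so p and q need not lie
    in L, but only be combinations of fields in L. *)
Lemma derived_twist p q a b f g h :
  Dom (curl (twist p q h) (f *: twist a b g) + curl (twist p q g) (f *: twist a b h)).
Proof.
have genr p' q' a' : L p' ->
    Dom (curl (twist p' q' h) (twist a' b g) + curl (twist p' q' g) (twist a' b h)).
  move=> Lp; have [r [k [y [Ly ->]]]] := L_gen q'.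
  rewrite ![twist p' _ _]twistC !twist_suml !curlNl !curl_suml -opprD -big_split.
  apply/derivedN/derived_sum => i /=; rewrite !curlZC -!twistZl -[X in derived _ X]opprK.
  apply: derivedN; rewrite opprD -!curlNl -!twistC.
  by apply: derived_twist_L.
have [r [k [y [Ly ->]]]] := L_gen p.
rewrite !twist_suml !curl_suml -big_split; apply: derived_sum => i /=.
by rewrite !curlZC !scalerA -!twistZl; apply: genr.
Qed.

Variables (e : 'I_n.+2 -> vfield A) (co : 'I_n.+2 -> vfield A -> A).
Hypothesis frame_e : is_frame e co.
Hypothesis dual : forall k, exists (r : nat) (c g : 'I_r -> A),
  forall v, co k v = \sum_i c i * v (g i).

(** With a third direction k at hand and e^k = sum_s c_s dg_s, both e_i and e_j
    are contractions of the bivectors e_k /\ e_i and e_k /\ e_j with e^k. So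
    curl (e_i) (f e_j) is a double sum over s and l, and the symmetric form of
    derived_twist, with g = g_s and h = g_l, puts twice that sum in the derived
    algebra. *)
Lemma derived_curl_frame f i j k : k != i -> k != j ->
  Dom (curl (e i) (f *: e j)).
Proof.
move=> ki kj; have [r [c [g coE]]] := dual k; have [_ co_e _] := frame_e.
pose Z s l := curl (twist (e k) (e i) (g s)) ((f * c s * c l) *: twist (e k) (e j) (g l)).
have frameE l : k != l -> e l = \sum_s c s *: twist (e k) (e l) (g s).
  move=> kl; rewrite /twist.
  under eq_bigr do rewrite scalerBr !scalerA.
  by rewrite sumrB -!scaler_suml -!coE !co_e eqxx (negbTE kl) scale1r scale0r subr0.
have ZE : curl (e i) (f *: e j) = \sum_s \sum_l Z s l.
  rewrite (frameE i ki) (frameE j kj) curl_suml; apply: eq_bigr => s _.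
  rewrite scaler_sumr curl_sumr; apply: eq_bigr => l _.
  by rewrite curlZC !scalerA /Z; congr (curl _ (_ *: _)); ring.
have : Dom (\sum_s \sum_l (Z s l + Z l s)).
  apply: derived_sum => s; apply: derived_sum => l.
  have := derived_twist (e k) (e i) (e k) (e j) (f * c s * c l) (g l) (g s).
  by rewrite /Z [f * c l * c s]mulrAC.
under eq_bigr do rewrite big_split /=.
rewrite big_split /= [X in _ + X]exchange_big /= -ZE => /(derivedZ (2%:R^-1)).
congr (derived _ _); rewrite -mulr2n -scaler_nat scalerA -scalerAl mul1r.
by rewrite -(scaler_nat 2 (1 : A)) scalerA mulVf ?pnatr_eq0 // !scale1r.
Qed.

(** Only the curls of e_i and f e_j with i and j distinct matter, and in
    dimension at least three there is an index different from both. *)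
Lemma derived_curl_high a b : (0 < n)%N -> Dom (curl a b).
Proof.
move=> n_gt0; have [_ _ coE] := frame_e.
rewrite (coE a) (coE b) curl_suml; apply: derived_sum => i.
rewrite curl_sumr; apply: derived_sum => j.
rewrite curlZC scalerA; have [->|ij] := eqVneq i j.
  rewrite -curlZC curlZl curlvv scaler0 add0r subrr.
  exact: derived0.
have [k] : exists k : 'I_n.+2, k \notin [:: i; j].
  apply/existsP; rewrite -negb_forall; apply/negP => /forallP kij.
  have : (#|'I_n.+2| <= 2)%N.
    apply: (@leq_trans #|[:: i; j]|); last exact: card_size.
    by apply/subset_leq_card/fintype.subsetP => k _; exact: kij.
  by rewrite card_ord ltnS ltnNge; case: n n_gt0.
rewrite !inE negb_or => /andP[ki kj]; exact: derived_curl_frame ki kj.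
Qed.

End HighDimension.

(** * Translations and inversion on the group *)

Section Points.
Variables (K : numClosedFieldType) (m : nat) (X : linAlgGroup K m).
Local Notation A := (coordRing X).
Implicit Types (x y z : point X) (f g h : A).

Definition ev x : A -> K := fun f => eval_at f x.

Lemma coord_ext f g : (forall x, ev x f = ev x g) -> f = g.
Proof. by move=> fg; apply/val_inj/funext. Qed.

Lemma ev_is_zmod_morphism x : zmod_morphism (ev x). Proof. by []. Qed.
Lemma ev_is_monoid_morphism x : monoid_morphism (ev x). Proof. by []. Qed.
HB.instance Definition _ x := GRing.isZmodMorphism.Build A K (ev x) (ev_is_zmod_morphism x).
HB.instance Definition _ x := GRing.isMonoidMorphism.Build A K (ev x) (ev_is_monoid_morphism x).

Lemma evZ x c f : ev x (c *: f) = c * ev x f. Proof. by []. Qed.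
Lemma ev_alg x c : ev x c%:A = c. Proof. exact: mulr1. Qed.

Lemma point_unit x : val x \in unitmx.
Proof.
case: x => g /= /set_mem; have [S ->] := lag_closed X.
by case.
Qed.

Lemma regularP (F : point X -> K) :
  (exists g : A, forall x, F x = ev x g) -> F \in @regular_functions _ _ X.
Proof.
move=> [g Fg]; have -> : F = val g by apply/funext.
exact: valP.
Qed.

Lemma poly_fun_subproof (p : {mpoly K[m * m + 1]}) :
  (fun x : point X => p.@[gl_coord (val x)] : K^o) \in @regular_functions _ _ X.
Proof. by apply/asboolP; exists p. Qed.

Definition poly_fun p : A := CoordRing (poly_fun_subproof p).

Lemma poly_funE p x : ev x (poly_fun p) = p.@[gl_coord (val x)].
Proof. by []. Qed.

Lemma poly_fun_surj f : exists p, f = poly_fun p.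
Proof.
have /asboolP[p fp] := valP f.
by exists p; apply: coord_ext => x; exact: fp.
Qed.

Definition coord k : A := poly_fun 'X_k.

Lemma coordE k x : ev x (coord k) = gl_coord (val x) k.
Proof. by rewrite poly_funE mevalXU. Qed.

Lemma poly_fun_mmap p : poly_fun p = mmap (in_alg A) coord p.
Proof.
apply: coord_ext => x; rewrite poly_funE /mmap rmorph_sum mevalE.
apply: eq_bigr => mm _; rewrite rmorphM /= ev_alg; congr (_ * _).
rewrite /mmap1 rmorph_prod; apply: eq_bigr => i _.
by rewrite rmorphXn /= coordE.
Qed.

Lemma coord_ind (P : A -> Prop) :
  (forall c, P c%:A) -> (forall f g, P f -> P g -> P (f + g)) ->
  (forall f g, P f -> P g -> P (f * g)) -> (forall k, P (coord k)) ->
  forall f, P f.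
Proof.
move=> Pc PD PM Px f; have [p ->] := poly_fun_surj f.
rewrite poly_fun_mmap /mmap; apply: (big_ind P) => [||mm _];
  [by have := Pc 0; rewrite scale0r|exact: PD|].
apply: (PM _ _ (Pc _)).
rewrite /mmap1; apply: (big_ind P) => [||i _];
  [by have := Pc 1; rewrite scale1r|exact: PM|].
elim: (mm i) => [|j IH]; first by have := Pc 1; rewrite scale1r.
by rewrite exprS; apply: PM.
Qed.

Definition entries : 'M[A]_m := \matrix_(i, j) coord (lshift 1 (mxvec_index i j)).
Definition inv_det : A := coord (rshift (m * m) ord0).

Lemma entriesE x : map_mx (ev x) entries = val x.
Proof.
by apply/matrixP=> i j; rewrite !mxE coordE /gl_coord row_mxEl mxvecE.
Qed.

Lemma ev_entries x i j : ev x (entries i j) = val x i j.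
Proof. by have := congr1 (fun M : 'M_m => M i j) (entriesE x); rewrite mxE. Qed.

Lemma inv_detE x : ev x inv_det = (\det (val x))^-1.
Proof. by rewrite coordE /gl_coord row_mxEr mxE eqxx mulr1n. Qed.

(** The generators of the coordinate ring, in matrix form: comultiplication and
    antipode only have to be found for the entries and for 1 / det. *)
Lemma coord_cases k :
  (exists i j, coord k = entries i j) \/ coord k = inv_det.
Proof.
case: (splitP k) => [k' kk'|k' kk'].
  case/mxvec_indexP: k' kk' => i j kk'; left; exists i, j; rewrite mxE.
  by congr coord; apply/val_inj.
by right; congr coord; apply/val_inj; rewrite /= kk' (ord1 k').
Qed.

Definition pone : point X := exist _ 1%:M (mem_set (lag_one X)).
Definition pmul x y : point X :=
  exist _ (val x *m val y) (mem_set (lag_mul (set_mem (valP x)) (set_mem (valP y)))).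
Definition pinv x : point X :=
  exist _ (invmx (val x)) (mem_set (lag_inv (set_mem (valP x)))).

Lemma pmulA x y z : pmul x (pmul y z) = pmul (pmul x y) z.
Proof. by apply/val_inj; rewrite /= mulmxA. Qed.
Lemma pmul1p x : pmul pone x = x.
Proof. by apply/val_inj; rewrite /= mul1mx. Qed.
Lemma pmulp1 x : pmul x pone = x.
Proof. by apply/val_inj; rewrite /= mulmx1. Qed.
Lemma pmulVp x : pmul (pinv x) x = pone.
Proof. by apply/val_inj; rewrite /= mulVmx ?point_unit. Qed.
Lemma pmulpV x : pmul x (pinv x) = pone.
Proof. by apply/val_inj; rewrite /= mulmxV ?point_unit. Qed.
Lemma pinvK x : pinv (pinv x) = x.
Proof. by apply/val_inj; rewrite /= invmxK. Qed.

(** That multiplication is a morphism of varieties, in the form of a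
    decomposition f(x y) = sum a_i(x) b_i(y). *)
Lemma comult f : exists s : seq (A * A), forall x y,
  ev (pmul x y) f = \sum_(p <- s) ev x p.1 * ev y p.2.
Proof.
elim/coord_ind: f => [c|f g [s fs] [s' gs]|f g [s fs] [s' gs]|k].
- by exists [:: (c%:A, 1)] => x y; rewrite big_seq1 /= !ev_alg rmorph1 mulr1.
- by exists (s ++ s') => x y; rewrite big_cat rmorphD /= fs gs.
- exists [seq (p.1 * q.1, p.2 * q.2) | p <- s, q <- s'] => x y.
  rewrite big_allpairs_dep rmorphM /= fs gs /= mulr_suml; apply: eq_bigr => p _.
  rewrite mulr_sumr; apply: eq_bigr => q _; rewrite /= !rmorphM; ring.
have [[i [j ->]]| ->] := coord_cases k; last first.
  exists [:: (inv_det, inv_det)] => x y; rewrite big_seq1 !inv_detE /=.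
  by rewrite det_mulmx invfM.
exists [seq (entries i l, entries l j) | l <- index_enum 'I_m] => x y.
rewrite ev_entries big_map /= mxE; apply: eq_bigr => l _.
by rewrite !ev_entries.
Qed.

Lemma antipode_subproof f : (fun x => ev (pinv x) f : K^o) \in @regular_functions _ _ X.
Proof.
apply: regularP; elim/coord_ind: f => [c|f g [f' ff'] [g' gg']|f g [f' ff'] [g' gg']|k].
- by exists c%:A => x; rewrite !ev_alg.
- by exists (f' + g') => x; rewrite !rmorphD /= ff' gg'.
- by exists (f' * g') => x; rewrite !rmorphM /= ff' gg'.
have [[i [j ->]]| ->] := coord_cases k; last first.
  exists (\det entries) => x; rewrite inv_detE /= det_inv invrK.
  by rewrite -det_map_mx entriesE.
exists (inv_det * (\adj entries) i j) => x.
rewrite rmorphM /= inv_detE ev_entries /= /invmx point_unit mxE; congr (_ * _).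
by rewrite -(entriesE x) -map_mx_adj mxE.
Qed.

Definition antipode f : A := CoordRing (antipode_subproof f).
Lemma ev_antipode x f : ev x (antipode f) = ev (pinv x) f.
Proof. by []. Qed.

Lemma rtrans_subproof y f : (fun x => ev (pmul x y) f : K^o) \in @regular_functions _ _ X.
Proof.
have [s fs] := comult f; apply: regularP.
exists (\sum_(p <- s) ev y p.2 *: p.1) => x.
by rewrite fs rmorph_sum; apply: eq_bigr => p _ /=; rewrite evZ mulrC.
Qed.

Lemma ltrans_subproof y f : (fun x => ev (pmul y x) f : K^o) \in @regular_functions _ _ X.
Proof.
have [s fs] := comult f; apply: regularP.
exists (\sum_(p <- s) ev y p.1 *: p.2) => x.
by rewrite fs rmorph_sum; apply: eq_bigr => p _ /=; rewrite evZ.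
Qed.

Definition rtrans y f : A := CoordRing (rtrans_subproof y f).
Definition ltrans y f : A := CoordRing (ltrans_subproof y f).

Lemma ev_rtrans x y f : ev x (rtrans y f) = ev (pmul x y) f. Proof. by []. Qed.
Lemma ev_ltrans x y f : ev x (ltrans y f) = ev (pmul y x) f. Proof. by []. Qed.

End Points.

(** * Prime ideals and the Nullstellensatz *)

Section PrimeIdeals.
Variable A : comNzRingType.
Implicit Types (I J P S : set A).

(** The last clause is the maximality of P among the ideals that avoid S. When
    S is multiplicative it makes P prime, and it says that every a outside P
    becomes invertible modulo P after inverting S. *)
Definition prime_off S P :=
  [/\ is_ideal P, forall s, S s -> ~ P s &
      forall a, ~ P a -> exists p b, P p /\ S (p + a * b)].

Lemma exists_prime_off J S :
  is_ideal J -> S 1 -> (forall s, S s -> ~ J s) ->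
  exists P, J `<=` P /\ prime_off S P.
Proof.
move=> iJ S1 SJ.
pose good I := [/\ is_ideal I, J `<=` I & forall s, S s -> ~ I s].
have [F FQ totF|P [PQ Pmax]] := @Zorn_bigcup A (fun I => I = set0 \/ good I).
  have [F0|] := pselect (forall I, F I -> I = set0).
    left; apply/seteqP; split=> // a [I FI Ia].
    by have := Ia; rewrite (F0 _ FI).
  move=> /existsNP[I0 /not_implyP[FI0 I0n]]; right.
  have gF I a : F I -> I a -> good I.
    by move=> FI Ia; case: (FQ _ FI) => // I0'; rewrite I0' in Ia.
  have gI0 : good I0 by case: (FQ _ FI0).
  split.
  - split=> [|a u v [I FI Iu] [I' FI' I'v]].
      by exists I0 => //; case: gI0 => -[].
    have [II'|I'I] := totF _ _ FI FI'.
      by exists I' => //; case: (gF _ _ FI' I'v) => -[_ l] _ _; apply: l => //; apply: II'.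
    by exists I => //; case: (gF _ _ FI Iu) => -[_ l] _ _; apply: l => //; apply: I'I.
  - by move=> a Ja; exists I0 => //; case: gI0 => _ JI _; apply: JI.
  - by move=> s Ss [I FI Is]; case: (gF _ _ FI Is) => _ _ /(_ s Ss).
have gJ : good J by split.
have [iP JP SP] : good P.
  case: PQ => // P0; exfalso; apply: (Pmax J); last by right.
  by rewrite P0; split=> // /(_ 0) J0; apply: J0; case: iJ.
exists P; split=> //; split=> // a Pa.
pose I := [set x | exists p b, P p /\ x = p + a * b].
have iI : is_ideal I.
  split; first by exists 0, 0; rewrite mulr0 addr0; split=> //; case: iP.
  move=> c u v [p [b [Pp ->]]] [p' [b' [Pp' ->]]].
  exists (c * p + p'), (c * b + b'); split; last by ring.
  by case: iP => _; apply.
have PI : P `<=` I by move=> p Pp; exists p, 0; rewrite mulr0 addr0.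
have : ~ (good I).
  move=> gI; apply: (Pmax I); last by right.
  split=> // /(_ a) IP; apply: Pa; apply: IP.
  by exists 0, 1; rewrite mulr1 add0r; split=> //; case: iP.
have [[s [Ss Is]] _|nS] := pselect (exists s, S s /\ I s).
  by case: Is => p [b [Pp sE]]; exists p, b; rewrite -sE.
case; split=> //; first by apply: subset_trans JP PI.
by move=> s Ss Is; apply: nS; exists s.
Qed.

Lemma prime_offM S P a b : (forall s s', S s -> S s' -> S (s * s')) ->
  prime_off S P -> P (a * b) -> P a \/ P b.
Proof.
move=> SM [iP SP Pmax] Pab; apply: contrapT => /not_orP[/Pmax[p [u [Pp Su]]]].
move=> /Pmax[q [v [Pq Sv]]]; apply: (SP _ (SM _ _ Su Sv)).
have -> : (p + a * u) * (q + b * v) =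
   (q + b * v) * p + ((a * u) * q + (u * v) * (a * b)) by ring.
by do 3![apply: iP.2 => //|apply: idealM => //].
Qed.

End PrimeIdeals.

Lemma scale_combE (K : fieldType) (A : comAlgType K) (c : K) (u h w y : A) :
  c *: (u * (h - y * w)) = h * (c *: u) - (y * u) * (c *: w).
Proof. by rewrite -!scalerAr -scalerBr; congr (_ *: _); ring. Qed.

Section PolynomialsModPrime.
Variables (K : closedFieldType) (A : comAlgType K) (P : set A).
Hypotheses (iP : is_ideal P) (primeP : forall a b, P (a * b) -> P a \/ P b).
Hypothesis P1 : ~ P 1.

Lemma ideal_const c : P c%:A -> c = 0.
Proof.
move=> Pc; apply/eqP/negP => /negP c0; apply: P1.
have -> : 1 = c^-1%:A * c%:A :> A by rewrite -scalerAl mul1r scalerA mulVf // scale1r.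
exact: idealM.
Qed.

Lemma root_mod_prime (q : {poly K}) a : q != 0 -> P (horner_alg a q) ->
  exists c, P (a - c%:A).
Proof.
move: {2}(size q) (leqnn (size q)) => n; elim: n q => [|n IH] q.
  by rewrite leqn0 size_poly_eq0 => /eqP->; rewrite eqxx.
move=> sq q0 Pq; have [sq1|sq1] := eqVneq (size q) 1%N.
  have := size1_polyC (eq_leq sq1) => qC; move: Pq q0; rewrite qC horner_algC.
  by move=> /ideal_const ->; rewrite eqxx.
have /closed_rootP[c /factor_theorem[r qE]] := sq1.
have r0 : r != 0 by apply: contra q0 => /eqP r0; rewrite qE r0 mul0r.
move: Pq; rewrite qE rmorphM /= rmorphB /= horner_algX horner_algC.
case/primeP; last by exists c.
apply: IH => //; move: sq; rewrite qE size_Mmonic ?monicXsubC // size_XsubC.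
by rewrite addn2.
Qed.

End PolynomialsModPrime.

(** The consequence of uncountability that is used: a map to a countable set
    has an infinite fibre. *)
Definition infinite_fibre (T : eqType) := forall kappa : T -> nat, exists v,
  forall N, exists s : seq T,
    [/\ uniq s, size s = N & forall c, c \in s -> kappa c = v].

Section Nullstellensatz.
Variables (K : numClosedFieldType) (m : nat) (X : linAlgGroup K m).
Local Notation A := (coordRing X).
Local Notation q := (m * m + 1)%N.

Hypothesis uncountableK : infinite_fibre K.

(** Here P is maximal among the ideals that avoid the powers of h. If a were
    congruent to no constant, every a - c would divide a power of h modulo P,
    say with cofactor b_c. Uncountably many c share one exponent k0 and one
    bound on the degree of b_c, so some of these b_c satisfy a linear relation
    sum_i al_i b_(c_i) = 0. Multiplied by the product of all a - c_j, it reads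
    h^k0 r(a) = 0 modulo P for the polynomial
    r = sum_i al_i prod_(j != i) ('X - c_j), which is not zero; so a is congruent
    to a root of r after all. *)
Lemma residue_field (P : set A) (h a : A) :
  is_ideal P -> (forall a b, P (a * b) -> P a \/ P b) -> ~ P 1 ->
  (forall a, ~ P a -> exists p b, P p /\ exists k, p + a * b = h ^+ k) ->
  ~ P h -> exists c, P (a - c%:A).
Proof.
move=> iP primeP P1 Pmax Ph; apply: contrapT => Pa.
have /choice[b /choice[k hb]] c : exists b : {mpoly K[q]}, exists k : nat,
    P (h ^+ k - (a - c%:A) * poly_fun X b).
  have [|p [b [Pp [k hk]]]] := Pmax (a - c%:A); first by move=> Pc; apply: Pa; exists c.
  have [pb bq] := poly_fun_surj b; exists pb, k.
  by rewrite -hk -bq addrK.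
have [k0 [d0 fib]] : exists k0 d0, forall N, exists s : seq K,
    [/\ uniq s, size s = N & forall c, c \in s -> k c = k0 /\ (msize (b c) <= d0)%N].
  have [v fib] := uncountableK (fun c => pickle (k c, msize (b c))).
  have [s1 [_ ss1 v0]] := fib 1%N; case: s1 ss1 v0 => // c0 s1 _ v0.
  exists (k c0), (msize (b c0)) => N; have [s [us ss vs]] := fib N.
  exists s; split=> // c /vs; rewrite -(v0 c0) ?mem_head //.
  by move=> /(pcan_inj pickleK) [-> ->].
(* One more c than there are monomials forces a linear relation between the b_c. *)
pose nmon := #|{: 'X_{1..q < d0}}|.
have [s [us ss vs]] := fib nmon.+1.
have vi (i : 'I_nmon.+1) : k (nth 0%R s i) = k0 /\ (msize (b (nth 0%R s i)) <= d0)%N.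
  by apply: vs; apply: mem_nth; rewrite ss.
pose M := \matrix_(i < nmon.+1, j < nmon)
  (b (nth 0%R s i))@_(enum_val j : 'X_{1..q < d0}).
have [al al0 alM] : exists2 al : 'rV[K]_nmon.+1, al != 0 & al *m M = 0.
  have kM : kermx M != 0.
    by rewrite kermx_eq0 /row_free neq_ltn ltnS rank_leq_col.
  by have /rowV0Pn[al /sub_kermxP ? ?] := kM; exists al.
have sumb : \sum_i al 0 i *: b (nth 0%R s i) = 0.
  apply/mpolyP => mm; rewrite mcoeff0 raddf_sum /=.
  have [mlt|mge] := ltnP (mdeg mm) d0; last first.
    apply: big1 => i _; rewrite mcoeffZ memN_msupp_eq0 ?mulr0 //.
    apply/negP => /msize_mdeg_lt; rewrite ltnNge.
    by have [_ le] := vi i; rewrite (leq_trans le).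
  have := congr1 (fun B : 'rV_ _ => B 0 (enum_rank (BMultinom mlt))) alM.
  rewrite !mxE => E0; rewrite -[RHS]E0; apply: eq_bigr => i _.
  by rewrite mcoeffZ !mxE enum_rankK.
pose pr (I : pred 'I_nmon.+1) : {poly K} := \prod_(j | I j) ('X - (nth 0%R s j)%:P).
pose r := \sum_i al 0 i *: pr (predC1 i).
have r0 : r != 0.
  have /rV0Pn[i ali] := al0.
  apply/eqP => /(congr1 (fun p : {poly K} => p.[nth 0%R s i])); rewrite horner0 horner_sum.
  rewrite (bigD1 i) //= big1 => [|j ji].
    rewrite addr0 hornerZ horner_prod => /eqP; rewrite mulf_eq0 (negbTE ali) /=.
    move=> /prodf_eq0[j ji]; rewrite hornerXsubC subr_eq0 nth_uniq ?ss //.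
    by rewrite (inj_eq val_inj) eq_sym (negbTE ji).
  rewrite hornerZ horner_prod (bigD1 i) /= 1?eq_sym //.
  by rewrite hornerXsubC subrr mul0r mulr0.
apply: Pa; apply: (root_mod_prime iP primeP P1 r0).
have hZ (c : K) p : horner_alg a (c *: p) = c *: horner_alg a p.
  by rewrite -mul_polyC rmorphM /= horner_algC mulr_algl.
have prT (i : 'I_nmon.+1) : horner_alg a (pr predT) =
    (a - (nth 0%R s i)%:A) * horner_alg a (pr (predC1 i)).
  have -> : pr predT = ('X - (nth 0%R s i)%:P) * pr (predC1 i).
    by rewrite /pr (bigD1 i).
  by rewrite rmorphM /= rmorphB /= horner_algX horner_algC.
have : P (h ^+ k0 * horner_alg a r).
  rewrite rmorph_sum mulr_sumr /=.
  have -> : \sum_i h ^+ k0 * horner_alg a (al 0 i *: pr (predC1 i)) =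
     \sum_i al 0 i *: (horner_alg a (pr (predC1 i)) *
        (h ^+ k0 - (a - (nth 0%R s i)%:A) * poly_fun X (b (nth 0%R s i)))).
    have E i : al 0 i *: (horner_alg a (pr (predC1 i)) *
        (h ^+ k0 - (a - (nth 0%R s i)%:A) * poly_fun X (b (nth 0%R s i)))) =
        h ^+ k0 * horner_alg a (al 0 i *: pr (predC1 i)) -
        horner_alg a (pr predT) * (al 0 i *: poly_fun X (b (nth 0%R s i))).
      by rewrite (prT i) hZ scale_combE.
    under [RHS]eq_bigr do rewrite E.
    have S0 : \sum_i (al 0 i *: poly_fun X (b (nth 0%R s i)) : A) = 0.
      apply: coord_ext => x; rewrite raddf_sum rmorph0 /=.
      have := congr1 (fun p => p.@[gl_coord (val x)]) sumb.
      rewrite raddf_sum /= meval0 => E'; rewrite -[RHS]E'; apply: eq_bigr => i _.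
      by rewrite mevalZ.
    rewrite sumrB; apply/esym/subr0_eq; rewrite addrAC subrr add0r.
    by rewrite -mulr_sumr S0 mulr0 oppr0.
  apply: ideal_sum => // i _; rewrite -mulr_algl; do 2!apply: idealM => //.
  by have [<- _] := vi i; exact: hb.
case/primeP => //; elim: (k0) => [|j IH]; first by rewrite expr0.
by rewrite exprS => /primeP[].
Qed.

(** Modulo a prime that is maximal among the ideals containing J and avoiding
    the powers of h, the ring is K by residue_field. The residues of the
    coordinate functions are the coordinates of a matrix, which satisfies the
    equations of X and is the point sought. *)
Theorem nullstellensatz (J : set A) (h : A) :
  is_ideal J -> (forall k, ~ J (h ^+ k)) ->
  exists x : point X, (forall f, J f -> ev x f = 0) /\ ev x h != 0.
Proof.
move=> iJ hJ; pose S := [set s | exists k, s = h ^+ k].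
have [||P [JP Poff]] := exists_prime_off iJ (S := S).
- by exists 0%N; rewrite expr0.
- by move=> _ [k ->].
have primeP a b : P (a * b) -> P a \/ P b.
  apply: prime_offM Poff => _ _ [k ->] [l ->].
  by exists (k + l)%N; rewrite exprD.
have [iP SP Pmax] := Poff.
have P1 : ~ P 1 by apply: SP; exists 0%N; rewrite expr0.
have Ph : ~ P h by apply: SP; exists 1%N; rewrite expr1.
have /choice[phi phiP] a : exists c : K, P (a - c%:A).
  exact: residue_field iP primeP P1 Pmax Ph.
have phi_uniq a c : P (a - c%:A) -> phi a = c.
  move=> Pac; apply/eqP; rewrite -subr_eq0; apply/eqP; apply: (ideal_const iP P1).
  have := idealB iP Pac (phiP a); congr P.
  by rewrite scalerBl; ring.
have phiB : zmod_morphism phi.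
  move=> a b; apply: phi_uniq; have := idealB iP (phiP a) (phiP b); congr P.
  by rewrite scalerBl; ring.
have phiM : monoid_morphism phi.
  split=> [|a b]; apply: phi_uniq; first by rewrite scale1r subrr; case: iP.
  have := idealD iP (idealM b iP (phiP a)) (idealM (phi a)%:A iP (phiP b)).
  by congr P; rewrite -(scalerA _ (phi b)) -[_ *: (phi b)%:A]mulr_algl; ring.
pose phiZ := GRing.isZmodMorphism.Build A K phi phiB.
pose phiR := GRing.isMonoidMorphism.Build A K phi phiM.
pose psi : {rmorphism A -> K} := HB.pack phi phiZ phiR.
have psiC c : psi c%:A = c by apply: phi_uniq; rewrite subrr; case: iP.
have psiE p : psi (poly_fun X p) = p.@[fun k => psi (coord X k)].
  rewrite poly_fun_mmap /mmap rmorph_sum mevalE; apply: eq_bigr => mm _.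
  rewrite rmorphM; congr (_ * _); first exact: psiC.
  by rewrite /mmap1 rmorph_prod; apply: eq_bigr => i _; rewrite rmorphXn.
pose g : 'M[K]_m := map_mx psi (entries X).
have detg : \det g = psi (\det (entries X)) by rewrite det_map_mx.
have det1 : psi (inv_det X) * \det g = 1.
  rewrite detg -rmorphM (_ : _ * _ = 1) ?rmorph1 //; apply: coord_ext => x.
  rewrite rmorphM rmorph1 /= inv_detE -det_map_mx entriesE mulVf //.
  by have := point_unit x; rewrite unitmxE unitfE.
have gU : g \in unitmx.
  rewrite unitmxE unitfE; apply/eqP => d0; have := oner_eq0 K.
  by rewrite -det1 d0 mulr0 eqxx.
have coordg k : psi (coord X k) = gl_coord g k.
  rewrite -[k]splitK; case: (fintype.split k) => k' /=.
    by case/mxvec_indexP: k' => i j; rewrite /gl_coord row_mxEl mxvecE !mxE.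
  rewrite (ord1 k') /gl_coord row_mxEr mxE eqxx mulr1n; apply: (mulIf (x := \det g)).
    by rewrite -unitfE -unitmxE.
  by rewrite mulVf -?unitfE -?unitmxE.
have [S' XE] := lag_closed X.
have gX : lag_set X g.
  rewrite XE; split=> // p S'p.
  have <- : psi (poly_fun X p) = 0.
    rewrite (_ : poly_fun X p = 0) ?rmorph0 //; apply: coord_ext => x.
    have XS g' : lag_set X g' -> p.@[gl_coord g'] = 0 by rewrite XE => -[_]; apply.
    move: (XS _ (set_mem (valP x))).
    by rewrite poly_funE rmorph0.
  by rewrite psiE; apply: meval_eq => k; rewrite coordg.
pose x : point X := exist _ g (mem_set gX).
have evx f : ev x f = psi f.
  have [p ->] := poly_fun_surj f.
  by rewrite psiE poly_funE; apply: meval_eq => k; rewrite coordg.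
have phi0 f : phi f = 0 -> P f.
  by move=> f0; have := phiP f; rewrite f0 scale0r subr0.
exists x; split=> [f /JP Pf|]; first by rewrite evx; apply: phi_uniq; rewrite scale0r subr0.
by rewrite evx; apply/eqP => /phi0.
Qed.

End Nullstellensatz.

(** * Extension of derivations and generic points *)

Section DerivationExtension.
Variable Q : comNzRingType.
Hypothesis domQ : forall x y : Q, x * y = 0 -> x = 0 \/ y = 0.
Hypothesis charQ : forall n, n.+1%:R != 0 :> Q.
Implicit Types (E : set Q) (delta : Q -> Q).

Definition is_subring E :=
  [/\ E 1, forall x y, E x -> E y -> E (x - y) & forall x y, E x -> E y -> E (x * y)].

(** Derivations are only required to be defined on a subring, their values
    outside of it being junk. *)
Definition derivation_on E delta :=
  (forall x y, E x -> E y -> delta (x + y) = delta x + delta y) /\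
  (forall x y, E x -> E y -> delta (x * y) = delta x * y + x * delta y).

Definition adjoin E a : set Q :=
  [set y | exists p : {poly Q}, (forall i, E p`_i) /\ y = p.[a]].

Section Adjoin.
Variables (E : set Q) (delta : Q -> Q) (a : Q).
Hypotheses (subE : is_subring E) (derE : derivation_on E delta).

Let E1 : E 1. Proof. by case: subE. Qed.
Let EB x y : E x -> E y -> E (x - y). Proof. by case: subE => _ h _; apply: h. Qed.
Let EM x y : E x -> E y -> E (x * y). Proof. by case: subE => _ _; apply. Qed.
Let E0 : E 0. Proof. by rewrite -(subrr 1); apply: EB. Qed.
Let EN x : E x -> E (- x). Proof. by rewrite -sub0r; apply: EB. Qed.
Let ED x y : E x -> E y -> E (x + y).
Proof. by move=> Ex Ey; rewrite -[y]opprK; apply: EB => //; apply: EN. Qed.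
Let Esum (I : Type) (r : seq I) (F : I -> Q) : (forall i, E (F i)) -> E (\sum_(i <- r) F i).
Proof. by move=> EF; apply: big_ind. Qed.
Let dD x y : E x -> E y -> delta (x + y) = delta x + delta y.
Proof. by case: derE => h _; apply: h. Qed.
Let dM x y : E x -> E y -> delta (x * y) = delta x * y + x * delta y.
Proof. by case: derE => _ h; apply: h. Qed.
Let d0 : delta 0 = 0.
Proof. by apply: (addIr (delta 0)); rewrite -dD // !add0r. Qed.
Let dsum (I : Type) (r : seq I) (F : I -> Q) : (forall i, E (F i)) ->
  delta (\sum_(i <- r) F i) = \sum_(i <- r) delta (F i).
Proof.
move=> EF; elim: r => [|i r IH]; first by rewrite !big_nil.
by rewrite !big_cons dD ?IH //; apply: Esum.
Qed.

Let polyE (p : {poly Q}) := forall i, E p`_i.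

Let polyEB p q : polyE p -> polyE q -> polyE (p - q).
Proof. by move=> Ep Eq i; rewrite coefB; apply: EB. Qed.
Let polyED p q : polyE p -> polyE q -> polyE (p + q).
Proof. by move=> Ep Eq i; rewrite coefD; apply: ED. Qed.
Let polyEM p q : polyE p -> polyE q -> polyE (p * q).
Proof. by move=> Ep Eq i; rewrite coefM; apply: Esum => j; apply: EM. Qed.
Let polyEC x : E x -> polyE x%:P.
Proof. by move=> Ex i; rewrite coefC; case: ifP. Qed.
Let polyEX : polyE 'X.
Proof. by move=> i; rewrite coefX; case: eqP. Qed.
Let polyED' p : polyE p -> polyE p^`().
Proof.
move=> Ep i; rewrite coef_deriv; move: p`_i.+1 (Ep i.+1) => x Ex.
elim: i.+1 => [|k IH]; first by rewrite mulr0n.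
by rewrite mulrS; apply: ED.
Qed.

Let hat p := map_poly delta p.
Let coef_hat p i : (hat p)`_i = delta p`_i. Proof. exact: coef_map_id0. Qed.
Let hatD p q : polyE p -> polyE q -> hat (p + q) = hat p + hat q.
Proof. by move=> Ep Eq; apply/polyP=> i; rewrite coefD !coef_hat coefD dD. Qed.
Let hatM p q : polyE p -> polyE q -> hat (p * q) = hat p * q + p * hat q.
Proof.
move=> Ep Eq; apply/polyP=> i; rewrite coef_hat coefD !coefM dsum => [|j]; last exact: EM.
by rewrite -big_split; apply: eq_bigr => j _; rewrite dM // !coef_hat.
Qed.
Let hatC x : hat x%:P = (delta x)%:P.
Proof. by apply/polyP=> i; rewrite coef_hat !coefC; case: ifP. Qed.

(** Put delta'(p(a)) = d (hat p)(a) + c p'(a), where hat applies delta to the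
    coefficients. If a is transcendental over E, take d = 1 and c = 0. Otherwise
    take a nonzero polynomial p0 of least degree with p0(a) = 0, d = p0'(a), which
    does not vanish in characteristic zero, and c = - (hat p0)(a); then delta' kills
    p0, and, by pseudo-division by p0, all relations. Denominators are cleared
    instead of being inverted, so that delta' extends d delta only. *)
Lemma derivation_adjoin : exists d delta', [/\ d != 0, is_subring (adjoin E a),
  derivation_on (adjoin E a) delta' & forall x, E x -> delta' x = d * delta x].
Proof.
have subEa : is_subring (adjoin E a).
  split; first by exists 1; rewrite hornerC; split=> //; apply: polyEC.
    move=> _ _ [p [Ep ->]] [q [Eq ->]]; exists (p - q).
    by rewrite hornerD hornerN; split=> //; apply: polyEB.
  by move=> _ _ [p [Ep ->]] [q [Eq ->]]; exists (p * q); rewrite hornerM; split=> //; apply: polyEM.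
have [d [c [dn0 kil]]] : exists d c, d != 0 /\ forall p, polyE p -> p.[a] = 0 ->
    d * (hat p).[a] + c * p^`().[a] = 0.
  have [[p0 [Ep0 [p0n0 p0a]]]|nalg] :=
    pselect (exists p : {poly Q}, polyE p /\ p != 0 /\ p.[a] = 0); last first.
    exists 1, 0; split=> [|p Ep pa]; first exact: oner_neq0.
    have -> : p = 0 by apply: contrapT => /eqP pn0; apply: nalg; exists p.
    by rewrite /hat map_poly0 deriv0 !horner0 !mulr0 addr0.
  have [p [Ep [pn0 pa]] pmin] : exists2 p : {poly Q}, polyE p /\ p != 0 /\ p.[a] = 0 &
      forall q, polyE q -> q.[a] = 0 -> (size q < size p)%N -> q = 0.
    move: {2}(size p0) (leqnn (size p0)) => n.
    elim: n p0 Ep0 p0n0 p0a => [|n IH] p Ep pn0 pa sp.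
      by move: sp; rewrite leqn0 size_poly_eq0 (negbTE pn0).
    have [[q [Eq [qa [qn0 sq]]]]|nq] := pselect (exists q : {poly Q},
      polyE q /\ q.[a] = 0 /\ q != 0 /\ (size q < size p)%N).
      by apply: (IH q) => //; rewrite -ltnS (leq_trans sq).
    exists p => // q Eq qa sq; apply: contrapT => /eqP qn0; apply: nq.
    by exists q.
  exists p^`().[a], (- (hat p).[a]); split.
    apply/eqP => p'a; have p'0 : p^`() = 0.
      by apply: pmin => //; [exact: polyED'|exact: lt_size_deriv].
    have pC : p = (p`_0)%:P.
      apply/polyP=> -[|i]; rewrite coefC //=.
      have := congr1 (fun r : {poly Q} => r`_i) p'0.
      rewrite coef_deriv coef0 -mulr_natl => /domQ[/eqP|//].
      by rewrite (negbTE (charQ i)).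
    have p00 : p`_0 = 0 by rewrite -[LHS](hornerC _ a) -pC.
    by move: pn0; rewrite pC p00 polyC0 eqxx.
  move=> q Eq; have [n] := ubnP (size q); elim: n q Eq => // n IH q Eq sq qa.
  have [sqp|spq] := ltnP (size q) (size p).
    by rewrite (pmin q) // /hat map_poly0 deriv0 !horner0 !mulr0 addr0.
  have [-> |qn0] := eqVneq q 0; first by rewrite /hat map_poly0 deriv0 !horner0 !mulr0 addr0.
  pose l := lead_coef p; pose t := (lead_coef q)%:P * 'X^(size q - size p).
  have Et : polyE t.
    apply: polyEM; first exact/polyEC/Eq.
    elim: (_ - _)%N => [|j IHj]; first by rewrite expr0; apply: polyEC.
    by rewrite exprS; apply: polyEM.
  have l0 : l != 0 by rewrite lead_coef_eq0.
  (* One step of the pseudo-division of q by p. *)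
  pose r := l%:P * q - t * p.
  have Er : polyE r by apply: polyEB; apply: polyEM => //; apply/polyEC/Ep.
  have ra : r.[a] = 0 by rewrite !hornerE qa pa; ring.
  have sr : (size r < n)%N.
    apply: leq_trans (_ : size q <= n)%N => //.
    have sp0 : (0 < size p)%N by rewrite size_poly_gt0.
    have sq0 : (0 < size q)%N by rewrite size_poly_gt0.
    rewrite -[X in (_ < X)%N](prednK sq0) ltnS; apply/leq_sizeP => j.
    rewrite leq_eqVlt => /predU1P[<-|jq]; rewrite coefB coefCM -mulrA coefCM coefXnM.
      rewrite ltn_subRL; have -> : (size p + (size q).-1 < size q)%N = false.
        by apply/negbTE; rewrite -leqNgt -(prednK sp0) addSn -[X in (X <= _)%N](prednK sq0)
          ltnS leq_addl.
      have -> : ((size q).-1 - (size q - size p))%N = (size p).-1.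
        by rewrite -!subn1 subnAC subKn.
      by rewrite -!lead_coefE mulrC subrr.
    rewrite (nth_default 0 (s := q)); last by rewrite -(prednK sq0).
    case: ifP => _; rewrite ?mulr0 ?subr0 //.
    rewrite [p`__]nth_default ?mulr0 ?subr0 // leq_subRL; last first.
      by rewrite (leq_trans _ (ltnW jq)) // -ltnS prednK // ltn_subrL sp0 sq0.
    by rewrite subnK // -(prednK sq0).
  have := IH r Er sr ra; rewrite /r.
  have hatN u : polyE u -> hat (- u) = - hat u.
    move=> Eu; apply/polyP=> i; rewrite coefN !coef_hat coefN.
    by apply: (addrI (delta u`_i)); rewrite -dD ?subrr //; apply: EN.
  have El : E l := Ep _.
  have EC : polyE l%:P by exact: polyEC.
  have Etp : polyE (t * p) by exact: polyEM.
  have ENtp : polyE (- (t * p)) by move=> i; rewrite coefN; apply: EN.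
  rewrite (hatD (polyEM EC Eq) ENtp) (hatN _ Etp) (hatM EC Eq) (hatM Et Ep).
  rewrite hatC derivB !derivM derivC !hornerE qa pa => h.
  have : l * (p^`().[a] * (hat q).[a] + - (hat p).[a] * q^`().[a]) = 0.
    by rewrite -[RHS]h; ring.
  by case/domQ => // l0'; rewrite l0' eqxx in l0.
pose Dl p := d * (hat p).[a] + c * p^`().[a].
have DlE p q : polyE p -> polyE q -> p.[a] = q.[a] -> Dl p = Dl q.
  move=> Ep Eq pq; have := kil (p - q) (polyEB Ep Eq).
  rewrite hornerD hornerN pq subrr => /(_ erefl).
  have -> : hat (p - q) = hat p - hat q.
    apply/eqP; rewrite -subr_eq0 opprB addrA; apply/eqP.
    have := hatD (polyEB Ep Eq) Eq; rewrite subrK => ->; ring.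
  rewrite derivB !hornerD !hornerN /Dl => h.
  by apply/eqP; rewrite -subr_eq0; apply/eqP; rewrite -[RHS]h; ring.
have /choice[ch chP] y : exists p : {poly Q}, adjoin E a y -> polyE p /\ y = p.[a].
  have [[p Py]|ny] := pselect (adjoin E a y); first by exists p.
  by exists 0.
exists d, (fun y => Dl (ch y)).
have DlP p : polyE p -> Dl (ch p.[a]) = Dl p.
  move=> Ep; have [|Ec ec] := chP p.[a]; first by exists p.
  by apply: DlE.
split=> // [|x Ex].
  split=> _ _ [p [Ep ->]] [q [Eq ->]].
    rewrite -hornerD !DlP //; last exact: polyED.
    by rewrite /Dl hatD // derivD !hornerD; ring.
  rewrite -hornerM !DlP //; last exact: polyEM.
  by rewrite /Dl hatM // derivM !hornerE; ring.
rewrite -{1}(hornerC x a) DlP; last exact: polyEC.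
by rewrite /Dl hatC derivC !hornerC ?horner0 mulr0 addr0.
Qed.

End Adjoin.

Lemma derivation_adjoin_seq E delta (s : seq Q) :
  is_subring E -> derivation_on E delta ->
  exists d E' delta', [/\ d != 0, is_subring E', derivation_on E' delta' &
    [/\ forall x, E x -> E' x, forall x, x \in s -> E' x &
        forall x, E x -> delta' x = d * delta x]].
Proof.
elim: s E delta => [|a s IH] E delta subE derE.
  by exists 1, E, delta; rewrite oner_neq0; split=> //; split=> // x; rewrite mul1r.
have [d1 [delta1 [d10 sub1 der1 E1]]] := derivation_adjoin a subE derE.
have [d2 [E2 [delta2 [d20 sub2 der2 [EE sE Ed]]]]] := IH _ _ sub1 der1.
have Ea x : E x -> adjoin E a x.
  move=> Ex; exists x%:P; rewrite hornerC; split=> // i; rewrite coefC.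
  by case: ifP => // _; case: subE => e1 eB _; rewrite -(subrr 1); apply: eB.
exists (d2 * d1), E2, delta2; split=> //.
  by apply/eqP => /domQ[] /eqP; apply/negP.
split=> [x Ex|x|x Ex].
- exact/EE/Ea.
- rewrite inE => /predU1P[->|/sE //]; apply: EE; exists 'X; rewrite hornerX.
  split=> // i; case: subE => e1 eB _; rewrite coefX; case: eqP => // _.
  by rewrite mulr0n -(subrr 1); apply: eB.
by rewrite (Ed _ (Ea _ Ex)) E1 // mulrA.
Qed.

End DerivationExtension.

Section JacobianPoint.
Variables (K : numClosedFieldType) (m : nat) (X : linAlgGroup K m).
Local Notation A := (coordRing X).

Hypothesis uncountableK : infinite_fibre K.

Definition point_derivation (x : point X) (lam : A -> K) :=
  (forall c f g, lam (c *: f + g) = c * lam f + lam g) /\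
  (forall f g, lam (f * g) = lam f * ev x g + ev x f * lam g).

(** The quotient ring, reduced to what is used of it: a ring onto which A maps with
    the given kernel. *)
Lemma ideal_quotient (P : set A) : is_ideal P -> ~ P 1 ->
  exists (Q : comNzRingType) (pi : {rmorphism A -> Q}),
    (forall y, exists a, y = pi a) /\ (forall a, pi a = 0 <-> P a).
Proof.
move=> iP P1; pose I : {pred A} := fun a => `[< P a >].
have cI : idealr_closed I.
  split; [by apply/asboolP; case: iP|by apply/asboolP|].
  by move=> a u v /asboolP Pu /asboolP Pv; apply/asboolP; case: iP => _; apply.
pose II := isIdealr.Build A I cI.
pose J : idealr A := HB.pack I II.
exists {ideal_quot J}, (\pi_{ideal_quot J})%qT.
split=> [y|a]; first by exists (repr y); rewrite /= reprK.
have -> : P a = (a \in I) :> Prop by apply/propext; split=> [?|/asboolP //]; apply/asboolP.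
rewrite -[a in a \in I]subr0 (Quotient.idealrBE J) -(rmorph0 (\pi_{ideal_quot J})%qT).
by split=> /eqP.
Qed.

(** Choose an ideal P maximal among those that avoid all nonzero polynomials in
    f. In the domain A / P the f_j are still independent, and the partial
    derivatives with respect to the f_j extend from the polynomials in f to
    A / P up to denominators d_i. By the Nullstellensatz there is a point of the
    zero set of P at which no d_i vanishes; evaluate there and divide by
    d_i. *)
Lemma jacobian_point N (f : 'I_N -> A) : alg_independent f ->
  exists (x : point X) (lam : 'I_N -> A -> K),
    (forall i, point_derivation x (lam i)) /\
    forall i j, lam i (f j) = (i == j)%:R.
Proof.
move=> indf; pose F := mmap (in_alg A) f.
have FR p q : F (p * q) = F p * F q by rewrite /F rmorphM.
have FD p q : F (p + q) = F p + F q by rewrite /F rmorphD.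
have FC c : F c%:MP = c%:A by rewrite /F mmapC.
pose S := [set s | exists p : {mpoly K[N]}, p != 0 /\ s = F p].
have iJ : is_ideal [set 0 : A].
  by split=> // a u v -> ->; rewrite mulr0 addr0.
have SM s s' : S s -> S s' -> S (s * s').
  move=> [p [p0 ->]] [q [q0 ->]]; exists (p * q); rewrite FR; split=> //.
  by rewrite mulf_neq0.
have [||P [_ Poff]] := exists_prime_off iJ (S := S).
- by exists 1; rewrite oner_neq0; split=> //; rewrite /F rmorph1.
- by move=> s [p [p0 ->]] /indf p0'; rewrite p0' eqxx in p0.
have [iP SP _] := Poff.
have primeP a b : P (a * b) -> P a \/ P b by exact: prime_offM Poff.
have constP c : c != 0 -> ~ P c%:A.
  by move=> c0; apply: SP; exists c%:MP; rewrite mpolyC_eq0 FC.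
have P1 : ~ P 1 by have := constP 1 (oner_neq0 _); rewrite scale1r.
have [Q [pi [pi_surj piP]]] := ideal_quotient iP P1.
have domQ x y : x * y = 0 :> Q -> x = 0 \/ y = 0.
  have [a ->] := pi_surj x; have [b ->] := pi_surj y.
  by rewrite -rmorphM => /piP/primeP[] /piP; [left|right].
have charQ n : n.+1%:R != 0 :> Q.
  apply/eqP; rewrite -(rmorph_nat pi) => /piP.
  by rewrite -scaler_nat; apply: constP; rewrite pnatr_eq0.
have Finj p : pi (F p) = 0 -> p = 0.
  by move=> /piP PF; apply: contrapT => /eqP p0; apply: (SP _ _ PF); exists p.
pose E0 := [set y | exists p, y = pi (F p)].
have /choice[ch chE] y : exists p, E0 y -> y = pi (F p).
  have [[p ->]|] := pselect (E0 y); first by exists p.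
  by move=> nE; exists 0.
have chF p : ch (pi (F p)) = p.
  apply/eqP; rewrite -subr_eq0; apply/eqP/Finj.
  rewrite /F !raddfB /= -/F -chE ?subrr //; by exists p.
have subE0 : is_subring E0.
  split; first by exists 1; rewrite /F !rmorph1.
    by move=> _ _ [p ->] [q ->]; exists (p - q); rewrite /F !rmorphB.
  by move=> _ _ [p ->] [q ->]; exists (p * q); rewrite /F !rmorphM.
pose d0 i y := pi (F (mderiv i (ch y))).
have der0 i : derivation_on E0 (d0 i).
  split=> _ _ [p ->] [q ->]; rewrite /d0.
    by rewrite -rmorphD -FD !chF mderivD FD rmorphD.
  by rewrite -rmorphM -FR !chF mderivM FD !FR rmorphD !rmorphM.
pose gens := [seq pi (coord X k) | k <- enum 'I_(m * m + 1)].
have ext i := derivation_adjoin_seq domQ charQ gens subE0 (der0 i).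
have /choice[d /choice[E /choice[delta extP]]] := ext.
have full i a : E i (pi a).
  have [_ [e1 eB eM] _ [EE gE _]] := extP i.
  have e0 : E i 0 by rewrite -(subrr 1); apply: eB.
  elim/coord_ind: a => [c|g h Eg Eh|g h Eg Eh|k].
  - by apply: EE; exists c%:MP; rewrite FC.
  - rewrite rmorphD -[pi h]opprK; apply: (eB) => //; rewrite -sub0r; exact: eB.
  - by rewrite rmorphM; apply: eM.
  by apply: gE; apply/mapP; exists k => //; rewrite mem_enum.
(* Preimages under pi; their values at x do not depend on choices, as x kills P. *)
have /choice[rp rpP] : forall y : Q, exists a, y = pi a by [].
pose h := \prod_i rp (d i).
have hP : ~ P h.
  move=> /piP; rewrite rmorph_prod => h0.
  have rd i : pi (rp (d i)) != 0 by rewrite -rpP; case: (extP i).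
  elim: (index_enum _) h0 => [|i r IH].
    by rewrite big_nil => /eqP; rewrite oner_eq0.
  by rewrite big_cons => /domQ[/eqP|//]; rewrite (negbTE (rd i)).
have hkP k : ~ P (h ^+ k).
  by elim: k => [|k IH]; rewrite ?expr0 // exprS => /primeP[].
have [x [xP hx]] := nullstellensatz uncountableK iP hkP.
have evrp a : ev x (rp (pi a)) = ev x a.
  apply/eqP; rewrite -subr_eq0 -rmorphB; apply/eqP/xP/piP.
  by rewrite rmorphB -rpP subrr.
pose v y := ev x (rp y).
have vD y z : v (y + z) = v y + v z.
  by rewrite /v [in LHS](rpP y) [in LHS](rpP z) -rmorphD evrp rmorphD.
have vM y z : v (y * z) = v y * v z.
  by rewrite /v [in LHS](rpP y) [in LHS](rpP z) -rmorphM evrp rmorphM.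
have dx i : v (d i) != 0.
  by move: hx; rewrite /h rmorph_prod => /prodf_neq0/(_ i isT).
have dE i p : delta i (pi (F p)) = d i * pi (F (mderiv i p)).
  have [_ _ _ [_ _ ->]] := extP i; last by exists p.
  by rewrite /d0 chF.
exists x, (fun i a => (v (d i))^-1 * v (delta i (pi a))); split=> [i|i j].
  have [_ _ [dD dM] _] := extP i.
  have dlM a b : v (delta i (pi (a * b))) =
      v (delta i (pi a)) * ev x b + ev x a * v (delta i (pi b)).
    by rewrite rmorphM dM // vD !vM /v !evrp.
  have dlD a b : v (delta i (pi (a + b))) = v (delta i (pi a)) + v (delta i (pi b)).
    by rewrite rmorphD dD // vD.
  have dlC c : v (delta i (pi c%:A)) = 0.
    by rewrite -FC dE mderivC /F !rmorph0 mulr0 /v -(rmorph0 pi) evrp rmorph0.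
  split=> [c a b|a b].
    by rewrite -(mulr_algl c) dlD dlM dlC mul0r add0r ev_alg; ring.
  by rewrite dlM; ring.
have -> : f j = F 'X_j by rewrite /F mmapX mmap1U.
rewrite dE mderivX vM mulKf // mnm1E eq_sym; case: eqP => [->|_].
  rewrite scale1r -{1}[U_(j)%MM]add0m addmK mpolyX0 /F !rmorph1.
  by rewrite /v -(rmorph1 pi) evrp rmorph1.
by rewrite scale0r /F !rmorph0 /v -(rmorph0 pi) evrp rmorph0.
Qed.

End JacobianPoint.

(** * Invariant vector fields *)

Section InvariantFields.
Variables (K : numClosedFieldType) (m : nat) (X : linAlgGroup K m).
Local Notation A := (coordRing X).
Local Notation one := (pone X).
Implicit Types (x y z : point X) (f g h : A) (v w : vfield A).

Lemma ltransD y c f g : ltrans y (c *: f + g) = c *: ltrans y f + ltrans y g.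
Proof. exact: coord_ext. Qed.
Lemma ltransM y f g : ltrans y (f * g) = ltrans y f * ltrans y g.
Proof. exact: coord_ext. Qed.
Lemma antipodeD c f g : antipode (c *: f + g) = c *: antipode f + antipode g.
Proof. exact: coord_ext. Qed.
Lemma antipodeM f g : antipode (f * g) = antipode f * antipode g.
Proof. exact: coord_ext. Qed.
Lemma antipodeK f : antipode (antipode f) = f.
Proof. by apply: coord_ext => x; rewrite !ev_antipode pinvK. Qed.

Lemma ltransA x y f : ltrans x (ltrans y f) = ltrans (pmul y x) f.
Proof. by apply: coord_ext => z; rewrite !ev_ltrans pmulA. Qed.
Lemma ltrans1 f : ltrans one f = f.
Proof. by apply: coord_ext => z; rewrite !ev_ltrans pmul1p. Qed.

(** Invariant under the left translations f |-> f(y x); the flows of such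
    fields on a Lie group are right translations. *)
Definition left_inv v := forall y f, v (ltrans y f) = ltrans y (v f).
Definition right_inv v := forall y f, v (rtrans y f) = rtrans y (v f).

Lemma comult_ltrans (s : seq (A * A)) f :
  (forall x y, ev (pmul x y) f = \sum_(p <- s) ev x p.1 * ev y p.2) ->
  forall x, ltrans x f = \sum_(p <- s) ev x p.1 *: p.2.
Proof.
move=> fs x; apply: coord_ext => y; rewrite ev_ltrans fs raddf_sum.
by apply: eq_bigr.
Qed.

Lemma comult_rtrans (s : seq (A * A)) f :
  (forall x y, ev (pmul x y) f = \sum_(p <- s) ev x p.1 * ev y p.2) ->
  forall y, rtrans y f = \sum_(p <- s) ev y p.2 *: p.1.
Proof.
move=> fs x; apply: coord_ext => y; rewrite ev_rtrans fs raddf_sum.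
by apply: eq_bigr => p _; rewrite mulrC.
Qed.

(** Write f(x y) = sum a_i(x) b_i(y): a left invariant field acts on the b_i, a
    right invariant one on the a_i. *)
Lemma left_right_comm v w f : left_inv v -> right_inv w -> v (w f) = w (v f).
Proof.
move=> lv rw; have [s fs] := comult f.
have lvf x y : ev (pmul x y) (v f) = \sum_(p <- s) ev x p.1 * ev y (v p.2).
  rewrite -ev_ltrans -lv (comult_ltrans fs) vf_sum raddf_sum.
  by apply: eq_bigr => p _; rewrite vfZ.
have rwf x y : ev (pmul x y) (w f) = \sum_(p <- s) ev x (w p.1) * ev y p.2.
  rewrite -ev_rtrans -rw (comult_rtrans fs) vf_sum raddf_sum.
  by apply: eq_bigr => p _; rewrite vfZ /= evZ mulrC.
apply: coord_ext => x; rewrite -(pmulp1 x) -ev_ltrans -lv.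
have -> : ltrans x (w f) = \sum_(p <- s) ev x (w p.1) *: p.2.
  by apply: coord_ext => y; rewrite ev_ltrans rwf raddf_sum; apply: eq_bigr.
rewrite -ev_rtrans -rw.
have -> : rtrans one (v f) = \sum_(p <- s) ev one (v p.2) *: p.1.
  apply: coord_ext => y; rewrite ev_rtrans lvf raddf_sum.
  by apply: eq_bigr => p _; rewrite mulrC.
rewrite !vf_sum !raddf_sum; apply: eq_bigr => p _.
by rewrite !vfZ /= !evZ mulrC.
Qed.

Lemma point_derivation_sum x lam (I : Type) (r : seq I) (c : I -> K) (F : I -> A) :
  point_derivation x lam ->
  lam (\sum_(i <- r) c i *: F i) = \sum_(i <- r) c i * lam (F i).
Proof.
move=> [lin _]; elim: r => [|i r IH]; last by rewrite !big_cons lin IH.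
rewrite !big_nil; have := lin (-1) 0 0.
by rewrite scaler0 addr0 mulN1r addNr.
Qed.

(** The field is x |-> lam (f (x .)), which is regular by comultiplication. *)
Lemma left_inv_field lam : point_derivation one lam ->
  exists2 v, left_inv v & forall f x, ev x (v f) = lam (ltrans x f).
Proof.
move=> dlam; have [lin leib] := dlam.
have reg f : (fun x => lam (ltrans x f) : K^o) \in @regular_functions _ _ X.
  apply: regularP; have [s fs] := comult f.
  exists (\sum_(p <- s) lam p.2 *: p.1) => x.
  rewrite (comult_ltrans fs) (point_derivation_sum _ _ _ dlam) raddf_sum.
  by apply: eq_bigr => p _; rewrite /= evZ mulrC.
pose D f : A := CoordRing (reg f).
have evD f x : ev x (D f) = lam (ltrans x f) by [].
have derD : (D : A -> A^o) \in @derivations _ A.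
  apply/asboolP; split=> [c f g|f g]; apply: coord_ext => x.
    by rewrite rmorphD /= evZ !evD ltransD lin.
  by rewrite rmorphD !rmorphM /= !evD ltransM leib !ev_ltrans pmulp1.
exists (VField derD) => [y f|//].
by apply: coord_ext => x; rewrite [LHS]evD ev_ltrans [RHS]evD ltransA.
Qed.

Lemma translate_derivation x lam : point_derivation x lam ->
  point_derivation one (fun f => lam (ltrans (pinv x) f)).
Proof.
move=> [lin leib]; split=> [c f g|f g]; first by rewrite ltransD lin.
by rewrite ltransM leib !ev_ltrans pmulVp.
Qed.

Lemma field_derivation v x : point_derivation x (fun f => ev x (v f)).
Proof.
split=> [c f g|f g]; first by rewrite vfD vfZ.
by rewrite vfM rmorphD !rmorphM.
Qed.

Section ChainRule.
Variables (n : nat) (f : 'I_n -> A).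
Local Notation F := (mmap (in_alg A) f).

Lemma mpoly_ind_ring (P : {mpoly K[n]} -> Prop) :
  (forall c, P c%:MP) -> (forall p q, P p -> P q -> P (p + q)) ->
  (forall p q, P p -> P q -> P (p * q)) -> (forall i, P 'X_i) -> forall p, P p.
Proof.
move=> PC PD PM PX p; rewrite [p]mpolyE.
apply: (big_ind P) => [||mm _]; [by have := PC 0; rewrite mpolyC0|exact: PD|].
rewrite -mul_mpolyC; apply: (PM _ _ (PC _)); rewrite mpolyXE_id.
apply: (big_ind P) => [||i _]; [by have := PC 1; rewrite mpolyC1|exact: PM|].
elim: (mm i) => [|k IH]; first by have := PC 1; rewrite mpolyC1.
by rewrite exprS; apply: PM.
Qed.

Lemma chain_rule v p : v (F p) = \sum_j F (mderiv j p) * v (f j).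
Proof.
elim/mpoly_ind_ring: p => [c|p q IHp IHq|p q IHp IHq|i].
- rewrite mmapC vf_alg big1 // => j _; by rewrite mderivC rmorph0 mul0r.
- rewrite rmorphD vfD IHp IHq -big_split; apply: eq_bigr => j _.
  by rewrite mderivD rmorphD mulrDl.
- rewrite rmorphM vfM IHp IHq mulr_suml mulr_sumr -big_split.
  apply: eq_bigr => j _; rewrite mderivM rmorphD !rmorphM /=; ring.
rewrite mmapX mmap1U (bigD1 i) //= big1 => [|j ji].
  rewrite mderivX mnm1E eqxx scale1r -{1}[U_(i)%MM]add0m addmK mpolyX0.
  by rewrite rmorph1 mul1r addr0.
by rewrite mderivX mnm1E eq_sym (negbTE ji) scale0r rmorph0 mul0r.
Qed.

End ChainRule.

(** Extend the lam_i to left invariant fields l_i. The matrix of the l_i(f_j) is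
    the identity matrix at the neutral element. If p(f) = 0, the chain rule gives
    sum_j l_i(f_j) (d_j p)(f) = 0, hence det (d_j p)(f) = 0 by Cramer's rule, and
    induction on the degree applies to the d_j p. As A may have zero divisors
    (X need not be connected), the induction runs over the relations
    g p(f) = 0 with g nonzero at the neutral element. *)
Lemma dual_alg_independent n (lam : 'I_n -> A -> K) (f : 'I_n -> A) :
  (forall i, point_derivation one (lam i)) ->
  (forall i j, lam i (f j) = (i == j)%:R) -> alg_independent f.
Proof.
move=> dlam lamf.
have /choice[l lP] i : exists v : vfield A, forall g, ev one (v g) = lam i g.
  by have [v _ vE] := left_inv_field (dlam i); exists v => g; rewrite vE ltrans1.
pose M := \matrix_(i, j) l i (f j).
have evM : ev one (\det M) = 1.
  rewrite -det_map_mx (_ : map_mx _ M = 1%:M) ?det1 //.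
  by apply/matrixP=> i j; rewrite !mxE /= lP lamf.
suff gen p : forall g, ev one g != 0 -> g * mmap (in_alg A) f p = 0 -> p = 0.
  by move=> p p0; apply: (gen p 1); rewrite ?rmorph1 ?oner_eq0 // p0 mulr0.
have [k] := ubnP (msize p); elim: k p => // k IH p sp g g0 gp.
have dp0 j : mderiv j p = 0.
  have [->|p0] := eqVneq p 0; first by rewrite mderiv0.
  apply: (IH _ _ (g ^+ 2 * \det M)).
  - rewrite ltnS in sp; apply: leq_trans sp.
    have pp : (0 < msize p)%N by rewrite lt0n msize_poly_eq0.
    rewrite -(prednK pp) ltnS msizeE; apply/bigmax_leqP_seq => mm mp _.
    have := @msize_mdeg_lt _ _ p (mm + U_(j))%MM; rewrite mdegD mdeg1 addn1.
    move=> lt; rewrite -ltnS prednK //; apply: lt.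
    move: mp; rewrite !mcoeff_msupp mcoeff_deriv; apply: contra => /eqP->.
    by rewrite mul0rn.
  - by rewrite rmorphM rmorphXn /= evM mulr1 expf_neq0.
  pose q := \col_j mmap (in_alg A) f (mderiv j p).
  have Mq : g ^+ 2 *: (M *m q) = 0.
    apply/colP=> i; rewrite !mxE.
    have -> : \sum_j M i j * q j 0 = l i (mmap (in_alg A) f p).
      rewrite chain_rule; apply: eq_bigr => j' _; by rewrite !mxE mulrC.
    have := congr1 (fun h => g * l i h) gp; rewrite vfM vf0 mulr0 => <-.
    by rewrite mulrDr mulrCA gp mulr0 add0r mulrA expr2.
  have := congr1 (fun B => (\adj M *m B) j 0) Mq.
  by rewrite -scalemxAr mulmxA mul_adj_mx mul_scalar_mx scalerA mulmx0 !mxE.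
have pC : p = (p@_0)%:MP.
  apply/mpolyP => mm; rewrite mcoeffC; have [->|mm0] := eqVneq mm 0%MM.
    by rewrite mulr1.
  rewrite mulr0; have [j mj] : exists j, mm j != 0%N.
    apply/existsP; rewrite -negb_forall; apply: contra mm0 => /forallP mm0.
    by apply/eqP/mnmP => j; rewrite mnmE; apply/eqP/mm0.
  have := congr1 (mcoeff (mm - U_(j))%MM) (dp0 j).
  rewrite mcoeff_deriv mcoeff0 submK; last first.
    by apply/mnm_lepP => i; rewrite mnm1E; case: eqP => // <-; rewrite lt0n.
  by move=> /eqP; rewrite mulrn_eq0 => /eqP.
move: gp; rewrite pC mmapC => /(congr1 (ev one)); rewrite rmorphM rmorph0 /= ev_alg.
by move=> /eqP; rewrite mulf_eq0 (negbTE g0) => /eqP ->; rewrite mpolyC0.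
Qed.

End InvariantFields.

(** * Invariant frames *)

Section InvariantFrames.
Variables (K : numClosedFieldType) (m : nat) (X : linAlgGroup K m).
Local Notation A := (coordRing X).
Local Notation one := (pone X).
Implicit Types (x y z : point X) (f g h : A) (v w : vfield A).

Hypothesis uncountableK : infinite_fibre K.

(** The point and the derivations of jacobian_point are moved to the neutral
    element. A derivation that is no combination of the lam_j, corrected so as
    to vanish on the f_j, would give N + 1 independent functions. *)
Lemma dual_system N : has_dimension X N ->
  exists (lam : 'I_N -> A -> K) (f : 'I_N -> A),
  [/\ forall i, point_derivation one (lam i), forall i j, lam i (f j) = (i == j)%:R &
      forall mu, point_derivation one mu -> forall g, mu g = \sum_j mu (f j) * lam j g].
Proof.
move=> [[f0 indf] dimX].
have [x [lam0 [dlam0 lam0f]]] := jacobian_point uncountableK indf.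
pose lam i g := lam0 i (ltrans (pinv x) g); pose f i := ltrans x (f0 i).
have dlam i : point_derivation one (lam i) by exact: translate_derivation.
have lamf i j : lam i (f j) = (i == j)%:R.
  by rewrite /lam /f ltransA pmulpV ltrans1.
exists lam, f; split=> // mu dmu g; apply: contrapT => /eqP; rewrite -subr_eq0 => cg.
pose nu h := mu h - \sum_j mu (f j) * lam j h.
have dnu : point_derivation one nu.
  split=> [c h k|h k]; rewrite /nu.
    have [-> _] := dmu; under eq_bigr => j _.
      have [-> _] := dlam j; rewrite mulrDr mulrCA; over.
    by rewrite big_split /= -mulr_sumr; ring.
  have [_ ->] := dmu; under eq_bigr => j _.
    have [_ ->] := dlam j; rewrite mulrDr mulrA [_ * (_ * lam _ _)]mulrCA; over.
  by rewrite big_split /= -mulr_sumr -mulr_suml; ring.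
have nuf j : nu (f j) = 0.
  rewrite /nu (bigD1 j) //= lamf eqxx mulr1 big1 ?addr0 ?subrr // => i ij.
  by rewrite lamf (negbTE ij) mulr0.
have lin_sum mu' (r : 'I_N -> K) h : point_derivation one mu' ->
    mu' (h - \sum_j r j *: f j) = mu' h - \sum_j r j * mu' (f j).
  move=> dmu'; rewrite -(point_derivation_sum _ _ _ dmu') addrC -scaleN1r.
  by case: dmu' => -> _; rewrite mulN1r addrC.
pose g' := g - \sum_j lam j g *: f j.
have nug' : nu g' = nu g.
  by rewrite lin_sum // big1 ?subr0 // => j _; rewrite nuf mulr0.
have lamg' i : lam i g' = 0.
  rewrite lin_sum // (bigD1 i) //= lamf eqxx mulr1 big1 ?addr0 ?subrr // => j ji.
  by rewrite lamf eq_sym (negbTE ji) mulr0.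
apply: (dimX (fun i => if unlift ord0 i is Some j then f j else g')).
apply: (@dual_alg_independent _ _ _ _
  (fun i h => if unlift ord0 i is Some j then lam j h else (nu g)^-1 * nu h)).
  move=> i; case: (unliftP ord0 i) => [j|] _ //.
  case: dnu => lin leib; split=> [c h k|h k]; first by rewrite lin; ring.
  by rewrite leib; ring.
move=> i j; case: (unliftP ord0 i) => [i' ->|->]; case: (unliftP ord0 j) => [j' ->|->].
- by rewrite lamf (inj_eq lift_inj).
- by rewrite lamg'.
- by rewrite nuf mulr0.
by rewrite nug' mulVf.
Qed.

(** The coordinate of v at x along l_j is the value at x of v applied to the
    translate of f_j by the inverse of x. By comultiplication this is a regular
    function of x and a finite sum of terms c v(g), which is the last clause:
    the dual frame is spanned by exact forms. *)
Lemma left_invariant_frame N : has_dimension X N ->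
  exists (l : 'I_N -> vfield A) (co : 'I_N -> vfield A -> A),
  [/\ is_frame l co, forall i, left_inv (l i) &
      forall k, exists (r : nat) (c g : 'I_r -> A),
        forall v, co k v = \sum_i c i * v (g i)].
Proof.
move=> dimX; have [lam [f [dlam lamf lamE]]] := dual_system dimX.
have /choice[l lP] i : exists v, left_inv v /\ forall g x, ev x (v g) = lam i (ltrans x g).
  by have [v lv vE] := left_inv_field (dlam i); exists v.
have /choice[s sP] j := comult (f j).
pose co j v := \sum_(p <- s j) antipode p.1 * v p.2.
have coE j v x : ev x (co j v) = ev x (v (ltrans (pinv x) (f j))).
  rewrite (comult_ltrans (sP j)) vf_sum !raddf_sum; apply: eq_bigr => p _.
  by rewrite vfZ.
exists l, co; split=> [|i|k]; last 2 first.
- by have [] := lP i.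
- exists (size (s k)), (fun i => antipode (nth (0, 0) (s k) i).1),
    (fun i => (nth (0, 0) (s k) i).2).
  by move=> v; rewrite /co (big_nth (0, 0)) big_mkord.
split=> [i a u v|i j|v].
- rewrite /co mulr_sumr -big_split; apply: eq_bigr => p _ /=.
  by rewrite vaddE vscaleE /=; ring.
- apply: coord_ext => x; have [_ ljE] := lP j.
  rewrite coE ljE ltransA pmulVp ltrans1 lamf rmorph_nat.
  by rewrite eq_sym.
apply: vfield_ext => g; apply: coord_ext => x; rewrite vsumE raddf_sum.
have /= := lamE _ (translate_derivation (field_derivation v x)) (ltrans x g).
rewrite ltransA pmulpV ltrans1 => ->; apply: eq_bigr => j _.
by rewrite vscaleE rmorphM /= coE; have [_ ->] := lP j.
Qed.

Lemma antipodeA f g : antipode (f + g) = antipode f + antipode g.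
Proof. exact: coord_ext. Qed.

Lemma vconj_subproof v : (fun f => antipode (v (antipode f)) : A^o) \in @derivations _ A.
Proof.
apply/asboolP; split=> [c f g|f g].
  by rewrite antipodeD vfD vfZ antipodeD.
by rewrite antipodeM vfM antipodeA !antipodeM !antipodeK.
Qed.

(** Transport by the inversion of the group, which exchanges left and right
    translations; this yields right invariant frames. *)
Definition vconj v : vfield A := VField (vconj_subproof v).

Lemma vconjE v f : vconj v f = antipode (v (antipode f)). Proof. by []. Qed.

Lemma vconjK v : vconj (vconj v) = v.
Proof. by apply: vfield_ext => f; rewrite !vconjE !antipodeK. Qed.

Lemma vconj_lin a v w : vconj (a *: v + w) = antipode a *: vconj v + vconj w.
Proof.
apply: vfield_ext => f; rewrite [RHS]vaddE vscaleE !vconjE.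
by rewrite -antipodeM -antipodeA.
Qed.

Lemma antipode_ltrans y f : antipode (ltrans y f) = rtrans (pinv y) (antipode f).
Proof.
apply: coord_ext => x; rewrite ev_antipode ev_ltrans ev_rtrans ev_antipode; congr ev.
have : pmul (pmul y (pinv x)) (pmul x (pinv y)) = one.
  by rewrite -pmulA [pmul (pinv x) _]pmulA pmulVp pmul1p pmulpV.
move/(congr1 (fun z => pmul z (pinv (pmul x (pinv y))))).
by rewrite -pmulA pmulpV pmulp1 pmul1p.
Qed.

Lemma antipode_rtrans y f : antipode (rtrans y f) = ltrans (pinv y) (antipode f).
Proof.
by rewrite -[f in LHS]antipodeK -{1}[y]pinvK -antipode_ltrans antipodeK.
Qed.

Lemma vconj_left v : left_inv v -> right_inv (vconj v).
Proof.
by move=> lv y f; rewrite !vconjE antipode_rtrans lv antipode_ltrans pinvK.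
Qed.

Lemma vconj_right v : right_inv v -> left_inv (vconj v).
Proof.
by move=> rv y f; rewrite !vconjE antipode_ltrans rv antipode_rtrans pinvK.
Qed.

Lemma vconj_frame N (l : 'I_N -> vfield A) co : is_frame l co ->
  is_frame (fun i => vconj (l i)) (fun i v => antipode (co i (vconj v))).
Proof.
move=> [lin delta expand]; split=> [i a u v|i j|v].
- by rewrite vconj_lin lin antipodeA antipodeM antipodeK.
- by rewrite vconjK delta; apply: coord_ext => x; rewrite ev_antipode !rmorph_nat.
apply: vfield_ext => f; rewrite -{1}(vconjK v) vconjE [in LHS](expand (vconj v)) !vsumE.
apply: coord_ext => x; rewrite ev_antipode !raddf_sum; apply: eq_bigr => i _.
by rewrite !vscaleE.
Qed.

End InvariantFrames.

(** * Volume forms on a group *)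

Section GroupVolume.
Variables (K : numClosedFieldType) (m n : nat) (X : linAlgGroup K m).
Local Notation A := (coordRing X).
Implicit Types (x y z : point X) (f g h : A) (v w r : vfield A).

Hypothesis uncountableK : infinite_fibre K.
Variable omega : cochain A n.+2.
Hypothesis volX : volume_form omega.

Lemma nowhere_zero_unit f : (forall x, ev x f != 0) -> exists t, t * f = 1.
Proof.
move=> f0; apply: contrapT => nt.
pose J := [set g | exists h, g = h * f].
have iJ : is_ideal J.
  split; first by exists 0; rewrite mul0r.
  by move=> a _ _ [u ->] [v ->]; exists (a * u + v); ring.
have [k|x [xJ _]] := nullstellensatz uncountableK iJ (h := 1).
  by rewrite expr1n => -[t ft]; apply: nt; exists t.
by have := f0 x; rewrite (xJ f) ?eqxx //; exists 1; rewrite mul1r.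
Qed.

(** If omega e vanished at x, all values of omega would, since they are multiples
    of omega e. *)
Lemma volume_unit (e : 'I_n.+2 -> vfield A) co : is_frame e co ->
  exists t, t * omega e = 1.
Proof.
move=> fe; apply: nowhere_zero_unit => x; apply/eqP => xe.
have [fo /(_ x) [w]] := volX.
have ix : is_ideal (fun f : A => ev x f = 0).
  split=> [|a u v u0 v0]; first exact: rmorph0.
  by rewrite rmorphD rmorphM /= u0 v0 mulr0 addr0.
by have /(_ w) := top_form_ideal fe ix fo xe; rewrite /ev => ->; rewrite eqxx.
Qed.

Variables (l : 'I_n.+2 -> vfield A) (co : 'I_n.+2 -> vfield A -> A) (t : A).
Hypotheses (frame_l : is_frame l co) (left_l : forall i, left_inv (l i)).
Hypothesis t_omega : t * omega l = 1.
Let form_omega : is_form omega := volX.1.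

(** A right invariant field commutes with the left invariant frame, so it
    preserves the left invariant volume form t omega. Therefore t r preserves
    omega, because i_(t r) omega = i_r (t omega) is closed. *)
Lemma right_inv_L0 r : right_inv r -> L0 omega (t *: r).
Proof.
move=> rr; apply/(L0P frame_l form_omega t_omega).
have rl i : lie_bracket r (l i) = 0.
  apply: vfield_ext => f; rewrite bracketE (left_right_comm f (left_l i) rr).
  by rewrite subrr.
have om0 i : omega (subst_arg l i 0) = 0.
  have := form_omega.1 l i (-1) 0 0.
  by rewrite scaler0 addr0 mulN1r addNr.
rewrite (divgZ frame_l form_omega t_omega) /divg /lie_derive.
rewrite big1 ?subr0 => [|i _]; last by rewrite rl om0.
have := congr1 r t_omega; rewrite vfM vf1 => h.
have -> : r t = r t * omega l * t by rewrite -mulrA [omega l * t]mulrC t_omega mulr1.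
have -> : t * (t * r (omega l)) = (t * r (omega l)) * t by ring.
by rewrite -mulrDl addrC h mul0r.
Qed.

Lemma right_inv_gen v : exists (k : nat) (f : 'I_k -> A) (p : 'I_k -> vfield A),
  (forall i, L0 omega (p i)) /\ v = \sum_i f i *: p i.
Proof.
have [_ _ expand] := vconj_frame frame_l.
exists n.+2, (fun i => antipode (co i (vconj v)) * omega l), (fun i => t *: vconj (l i)).
split=> [i|]; first exact/right_inv_L0/vconj_left/left_l.
rewrite [LHS]expand; apply: eq_bigr => i _.
by rewrite scalerA -mulrA [omega l * t]mulrC t_omega mulr1.
Qed.

End GroupVolume.

(** In the abstract argument for dimension at least three, the divergence-free
    generators are the right invariant fields times t. *)
Lemma derived_eq_LJ_high (K : numClosedFieldType) (m n : nat) (X : linAlgGroup K m)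
    (omega : cochain (coordRing X) n.+3) :
  infinite_fibre K -> has_dimension X n.+3 -> volume_form omega ->
  derived (L0 omega) = LJ omega.
Proof.
move=> unc dimX volX.
have [l [co [fl left_l dual]]] := left_invariant_frame unc dimX.
have [t tom] := volume_unit unc volX fl; have fo := volX.1.
apply: (derived_eq_LJ fl fo tom) => a b.
have gen := right_inv_gen volX fl left_l tom.
exact: (derived_curl_high (curlDl fl fo tom) (curlC _ _ _) (curlvv _ _ _)
  (curlZl fl fo tom) (L0_curl fl fo tom) (lie_bracket_curl fl fo tom) gen fl dual).
Qed.

(** * Polynomials in a vector field *)

Section PolynomialAction.
Variables (K : numClosedFieldType) (A : comAlgType K) (D : vfield A).
Implicit Types (f g : A) (p q : {poly K}).

(** The value at f of the differential operator p(D). *)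
Definition pact p f : A := \sum_(i < size p) p`_i *: iter i D f.

Lemma pactE k p f : (size p <= k)%N -> pact p f = \sum_(i < k) p`_i *: iter i D f.
Proof.
move=> pk; rewrite /pact (big_ord_widen k (fun i => p`_i *: iter i D f)) //.
rewrite [RHS](bigID (fun i : 'I_k => (i < size p)%N)) /= [X in _ + X]big1 ?addr0 //.
by move=> i; rewrite -leqNgt => /(nth_default 0) ->; rewrite scale0r.
Qed.

Lemma pactDl p q f : pact (p + q) f = pact p f + pact q f.
Proof.
rewrite (@pactE (maxn (size p) (size q))) ?size_polyD //.
rewrite (@pactE (maxn (size p) (size q)) p) ?leq_maxl //.
rewrite (@pactE (maxn (size p) (size q)) q) ?leq_maxr // -big_split.
by apply: eq_bigr => i _; rewrite coefD scalerDl.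
Qed.

Lemma iterD k c f g : iter k D (c *: f + g) = c *: iter k D f + iter k D g.
Proof. by elim: k => //= k ->; rewrite vfD vfZ. Qed.

Lemma pact_lin p c f g : pact p (c *: f + g) = c *: pact p f + pact p g.
Proof.
rewrite /pact scaler_sumr -big_split; apply: eq_bigr => i _ /=.
by rewrite iterD scalerDr !scalerA mulrC.
Qed.

Lemma pact0r p : pact p 0 = 0.
Proof. by have := pact_lin p (-1) 0 0; rewrite scaler0 addr0 scaleN1r addNr. Qed.

Lemma pact0l f : pact 0 f = 0. Proof. by rewrite /pact size_poly0 big_ord0. Qed.

Lemma pactC c f : pact c%:P f = c *: f.
Proof. by rewrite (@pactE 1) ?size_polyC_leq1 // big_ord1 coefC. Qed.

Lemma pactMX p f : pact (p * 'X) f = pact p (D f).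
Proof.
rewrite (@pactE (size p).+1) ?(leq_trans (size_polyMleq _ _)) ?size_polyX ?addn2 //.
rewrite big_ord_recl coefMX scale0r add0r.
by apply: eq_bigr => i _; rewrite coefMX -iterSr.
Qed.

Lemma vf_pact p f : D (pact p f) = pact p (D f).
Proof.
rewrite /pact vf_sum; apply: eq_bigr => i _.
by rewrite vfZ -iterS iterSr.
Qed.

Lemma pactCM c q f : pact (c%:P * q) f = c *: pact q f.
Proof.
rewrite (@pactE (size q)) ?mul_polyC ?size_scale_leq // scaler_sumr.
by apply: eq_bigr => i _; rewrite coefZ scalerA.
Qed.

Lemma pactM p q f : pact (p * q) f = pact p (pact q f).
Proof.
elim/poly_ind: p f => [|p c IH] f; first by rewrite mul0r !pact0l.
rewrite mulrDl -mulrA [_ * q]mulrC mulrA pactDl pactMX IH -vf_pact pactDl pactMX.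
by rewrite pactCM pactC.
Qed.

Lemma pactXsubC c f : pact ('X - c%:P) f = D f - c *: f.
Proof.
rewrite -['X]mul1r pactDl pactMX -polyC1 pactC scale1r; congr (_ + _).
by rewrite -polyCN pactC scaleNr.
Qed.

Lemma pactXn k p f : pact (p * 'X^k) f = pact p (iter k D f).
Proof.
elim: k f => [|k IH] f; first by rewrite expr0 mulr1.
by rewrite exprSr mulrA pactMX IH -iterSr.
Qed.

Definition locally_finite := forall f, exists2 p, p != 0 & pact p f = 0.

(** Stated for a set V stable under D, so that the eigenvector can be asked to
    have further properties. *)
Lemma eigenvector (V : A -> Prop) f : locally_finite ->
  (forall c g h, V g -> V h -> V (c *: g + h)) -> (forall g, V g -> V (D g)) ->
  V f -> f != 0 -> exists g c, [/\ V g, g != 0 & D g = c *: g].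
Proof.
move=> lf Vlin VD Vf f0; have [p p0 pf] := lf f.
have [k] := ubnP (size p); elim: k p f p0 pf Vf f0 => // k IH p f p0 pf Vf f0 sp.
have [p1|p1] := eqVneq (size p) 1%N.
  have pc := size1_polyC (eq_leq p1); move: pf p0; rewrite pc pactC => pf.
  rewrite polyC_eq0 => c0; move: f0; rewrite -[f]scale1r -(mulVf c0) -scalerA pf.
  by rewrite scaler0 eqxx.
have /closed_rootP[c /factor_theorem[q qE]] := p1.
have q0 : q != 0 by apply: contra p0 => /eqP q0; rewrite qE q0 mul0r.
have sq : (size q < k)%N.
  by move: sp; rewrite qE size_Mmonic ?monicXsubC // size_XsubC addn2.
move: pf; rewrite qE pactM pactXsubC => pf.
have [g0|g0] := eqVneq (D f - c *: f) 0.
  by exists f, c; split=> //; apply/eqP; rewrite -subr_eq0 g0.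
apply: (IH q _ q0 pf _ g0 sq).
by rewrite addrC -scaleNr; apply: Vlin => //; apply: VD.
Qed.

(** Write an annihilating polynomial as q X^k with q(0) nonzero. Normalised by
    q(0) = 1, the polynomial q is 1 modulo X, so f - q(D) f is in the image of
    D, while D^k kills q(D) f. *)
Lemma fitting f : locally_finite -> exists k (q r : {poly K}),
  f = pact q f + D (pact r f) /\ iter k D (pact q f) = 0.
Proof.
move=> lf; have [p p0 pf] := lf f.
have [k [q [q0 pE]]] : exists k q, q`_0 != 0 /\ p = q * 'X^k.
  have [k] := ubnP (size p); elim: k p p0 {pf} => // k IH p p0 sp.
  have [r [c pE]] : exists r c, p = r * 'X + c%:P.
    by elim/poly_ind: p {p0 sp} => [|r c _]; [exists 0, 0; rewrite mul0r addr0|exists r, c].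
  have [c0|c0] := eqVneq c 0; last first.
    by exists 0%N, p; rewrite expr0 mulr1 {1}pE coefD coefMX add0r coefC.
  have r0 : r != 0 by apply: contra p0 => /eqP r0; rewrite pE r0 c0 mul0r addr0.
  have [|j [q [q0 rE]]] := IH r r0.
    by move: sp; rewrite pE c0 addr0 size_mulX.
  by exists j.+1, q; rewrite pE c0 addr0 rE exprSr mulrA.
have [r [c qE]] : exists r c, q = r * 'X + c%:P.
  by elim/poly_ind: q {q0 pE} => [|r c _]; [exists 0, 0; rewrite mul0r addr0|exists r, c].
have c0 : c != 0 by move: q0; rewrite qE coefD coefMX add0r coefC.
exists k, (c^-1 *: q), (- c^-1 *: r); split.
  rewrite -!mul_polyC !pactM !pactC qE pactDl pactMX pactC scalerDr scalerA mulVf //.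
  by rewrite scale1r vfZ vf_pact scaleNr addrAC subrr add0r.
have iterp j g s : iter j D (pact s g) = pact s (iter j D g).
  by elim: j => //= j ->; rewrite vf_pact.
by rewrite iterp -mul_polyC pactM -pactXn -pE pf pact0r.
Qed.

End PolynomialAction.

(** * Local finiteness and locally constant functions *)

Section Constants.
Variables (K : numClosedFieldType) (m : nat) (X : linAlgGroup K m).
Local Notation A := (coordRing X).
Local Notation one := (pone X).
Implicit Types (x y z : point X) (f g h c : A).

(** If f(x y) = sum a_i(x) b_i(y), all v^n f lie in the span of the b_i. *)
Lemma right_inv_locally_finite (v : vfield A) : right_inv v -> locally_finite v.
Proof.
move=> rv f; have [s fs] := comult f.
have rI n y h : iter n v (rtrans y h) = rtrans y (iter n v h).
  by elim: n => //= n ->; rewrite rv.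
have vI n : iter n v f = \sum_(p <- s) ev one (iter n v p.1) *: p.2.
  apply: coord_ext => y; rewrite -(pmul1p y) -ev_rtrans -rI (comult_rtrans fs).
  rewrite pmul1p !raddf_sum.
  have iter_sum (r : seq (A * A)) (c : A * A -> K) :
      iter n v (\sum_(p <- r) c p *: p.1) = \sum_(p <- r) c p *: iter n v p.1.
    elim: r => [|p r IH]; rewrite ?big_nil ?big_cons ?iterD ?IH //.
    by elim: (n) => //= j ->; rewrite vf0.
  rewrite iter_sum raddf_sum; apply: eq_bigr => p _ /=.
  by rewrite !evZ mulrC.
pose M := \matrix_(i < (size s).+1, j < size s) ev one (iter i v (nth (0, 0) s j).1).
have [al al0 alM] : exists2 al : 'rV[K]_(size s).+1, al != 0 & al *m M = 0.
  have kM : kermx M != 0.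
    by rewrite kermx_eq0 /row_free neq_ltn ltnS rank_leq_col.
  by have /rowV0Pn[al /sub_kermxP ? ?] := kM; exists al.
exists (\poly_(i < (size s).+1) al 0 (inord i)).
  apply/eqP => p0; case/eqP: al0; apply/rowP => i; rewrite mxE.
  have := congr1 (fun q : {poly K} => q`_i) p0.
  by rewrite coef_poly ltn_ord coef0 inord_val.
rewrite (@pactE _ _ _ (size s).+1) ?size_poly //.
transitivity (\sum_(i < (size s).+1) \sum_(j < size s)
    (al 0 i * M i j) *: (nth (0, 0) s j).2).
  apply: eq_bigr => i _; rewrite coef_poly ltn_ord inord_val vI.
  rewrite (big_nth (0, 0)) big_mkord scaler_sumr.
  by apply: eq_bigr => j _; rewrite scalerA !mxE.
rewrite exchange_big big1 // => j _; rewrite -scaler_suml.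
have := congr1 (fun B : 'rV_(size s) => B 0 j) alM.
by rewrite !mxE => ->; rewrite scale0r.
Qed.

(** The locally constant functions. On a disconnected group there are more of
    them than scalars. *)
Definition is_const c := forall v : vfield A, v c = 0.

Lemma const1 : is_const 1. Proof. exact: vf1. Qed.
Lemma const_alg (k : K) : is_const k%:A. Proof. by move=> v; exact: vf_alg. Qed.
Lemma constD c d : is_const c -> is_const d -> is_const (c + d).
Proof. by move=> hc hd v; rewrite vfD hc hd addr0. Qed.
Lemma constB c d : is_const c -> is_const d -> is_const (c - d).
Proof. by move=> hc hd v; rewrite vfB hc hd subr0. Qed.
Lemma constM c d : is_const c -> is_const d -> is_const (c * d).
Proof. by move=> hc hd v; rewrite vfM hc hd mulr0 mul0r addr0. Qed.

Lemma const_horner c (q : {poly K}) : is_const c -> is_const (horner_alg c q).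
Proof.
move=> hc; elim/poly_ind: q => [|q d IH]; first by move=> v; rewrite rmorph0 vf0.
rewrite rmorphD rmorphM /= horner_algX horner_algC.
by apply: constD (const_alg _); apply: constM.
Qed.

Hypothesis uncountableK : infinite_fibre K.

(** A transcendental c would have derivative 1 along some tangent vector, and so
    along some left invariant field. *)
Lemma const_algebraic c : is_const c ->
  exists2 q : {poly K}, q != 0 & horner_alg c q = 0.
Proof.
move=> hc; apply: contrapT => nalg.
have indc : alg_independent (fun _ : 'I_1 => c).
  move=> p pc; apply: contrapT => /eqP p0; apply: nalg.
  pose q := \sum_(mm <- msupp p) p@_mm *: 'X^(mm ord0) : {poly K}.
  exists q; last first.
    rewrite -pc /mmap /q raddf_sum /=; apply: eq_bigr => mm _.
    rewrite -mul_polyC rmorphM /= horner_algC rmorphXn /= horner_algX.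
    by rewrite /mmap1 big_ord1.
  have [mm mp] : exists mm, mm \in msupp p.
    by exists (mlead p); apply: mlead_supp.
  apply/eqP => q0; have := congr1 (fun r : {poly K} => r`_(mm ord0)) q0.
  rewrite coef0 /q coef_sum (bigD1_seq mm) ?msupp_uniq //= big1_seq.
    rewrite coefZ coefXn eqxx mulr1 addr0 => /eqP.
    by move: mp; rewrite mcoeff_msupp => /negbTE ->.
  move=> mm' /andP[mm'm _]; rewrite coefZ coefXn.
  case: eqP => [e|_]; last by rewrite mulr0.
  case/eqP: mm'm; apply/mnmP => i; by rewrite (ord1 i) e.
have [x [lam [dlam lamc]]] := jacobian_point uncountableK indc.
have [v _ vE] := left_inv_field (translate_derivation (dlam ord0)).
have := vE c x; rewrite hc rmorph0 ltransA pmulpV ltrans1 (lamc ord0 ord0) eqxx => /eqP.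
by rewrite eq_sym oner_eq0.
Qed.

(** An algebraic function takes finitely many values, so the locally constant
    functions form a von Neumann regular ring. The inverse t on the support of c
    is a polynomial in c, and 1 - c t is the indicator of the zero set of c; this
    replaces an analysis of the connected components. *)
Lemma const_regular c : is_const c -> exists2 t, is_const t & c * c * t = c.
Proof.
move=> hc; have [p p0 pc] := const_algebraic hc.
have [q [q0 qc]] : exists q : {poly K}, q`_0 != 0 /\ c * horner_alg c q = 0.
  have [k] := ubnP (size p); elim: k p p0 pc => // k IH p p0 pc sp.
  have [r [d pE]] : exists r d, p = r * 'X + d%:P.
    by elim/poly_ind: p {p0 sp pc} => [|r d _]; [exists 0, 0; rewrite mul0r addr0|exists r, d].
  have [d0|d0] := eqVneq d 0; last first.
    exists p; rewrite {1}pE coefD coefMX add0r coefC; split=> //.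
    by rewrite pc mulr0.
  have r0 : r != 0 by apply: contra p0 => /eqP r0; rewrite pE r0 d0 mul0r addr0.
  have sr : (size r < k)%N by move: sp; rewrite pE d0 addr0 size_mulX.
  have rc : c * horner_alg c r = 0.
    by rewrite -pc pE d0 addr0 rmorphM /= horner_algX mulrC.
  have [rc0|rc0] := pselect (horner_alg c r = 0); first exact: (IH r).
  have [e0|e0] := eqVneq (r`_0) 0; last by exists r.
  have [r1 [d1 rE]] : exists r1 d1, r = r1 * 'X + d1%:P.
    by elim/poly_ind: (r) => [|r1 d1 _]; [exists 0, 0; rewrite mul0r addr0|exists r1, d1].
  have d10 : d1 = 0 by move: e0; rewrite rE coefD coefMX add0r coefC.
  (* Now c divides r(c), and c r(c) = 0, so r(c) vanishes at every point. *)
  exfalso; apply: rc0; apply: coord_ext => x; rewrite rmorph0.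
  have := congr1 (ev x) rc; rewrite rmorph0 rmorphM /= => /eqP.
  rewrite mulf_eq0 => /orP[/eqP xc|/eqP//].
  by rewrite rE d10 addr0 rmorphM rmorphM /= horner_algX xc mulr0.
have [r [d qE]] : exists r d, q = r * 'X + d%:P.
  by elim/poly_ind: q {q0 qc} => [|r d _]; [exists 0, 0; rewrite mul0r addr0|exists r, d].
have d0 : d != 0 by move: q0; rewrite qE coefD coefMX add0r coefC.
exists ((- d^-1)%:A * horner_alg c r).
  by apply: constM; [exact: const_alg|exact: const_horner].
have : c * (horner_alg c r * c + d%:A) = 0.
  by rewrite -qc qE rmorphD rmorphM /= horner_algX horner_algC.
move=> h; have h2 : c * c * horner_alg c r = - d%:A * c.
  by apply/eqP; rewrite -subr_eq0; apply/eqP; rewrite -[RHS]h; ring.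
rewrite mulrCA h2 mulrA -scaleNr -scalerAl mul1r scalerA mulrNN mulVf //.
by rewrite scale1r mul1r.
Qed.

End Constants.

(** * Slices of an invariant field *)

Section TwoFields.
Variables (K : numClosedFieldType) (m : nat) (X : linAlgGroup K m).
Local Notation A := (coordRing X).
Local Notation one := (pone X).
Implicit Types (x y z : point X) (f g h c : A) (v w : vfield A).

(** Frames of two named fields, so that D and E can play different roles. *)
Record pair_frame (D E : vfield A) := PairFrame {
  pf1 : vfield A -> A; pf2 : vfield A -> A;
  pf1_lin : forall a u v, pf1 (a *: u + v) = a * pf1 u + pf1 v;
  pf2_lin : forall a u v, pf2 (a *: u + v) = a * pf2 u + pf2 v;
  pf11 : pf1 D = 1; pf12 : pf1 E = 0; pf21 : pf2 D = 0; pf22 : pf2 E = 1;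
  pfE : forall v, v = pf1 v *: D + pf2 v *: E }.

Lemma pair_frame_sym D E : pair_frame D E -> pair_frame E D.
Proof.
case=> c d lc ld c1 c2 d1 d2 e; exists d c => //.
by move=> v; rewrite addrC -e.
Qed.

Lemma vconj_pair_frame D E : pair_frame D E -> pair_frame (vconj D) (vconj E).
Proof.
case=> c d lc ld c1 c2 d1 d2 e.
have a0 : antipode 0 = 0 :> A by exact: coord_ext.
have a1 : antipode 1 = 1 :> A by exact: coord_ext.
exists (fun v => antipode (c (vconj v))) (fun v => antipode (d (vconj v))).
- by move=> a u v; rewrite vconj_lin lc antipodeA antipodeM antipodeK.
- by move=> a u v; rewrite vconj_lin ld antipodeA antipodeM antipodeK.
- by rewrite vconjK c1.
- by rewrite vconjK c2.
- by rewrite vconjK d1.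
- by rewrite vconjK d2.
have conj0 : vconj (0 : vfield A) = 0 by apply: vfield_ext => f; exact: coord_ext.
move=> v; rewrite -{1}(vconjK v) {1}(e (vconj v)) vconj_lin; congr (_ + _).
by rewrite -[_ *: E]addr0 vconj_lin conj0 addr0.
Qed.

Lemma pair_const D E f : pair_frame D E -> D f = 0 -> E f = 0 -> is_const f.
Proof.
by move=> pf Df Ef v; rewrite (pfE pf v) vaddE !vscaleE Df Ef !mulr0 addr0.
Qed.

Lemma vconj_bracket v w : lie_bracket (vconj v) (vconj w) = vconj (lie_bracket v w).
Proof.
apply: vfield_ext => f; rewrite bracketE !vconjE !antipodeK bracketE.
exact: coord_ext.
Qed.

(** The differential of the inversion at the neutral element is - 1. Apply v at
    the neutral element to sum a_i (b_i o inv) = f(1), where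
    f(x y) = sum a_i(x) b_i(y). *)
Lemma ev1_antipode v f : ev one (v (antipode f)) = - ev one (v f).
Proof.
have [s fs] := comult f.
have cf : \sum_(p <- s) p.1 * antipode p.2 = (ev one f)%:A.
  apply: coord_ext => x; rewrite ev_alg raddf_sum -(pmulpV x) fs.
  by apply: eq_bigr.
have f1 : f = \sum_(p <- s) ev one p.2 *: p.1.
  apply: coord_ext => x; rewrite -{1}(pmulp1 x) fs raddf_sum.
  by apply: eq_bigr => p _; rewrite mulrC.
have f2 : f = \sum_(p <- s) ev one p.1 *: p.2.
  apply: coord_ext => x; rewrite -{1}(pmul1p x) fs raddf_sum.
  by apply: eq_bigr => p _.
have af2 : antipode f = \sum_(p <- s) ev one p.1 *: antipode p.2.
  apply: coord_ext => x; rewrite {1}f2 ev_antipode !raddf_sum.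
  by apply: eq_bigr.
have inv1 : pinv one = one.
  by rewrite -[LHS]pmulp1 pmulVp.
have := congr1 (fun g => ev one (v g)) cf; rewrite vf_alg rmorph0 vf_sum raddf_sum.
have leib p : ev one (v (p.1 * antipode p.2)) =
    ev one (v p.1) * ev one p.2 + ev one p.1 * ev one (v (antipode p.2)).
  by rewrite vfM rmorphD !rmorphM /= ev_antipode inv1.
rewrite (eq_bigr (fun p => ev one (v p.1) * ev one p.2 +
  ev one p.1 * ev one (v (antipode p.2)))) => [|p _]; last exact: leib.
rewrite big_split /= => /eqP; rewrite addrC addr_eq0 => /eqP h.
rewrite af2 [f in RHS]f1 !vf_sum !raddf_sum.
transitivity (\sum_(p <- s) ev one p.1 * ev one (v (antipode p.2))).
  by apply: eq_bigr => p _; rewrite vfZ.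
rewrite h -sumrN; apply: eq_bigr => p _.
by rewrite vfZ mulrC.
Qed.

Hypothesis uncountableK : infinite_fibre K.

Section Slice.
Variables (D E : vfield A) (kappa : K).
Hypotheses (rD : right_inv D) (rE : right_inv E).
Hypothesis bracketED : lie_bracket E D = kappa%:A *: D.
Variable pf : pair_frame D E.

Let ED f : E (D f) = D (E f) + kappa *: D f.
Proof.
have := congr1 (fun v : vfield A => v f) bracketED.
by rewrite bracketE vscaleE mulr_algl => /eqP; rewrite subr_eq addrC => /eqP.
Qed.

(** In the left invariant frame (vconj D, vconj E) the coefficients of D and E
    along vconj E are constants. Indeed v commutes with left invariant
    fields, and the brackets of the two frame fields are multiples of vconj D, so
    these fields kill the coefficient along vconj E. This uses that D spans an
    ideal of the Lie algebra. *)
Let coef_const v : right_inv v -> is_const (pf2 (vconj_pair_frame pf) v).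
Proof.
move=> rv; set F := vconj_pair_frame pf; set p := pf1 F v; set q := pf2 F v.
have lD : left_inv (vconj D) by exact: vconj_right.
have lE : left_inv (vconj E) by exact: vconj_right.
have br0 w : left_inv w -> lie_bracket w v = 0.
  by move=> lw; apply: vfield_ext => f; rewrite bracketE (left_right_comm f lw rv) subrr.
have vpq : v = p *: vconj D + q *: vconj E by exact: pfE.
have bED : lie_bracket (vconj E) (vconj D) = kappa%:A *: vconj D.
  rewrite vconj_bracket bracketED; apply: vfield_ext => f.
  by rewrite vscaleE !vconjE vscaleE !mulr_algl; exact: coord_ext.
have bDE : lie_bracket (vconj D) (vconj E) = (- kappa)%:A *: vconj D.
  by rewrite bracketC bED !scaleNr.
have d2 w : left_inv w -> (exists k : K, lie_bracket w (vconj D) = k%:A *: vconj D) ->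
    (exists k : K, lie_bracket w (vconj E) = k%:A *: vconj D) -> w q = 0.
  move=> lw [k1 e1] [k2 e2]; have := congr1 (pf2 F) (br0 w lw).
  rewrite {1}vpq bracketDr !bracketZr e1 e2 !scalerA.
  rewrite (_ : _ + _ = (p * k1%:A + w p + q * k2%:A) *: vconj D + w q *: vconj E); last first.
    by rewrite !scalerDl addrA.
  rewrite pf2_lin -[w q *: _]addr0 pf2_lin pf21 pf22 (lin0 (pf2_lin F)).
  by rewrite mulr0 add0r mulr1 addr0.
apply: (pair_const F); apply: d2 => //.
- by exists 0; rewrite bracketvv scale0r scale0r.
- by exists (- kappa).
- by exists kappa.
by exists 0; rewrite bracketvv scale0r scale0r.
Qed.

Lemma rtrans_const y c : is_const c -> is_const (rtrans y c).
Proof.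
move=> hc; apply: (pair_const pf); rewrite ?rD ?rE hc; exact: coord_ext.
Qed.

(** The plinth ideal of D, an ideal of the ring of constants; it is the whole ring
    exactly when D has a slice. *)
Definition plinth c := is_const c /\ exists s, c = D s.

(** The image of D meets ker D in a space that is stable under E and nonzero, so
    it contains an eigenvector F of E; translate it to make F(1) nonzero, and put
    G = F o inv. Since vconj D kills G and vconj E multiplies it by theta, coef_const
    gives D G = c1 G and E G = (c2 - theta) G with constants c1 and c2, and by
    ev1_antipode both vanish at 1. A constant that is 1 at the neutral element and
    annihilates c1 and c2 turns G into psi with D psi = 0 and
    E psi = - theta psi. Then F psi is killed by D and E, and it is the image
    under D of s0 psi, where F = D s0. *)
Lemma plinth_at_one f1 : D f1 != 0 -> D (D f1) = 0 ->
  exists2 k, plinth k & ev one k != 0.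
Proof.
move=> Df1 DDf1; pose V g := (exists h, g = D h) /\ D g = 0.
have [|||F [theta [[F_im DF] F0 EF]]] :=
  eigenvector (V := V) (f := D f1) (right_inv_locally_finite rE) _ _ _ Df1.
- move=> c g h [[g' ->] Dg] [[h' ->] Dh]; split; first by exists (c *: g' + h'); rewrite vfD vfZ.
  by rewrite vfD vfZ Dg Dh scaler0 addr0.
- move=> g [[g' ->] Dg]; split; last first.
    have := ED (D g'); rewrite Dg vf0 scaler0 addr0 => /esym.
    by [].
  by exists (E g' + kappa *: g'); rewrite ED vfD vfZ.
- by split=> //; exists f1.
case: F_im => s0 Fs0.
have [y Fy] : exists y, ev y F != 0.
  apply: contrapT => nF; case/eqP: F0; apply: coord_ext => y.
  by apply: contrapT => /eqP yF; apply: nF; exists y; rewrite rmorph0 in yF.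
set F' := rtrans y F; pose G := antipode F'.
have r0 : rtrans y 0 = 0 by exact: coord_ext.
have DF' : D F' = 0 by rewrite rD DF.
have EF' : E F' = theta *: F' by rewrite rE EF; exact: coord_ext.
have Fs : F' = D (rtrans y s0) by rewrite rD -Fs0.
have a0 : antipode 0 = 0 :> A by exact: coord_ext.
have cDG : vconj D G = 0 by rewrite vconjE antipodeK DF'.
have cEG : vconj E G = theta *: G by rewrite vconjE antipodeK EF'; exact: coord_ext.
have GE v : v G = theta *: (pf2 (vconj_pair_frame pf) v * G).
  rewrite {1}(pfE (vconj_pair_frame pf) v) vaddE !vscaleE cDG cEG mulr0 add0r.
  by rewrite scalerAr.
have inv1 : pinv one = one by rewrite -[LHS]pmulp1 pmulVp.
have F1 : ev one F' = ev y F by rewrite ev_rtrans pmul1p.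
have G1 : ev one G = ev y F by rewrite ev_antipode inv1.
have [t1 ct1 t1E] := const_regular uncountableK (coef_const rD).
set q1 := pf2 _ D in t1E; set q2 := pf2 (vconj_pair_frame pf) E.
pose c1 := theta *: q1; pose c2 := theta *: q2 + theta%:A.
have cZ k c : is_const c -> is_const (k *: c) by move=> hc v; rewrite vfZ hc scaler0.
have hc1 : is_const c1 by apply: cZ; exact: coef_const.
have hc2 : is_const c2 by apply: constD; [apply: cZ; exact: coef_const|exact: const_alg].
have c11 : ev one c1 = 0.
  have := ev1_antipode D F'; rewrite DF' rmorph0 oppr0 -/G GE evZ rmorphM /= mulrA.
  by move/eqP; rewrite mulf_eq0 G1 (negbTE Fy) orbF => /eqP.
have c21 : ev one c2 = 0.
  have := ev1_antipode E F'; rewrite EF' -/G GE !evZ rmorphM /= mulrA G1 F1.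
  rewrite -mulNr => /(mulIf Fy) e2.
  by rewrite rmorphD /= ev_alg evZ e2 addNr.
have kill c : is_const c -> ev one c = 0 -> exists e, [/\ is_const e, ev one e = 1 & e * c = 0].
  move=> hc e1; have [t ht tE] := const_regular uncountableK hc.
  exists (1 - c * t); split.
  - by apply: constB; [exact: const1|exact: constM].
  - by rewrite rmorphB rmorphM rmorph1 /= e1 mul0r subr0.
  by rewrite mulrBl mul1r mulrAC tE subrr.
have [e1 [he1 e11 e1c]] := kill _ hc1 c11; have [e2 [he2 e21 e2c]] := kill _ hc2 c21.
pose psi := G * (e1 * e2).
have he : is_const (e1 * e2) by exact: constM.
have psiE v : v psi = v G * (e1 * e2) by rewrite vfM he mulr0 addr0.
have Dpsi : D psi = 0.
  rewrite psiE GE; transitivity (G * e2 * (e1 * c1)); last by rewrite e1c mulr0.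
  by rewrite /c1 /q1 -scalerAl -!scalerAr; congr (_ *: _); ring.
have Epsi : E psi = - (theta *: psi).
  rewrite psiE GE.
  apply/eqP; rewrite -addr_eq0; apply/eqP.
  transitivity (G * e1 * (e2 * c2)); last by rewrite e2c mulr0.
  have -> : c2 = theta *: (q2 + 1) by rewrite /c2 scalerDr.
  by rewrite /q2 /psi -scalerAl -scalerDr -!scalerAr; congr (_ *: _); ring.
exists (F' * psi).
  split; last by exists (rtrans y s0 * psi); rewrite vfM Dpsi mulr0 addr0 -Fs.
  apply: (pair_const pf); rewrite vfM ?DF' ?Dpsi ?EF' ?Epsi ?mul0r ?mulr0 ?addr0 //.
  by rewrite mulrN -scalerAr -scalerAl subrr.
by rewrite !rmorphM /= F1 G1 e11 e21 !mulr1 mulf_neq0.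
Qed.

Lemma plinthM c j : is_const c -> plinth j -> plinth (c * j).
Proof.
move=> hc [hj [s js]]; split; first exact: constM.
by exists (c * s); rewrite vfM hc mul0r add0r js.
Qed.

Lemma plinthD i j : plinth i -> plinth j -> plinth (i + j).
Proof.
move=> [hi [s is_]] [hj [s' js]]; split; first exact: constD.
by exists (s + s'); rewrite vfD is_ js.
Qed.

(** By the Nullstellensatz the translates of an element of the plinth that is
    nonzero at 1 generate the unit ideal. So 1 is a combination of finitely many
    elements of the plinth; as constants form a regular ring, a single element e of
    the plinth acts on them as the identity, and e = e 1 = 1. *)
Lemma exists_slice f1 : D f1 != 0 -> D (D f1) = 0 -> exists s, D s = 1.
Proof.
move=> Df1 DDf1; have [k [hk [sk ks]] k1] := plinth_at_one Df1 DDf1.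
pose J := [set f | exists s : seq (A * A),
  (forall p, p \in s -> plinth p.2) /\ f = \sum_(p <- s) p.1 * p.2].
have iJ : is_ideal J.
  split; first by exists [::]; rewrite big_nil.
  move=> a _ _ [s1 [P1 ->]] [s2 [P2 ->]].
  exists ([seq (a * p.1, p.2) | p <- s1] ++ s2); split.
    by move=> p; rewrite mem_cat => /orP[/mapP[p' /P1 ? ->]|/P2].
  rewrite big_cat big_map mulr_sumr; congr (_ + _).
  by apply: eq_bigr => p _; rewrite mulrA.
have [s [sP s1]] : J 1.
  apply: contrapT => J1; have [n|x [xJ _]] := nullstellensatz uncountableK iJ (h := 1).
    by rewrite expr1n.
  move: k1; have := xJ (rtrans (pinv x) k); rewrite ev_rtrans pmulpV => -> //.
    by rewrite eqxx.
  exists [:: (1, rtrans (pinv x) k)]; rewrite big_seq1 mul1r; split=> // p.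
  rewrite inE => /eqP -> /=; split; first exact: rtrans_const.
  by exists (rtrans (pinv x) sk); rewrite rD -ks.
have [e [[_ [se eD]] eP]] : exists e, plinth e /\ forall p, p \in s -> e * p.2 = p.2.
  elim: s {s1} sP => [|p s IH] sP.
    exists 0; split=> //; split; first by move=> v; rewrite vf0.
    by exists 0; rewrite vf0.
  have [|e [he eP]] := IH; first by move=> p' ps; apply: sP; rewrite inE ps orbT.
  have hp : plinth p.2 by apply: sP; rewrite inE eqxx.
  have [t ht tE] := const_regular uncountableK hp.1.
  (* The idempotent with the same support as p.2. *)
  pose ep := p.2 * t.
  have hep : plinth ep by rewrite /ep mulrC; apply: plinthM.
  have epp : ep * p.2 = p.2 by rewrite /ep mulrAC.
  exists (e + (1 - e) * ep); split.
    by apply: plinthD => //; apply: plinthM => //; apply: constB he.1; exact: const1.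
  move=> p'; rewrite inE => /predU1P[->|/eP ep'].
    by rewrite mulrDl -mulrA epp; ring.
  by rewrite mulrDl mulrAC mulrBl mul1r ep' subrr mul0r addr0.
exists se; rewrite -eD -[e]mulr1 s1 mulr_sumr; apply: eq_big_seq => p ps.
by rewrite mulrCA eP.
Qed.

End Slice.

(** By fitting, f is in the image of D up to a function killed by a power of D.
    If D^(k+1) g = 0 then h0 = D^k g is killed by D, and g - (s^k / k!) h0 is killed
    by D^k, while s^k h0 is the image under D of s^(k+1) h0 / (k + 1). *)
Lemma slice_surjective (D : vfield A) s : right_inv D -> D s = 1 ->
  forall f, exists g, f = D g.
Proof.
move=> rD Ds f.
have Dpow k h : D h = 0 -> D (s ^+ k.+1 * h) = k.+1%:R *: (s ^+ k * h).
  move=> Dh; rewrite vfM Dh mulr0 addr0 scalerAl; congr (_ * _).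
  elim: k => [|k IH]; first by rewrite expr1 Ds expr0 scale1r.
  rewrite exprS vfM Ds IH mul1r -scalerAr -exprS -[X in X + _]scale1r -scalerDl.
  by rewrite -[k.+2%:R]natr1 [1 + _]addrC.
have iterpow k h : D h = 0 -> iter k D (s ^+ k * h) = k`!%:R *: h.
  move=> Dh; elim: k => [|k IH]; first by rewrite expr0 mul1r scale1r.
  rewrite iterSr Dpow //.
  have iterZ (c : K) g : iter k D (c *: g) = c *: iter k D g.
    by elim: (k) => //= j ->; rewrite vfZ.
  by rewrite iterZ IH scalerA -natrM -factS.
have nil k : forall g, iter k D g = 0 -> exists h, g = D h.
  elim: k => [|k IH] g; first by move=> /= ->; exists 0; rewrite vf0.
  move=> gk; set h0 := iter k D g; have Dh0 : D h0 = 0 by [].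
  have fk : k`!%:R != 0 :> K by rewrite pnatr_eq0 -lt0n fact_gt0.
  have [|h gh] := IH (- (k`!%:R)^-1 *: (s ^+ k * h0) + g).
    by rewrite iterD iterpow // scalerA mulNr mulVf // scaleN1r addNr.
  exists (h + (k`!%:R)^-1 *: (k.+1%:R^-1 *: (s ^+ k.+1 * h0))).
  rewrite vfD !vfZ Dpow // [k.+1%:R^-1 *: _]scalerA mulVf ?pnatr_eq0 // scale1r.
  by rewrite -gh scaleNr addrAC addNr add0r.
have [k [q [r [fE qk]]]] := fitting f (right_inv_locally_finite rD).
have [h hE] := nil _ _ qk.
by exists (h + pact D r f); rewrite vfD -hE.
Qed.

End TwoFields.

(** * Images of the fields of a two-dimensional group *)

Section TwoDimensionalAlgebra.
Variables (K : numClosedFieldType) (m : nat) (X : linAlgGroup K m).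
Local Notation A := (coordRing X).
Local Notation one := (pone X).
Implicit Types (x y z : point X) (f g h c : A) (v w : vfield A).

Hypothesis uncountableK : infinite_fibre K.

Section Ladder.
Variables (D E : vfield A) (kappa : K).
Hypotheses (rD : right_inv D) (rE : right_inv E) (k0 : kappa != 0).
Hypothesis bracketED : lie_bracket E D = kappa%:A *: D.

Lemma pact_shift p f : D (pact E p f) = pact E (p \Po ('X - kappa%:P)) (D f).
Proof.
have DE h : D (E h) = pact E ('X - kappa%:P) (D h).
  rewrite pactXsubC; have := congr1 (fun v : vfield A => v h) bracketED.
  by rewrite bracketE vscaleE mulr_algl => <-; rewrite opprB addrC subrK.
elim/poly_ind: p f => [|p c IH] f; first by rewrite comp_poly0 !pact0l vf0.
rewrite comp_poly_MXaddC !pactDl !pactC vfD vfZ; congr (_ + _).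
by rewrite pactMX pactM IH DE.
Qed.

(** As [E, D] = kappa D, the field D intertwines E and E - kappa. If D g = e g with
    e nonzero, the annihilator of g in K[E] is stable under translation by kappa,
    and so are the roots of its generator, which are finitely many and exist; this is
    absurd in characteristic zero. *)
Lemma eigenvalue0 g e : D g = e *: g -> g != 0 -> e = 0.
Proof.
move=> Dg g0; apply: contrapT => /eqP e0.
have shift p : pact E p g = 0 -> pact E (p \Po ('X - kappa%:P)) g = 0.
  move=> pg; have := pact_shift p g; rewrite pg vf0 Dg => /esym.
  rewrite -[e *: g]addr0 pact_lin pact0r addr0 => h.
  by rewrite -[LHS]scale1r -(mulVf e0) -scalerA h scaler0.
have [p [p0 pg] pmin] : exists2 p : {poly K}, p != 0 /\ pact E p g = 0 &
    forall q, pact E q g = 0 -> (size q < size p)%N -> q = 0.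
  have [p0 p0n0 p0g] := right_inv_locally_finite rE g.
  move: {2}(size p0) (leqnn (size p0)) => n.
  elim: n p0 p0n0 p0g => [|n IH] p pn0 pg sp.
    by move: sp; rewrite leqn0 size_poly_eq0 (negbTE pn0).
  have [[q [qg [qn0 sq]]]|nq] := pselect (exists q : {poly K},
    pact E q g = 0 /\ q != 0 /\ (size q < size p)%N).
    by apply: (IH q) => //; rewrite -ltnS (leq_trans sq).
  exists p => // q qg sq; apply: contrapT => /eqP qn0; apply: nq.
  by exists q.
have sX : size ('X - kappa%:P) = 2 by rewrite size_XsubC.
(* The shift keeps the degree and the leading coefficient. *)
have pshift : p \Po ('X - kappa%:P) = p.
  apply/eqP; rewrite -subr_eq0; apply/eqP; apply: pmin.
    rewrite pactDl shift // add0r (_ : - p = (-1)%:P * p) ?pactCM ?pg ?scaler0 //.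
    by rewrite polyCN mulN1r.
  have sp : (0 < size p)%N by rewrite size_poly_gt0.
  rewrite -[X in (_ < X)%N](prednK sp) ltnS; apply/leq_sizeP => j.
  have ss : size (p \Po ('X - kappa%:P)) = size p by rewrite size_comp_poly2.
  rewrite coefB leq_eqVlt => /predU1P[<-|jp].
    have := lead_coef_comp p (q := 'X - kappa%:P); rewrite sX => /(_ isT).
    rewrite (monicP (monicXsubC _)) expr1n mulr1 !lead_coefE ss => ->.
    by rewrite subrr.
  by rewrite !nth_default ?subrr // ?ss -(prednK sp).
have [p1|p1] := eqVneq (size p) 1%N.
  have pc := size1_polyC (eq_leq p1); move: pg p0; rewrite pc pactC => pg.
  rewrite polyC_eq0 => c0; move: g0; rewrite -[g]scale1r -(mulVf c0) -scalerA pg.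
  by rewrite scaler0 eqxx.
have /closed_rootP[a pa] := p1.
have roots j : root p (a - j%:R * kappa).
  elim: j => [|j IH]; first by rewrite mul0r subr0.
  have per (x : K) : p.[x - kappa] = p.[x].
    by rewrite -[in RHS]pshift horner_comp hornerXsubC.
  by move: IH; rewrite /root -natr1 mulrDl mul1r opprD addrA per.
have := @max_poly_roots _ p [seq a - j%:R * kappa | j <- iota 0 (size p)] p0.
rewrite size_map size_iota ltnn => h; suff: false by []; apply: h.
  by apply/allP => _ /mapP[j _ ->].
rewrite map_inj_uniq ?iota_uniq // => i j /addrI/oppr_inj/(mulIf k0)/eqP.
by rewrite eqr_nat => /eqP.
Qed.

(** By eigenvalue0 the only possible root of the minimal polynomial of f under D
    is 0. *)
Lemma ladder_nilpotent f : exists k, iter k D f = 0.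
Proof.
have [p p0 pf] := right_inv_locally_finite rD f.
have [n] := ubnP (size p); elim: n p f p0 pf => // n IH p f p0 pf sp.
have [p1|p1] := eqVneq (size p) 1%N.
  have pc := size1_polyC (eq_leq p1); move: pf p0; rewrite pc pactC => pf.
  rewrite polyC_eq0 => c0; exists 0%N.
  by rewrite /= -[f]scale1r -(mulVf c0) -scalerA pf scaler0.
have /closed_rootP[c /factor_theorem[q qE]] := p1.
have q0 : q != 0 by apply: contra p0 => /eqP q0; rewrite qE q0 mul0r.
have sq : (size q < n)%N.
  by move: sp; rewrite qE size_Mmonic ?monicXsubC // size_XsubC addn2.
have [qf|qf] := eqVneq (pact D q f) 0; first exact: (IH q).
have Dq : D (pact D q f) = c *: pact D q f.
  by apply/eqP; rewrite -subr_eq0 -pactXsubC -pactM mulrC -qE pf.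
have c0 := eigenvalue0 Dq qf.
have [|k kf] := IH q (D f) q0 _ sq; first by rewrite -vf_pact Dq c0 scale0r.
by exists k.+1; rewrite iterSr.
Qed.

Variable pf : pair_frame D E.

Lemma ladder_surjective f : exists g, f = D g.
Proof.
have [f0 Df0] : exists f0, D f0 != 0.
  apply: contrapT => nD; have D0 : D = 0.
    by apply: vfield_ext => h; apply: contrapT => /eqP Dh; apply: nD; exists h.
  have := congr1 (pf1 pf) D0; rewrite pf11 (lin0 (pf1_lin pf)).
  by move/eqP; rewrite oner_eq0.
have [k kf0] := ladder_nilpotent f0.
have [f1 [Df1 DDf1]] : exists f1, D f1 != 0 /\ D (D f1) = 0.
  elim: k f0 Df0 kf0 => [|k IH] h Dh kh.
    by move: Dh; move: kh => /= ->; rewrite vf0 eqxx.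
  have [DD|DD] := eqVneq (D (D h)) 0; first by exists h.
  by apply: (IH (D h)) => //; rewrite -iterSr.
have [s Ds] := exists_slice uncountableK rD rE bracketED pf Df1 DDf1.
exact: slice_surjective rD Ds f.
Qed.

End Ladder.

(** The coordinates of a right invariant field in a right invariant frame are
    invariant under the transitive right translations. *)
Lemma pair_right_inv D E (pf : pair_frame D E) v :
  right_inv D -> right_inv E -> right_inv v ->
  exists a b : K, v = a%:A *: D + b%:A *: E.
Proof.
move=> rD rE rv; set c := pf1 pf v; set d := pf2 pf v.
have vE : v = c *: D + d *: E by exact: pfE.
have cd y : rtrans y c = c /\ rtrans y d = d.
  have z0 : (rtrans y c - c) *: D + (rtrans y d - d) *: E = 0.
    apply: vfield_ext => f; rewrite vaddE !vscaleE.
    have [g ->] : exists g, f = rtrans y g.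
      exists (rtrans (pinv y) f); apply: coord_ext => x.
      by rewrite !ev_rtrans -pmulA pmulpV pmulp1.
    have := rv y g; rewrite {1 2}vE !vaddE !vscaleE.
    have -> : rtrans y (c * D g + d * E g) =
       rtrans y c * D (rtrans y g) + rtrans y d * E (rtrans y g).
      by rewrite rD rE; exact: coord_ext.
    move=> /eqP; rewrite eq_sym -subr_eq0 => /eqP h.
    by rewrite vzeroE -[RHS]h; ring.
  split; apply/eqP; rewrite -subr_eq0; apply/eqP.
    have := congr1 (pf1 pf) z0.
    rewrite pf1_lin -[_ *: E]addr0 pf1_lin pf11 pf12 (lin0 (pf1_lin pf)).
    by rewrite mulr1 mulr0 !addr0.
  have := congr1 (pf2 pf) z0.
  rewrite pf2_lin -[_ *: E]addr0 pf2_lin pf21 pf22 (lin0 (pf2_lin pf)).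
  by rewrite mulr1 mulr0 add0r addr0.
have cst h : (forall y, rtrans y h = h) -> h = (ev one h)%:A.
  move=> hy; apply: coord_ext => y; rewrite ev_alg -[in RHS](hy y) ev_rtrans.
  by rewrite pmul1p.
exists (ev one c), (ev one d); rewrite -!cst // => y; by case: (cd y).
Qed.

Lemma nonabelian_surjective (D0 D1 : vfield A) (pf : pair_frame D0 D1) (a b : K) :
  right_inv D0 -> right_inv D1 -> lie_bracket D0 D1 = a%:A *: D0 + b%:A *: D1 ->
  b != 0 -> exists2 D : vfield A, right_inv D & forall f, exists g, f = D g.
Proof.
move=> r0 r1 br b0; pose D := a%:A *: D0 + b%:A *: D1.
have ba : b%:A * (b^-1)%:A = 1 :> A by rewrite -scalerAl mul1r scalerA mulfV // scale1r.
have rD : right_inv D.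
  move=> y f; rewrite /D !vaddE !vscaleE !mulr_algl r0 r1; exact: coord_ext.
have brD : lie_bracket D0 D = b%:A *: D.
  rewrite /D bracketDr !bracketZr bracketvv !vf_alg !scale0r scaler0 !addr0 add0r.
  by rewrite br.
exists D => //; apply: (ladder_surjective rD r0 b0 brD).
have e1 (F : vfield A -> A) : (forall a u w, F (a *: u + w) = a * F u + F w) ->
    F D = a%:A * F D0 + b%:A * F D1.
  by move=> lF; rewrite /D lF -[b%:A *: D1]addr0 lF (lin0 lF) addr0.
have l1 := pf1_lin pf; have l2 := pf2_lin pf.
exists (fun v => (b^-1)%:A * pf2 pf v) (fun v => pf1 pf v - a%:A * (b^-1)%:A * pf2 pf v).
- by move=> c u v; rewrite l2; ring.
- by move=> c u v; rewrite l1 l2; ring.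
- by rewrite (e1 _ l2) pf21 pf22 mulr0 add0r mulr1 mulrC.
- by rewrite pf21 mulr0.
- rewrite (e1 _ l1) (e1 _ l2) pf11 pf12 pf21 pf22 !mulr0 !mulr1 addr0 add0r.
  by rewrite -mulrA [_ * b%:A]mulrC ba mulr1 subrr.
- by rewrite pf11 pf21 mulr0 subr0.
move=> v; rewrite {1}(pfE pf v); apply: vfield_ext => f.
rewrite /D !vE; set c := pf1 _ _; set d := pf2 _ _.
transitivity (c * D0 f + d * ((b%:A * (b^-1)%:A) * D1 f)); last by ring.
by rewrite ba mul1r.
Qed.

(** By fitting, ker D^k being ker D for all positive k. *)
Lemma split_kernel (D : vfield A) f : right_inv D -> (forall h, D (D h) = 0 -> D h = 0) ->
  exists (q : {poly K}) g, f = pact D q f + D g /\ D (pact D q f) = 0.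
Proof.
move=> rD kerD; have [k [q [r [fE qk]]]] := fitting f (right_inv_locally_finite rD).
exists q, (pact D r f); split=> //.
elim: k qk => [/= ->|k IH qk]; first by rewrite vf0.
by case: k IH qk => [//|k] IH qk; apply: IH; apply: kerD.
Qed.

(** If [D0, D1] is not zero, one of D0 and D1 acts on it by a nonzero scalar, and
    the ladder argument makes it surjective. If D0 and D1 commute and one of them,
    D, has ker D^2 larger than ker D, then D has a slice. Otherwise every
    function is congruent modulo the image of D0 to a function killed by D0, and
    that one modulo the image of D1 to a function killed by both. *)
Lemma two_dim_cases (D0 D1 : vfield A) (pf : pair_frame D0 D1) : right_inv D0 -> right_inv D1 ->
  (exists2 D : vfield A, right_inv D & forall f, exists g, f = D g) \/
  (lie_bracket D0 D1 = 0 /\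
   forall f, exists g0 g1 c, is_const c /\ f = D0 g0 + D1 g1 + c).
Proof.
move=> r0 r1.
have rbr : right_inv (lie_bracket D0 D1).
  move=> y f; rewrite !bracketE !r0 !r1 r0; exact: coord_ext.
have [a [b br]] := pair_right_inv pf r0 r1 rbr.
have [b0|b0] := eqVneq b 0; last by left; exact: nonabelian_surjective br b0.
have [a0|a0] := eqVneq a 0; last first.
  left; apply: (nonabelian_surjective (pair_frame_sym pf) r1 r0 (a := - b) (b := - a)).
    by rewrite bracketC br !scaleNr opprD addrC.
  by rewrite oppr_eq0.
have br0 : lie_bracket D0 D1 = 0 by rewrite br a0 b0 !scale0r addr0.
have br1 : lie_bracket D1 D0 = 0%:A *: D0 by rewrite bracketC br0 oppr0 !scale0r.
have br0' : lie_bracket D0 D1 = 0%:A *: D1 by rewrite br0 !scale0r.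
have [[f1 [Df1 DDf1]]|n0] := pselect (exists f1, D0 f1 != 0 /\ D0 (D0 f1) = 0).
  have [s Ds] := exists_slice uncountableK r0 r1 br1 pf Df1 DDf1.
  by left; exists D0 => //; exact: slice_surjective r0 Ds.
have [[f1 [Df1 DDf1]]|n1] := pselect (exists f1, D1 f1 != 0 /\ D1 (D1 f1) = 0).
  have [s Ds] := exists_slice uncountableK r1 r0 br0' (pair_frame_sym pf) Df1 DDf1.
  by left; exists D1 => //; exact: slice_surjective r1 Ds.
right; split=> // f.
have k0 h : D0 (D0 h) = 0 -> D0 h = 0.
  by move=> DD; apply: contrapT => /eqP Dh; apply: n0; exists h.
have k1 h : D1 (D1 h) = 0 -> D1 h = 0.
  by move=> DD; apply: contrapT => /eqP Dh; apply: n1; exists h.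
have [q0 [g0 [fE q0f]]] := split_kernel f r0 k0.
set f0 := pact D0 q0 f in fE q0f.
have [q1 [g1 [f0E q1f]]] := split_kernel f0 r1 k1.
exists g0, g1, (pact D1 q1 f0); split; last by rewrite {1}fE {1}f0E; ring.
apply: (pair_const pf) => //.
have comm h : D0 (D1 h) = D1 (D0 h).
  by apply/eqP; rewrite -subr_eq0 -bracketE br0.
have -> : D0 (pact D1 q1 f0) = pact D1 q1 (D0 f0).
  rewrite /pact vf_sum; apply: eq_bigr => i _; rewrite vfZ; congr (_ *: _).
  by elim: (i : nat) => //= j IH; rewrite comm IH.
by rewrite q0f pact0r.
Qed.

End TwoDimensionalAlgebra.

(** * Groups of dimension two *)

Section AlternatingPairs.
Variables (K : numClosedFieldType) (m : nat) (X : linAlgGroup K m).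
Local Notation A := (coordRing X).

Lemma frame_pair (e : 'I_2 -> vfield A) co : is_frame e co ->
  pair_frame (e ord0) (e (lift ord0 ord0)).
Proof.
move=> fr.
have H : forall v, v = co ord0 v *: e ord0 + co (lift ord0 ord0) v *: e (lift ord0 ord0).
  by case: fr => _ _ ex v; rewrite {1}(ex v) big_ord_recl big_ord1.
have lin i : forall (a : A) u v, co i (a *: u + v) = a * co i u + co i v by case: fr.
have d i j : co i (e j) = (i == j)%:R by case: fr.
exact: (PairFrame (lin _) (lin _) (d ord0 ord0) (d ord0 (lift ord0 ord0))
  (d (lift ord0 ord0) ord0) (d (lift ord0 ord0) (lift ord0 ord0)) H).
Qed.

(** The relations say that B factors through the second exterior power over the
    ring of functions, which is free of rank one. As functions need not
    act on M, their linearity is expressed by moving them between arguments. *)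
Lemma alternating_pair (M : zmodType) (B : vfield A -> vfield A -> M) (D E : vfield A)
    (pf : pair_frame D E) :
  (forall a b v, B (a + b) v = B a v + B b v) -> (forall a b, B a b = - B b a) ->
  (forall (f : A) a b, B (f *: a) b = B a (f *: b)) -> (forall (f : A) a, B (f *: a) a = 0) ->
  forall a b, B a b = B ((pf1 pf a * pf2 pf b - pf2 pf a * pf1 pf b) *: D) E.
Proof.
move=> BD BC BZ B0 a b; set a1 := pf1 pf a; set a2 := pf2 pf a.
set b1 := pf1 pf b; set b2 := pf2 pf b.
have BDr x y v : B v (x + y) = B v x + B v y by rewrite BC BD opprD -!BC.
have BN x v : B (- x) v = - B x v.
  apply/eqP; rewrite -addr_eq0 -BD addNr; apply/eqP.
  by have := B0 0 v; rewrite scale0r.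
have h (f g : A) (x y : vfield A) : B (f *: x) (g *: y) = B ((f * g) *: x) y.
  by rewrite -BZ scalerA mulrC.
rewrite [in LHS](pfE pf a) [in LHS](pfE pf b) -/a1 -/a2 -/b1 -/b2.
have flip (f : A) : B (f *: E) D = - B (f *: D) E by rewrite BC -BZ.
by rewrite BD !BDr !h !B0 add0r addr0 flip scalerBl BD BN.
Qed.

End AlternatingPairs.

Section Surfaces.
Variables (K : numClosedFieldType) (m : nat) (X : linAlgGroup K m).
Local Notation A := (coordRing X).
Implicit Types (f g h c : A) (a b v w : vfield A).

Variable omega : cochain A 2.
Hypothesis volX : volume_form omega.
Variables (l : 'I_2 -> vfield A) (co : 'I_2 -> vfield A -> A) (t : A).
Hypotheses (frame_l : is_frame l co) (left_l : forall i, left_inv (l i)).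
Hypothesis t_omega : t * omega l = 1.

Let form_omega : is_form omega := volX.1.
Let Dom := derived (L0 omega).
Local Notation l0 := (l ord0).
Local Notation l1 := (l (lift ord0 ord0)).
Local Notation curl := (curl l omega t).

Let noarg : 'I_0 -> vfield A := fun=> 0.
Let om a b := omega (cons_arg a (cons_arg b noarg)).

Let omC a b : om a b = - om b a. Proof. exact: form_consC. Qed.

Let omZ f a b : om (f *: a) b = f * om a b.
Proof. exact: form_consE. Qed.

Let omD a b v : om (a + b) v = om a v + om b v.
Proof. by rewrite -[a]scale1r /om form_cons_lin // mul1r scale1r. Qed.

Let om_frame : om l0 l1 = omega l.
Proof.
rewrite /om -[l in RHS]cons_arg_eta -[l \o _]cons_arg_eta.
by rewrite (arg0_eq noarg ((l \o lift ord0) \o lift ord0)).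
Qed.

Let om_t f : om ((f * t) *: l0) l1 = f.
Proof. by rewrite omZ om_frame -mulrA t_omega mulr1. Qed.

(** On a surface, curl a b is, up to sign, the Hamiltonian field of the function
    omega (a, b). *)
Lemma curl_om a b : curl a b = curl ((om a b * t) *: l0) l1.
Proof.
have pf := frame_pair frame_l.
rewrite (alternating_pair pf (curlDl frame_l form_omega t_omega) (curlC _ _ _)
  (curlZC frame_l form_omega t_omega)); last first.
  move=> f v; rewrite (curlZl frame_l form_omega t_omega) (curlvv _ _ _).
  by rewrite scaler0 add0r subrr.
apply: (congr1 (fun f => curl (f *: l0) l1)).
rewrite [om a b](alternating_pair pf omD omC) => [|f v w|f v].
- by rewrite omZ om_frame -mulrA [omega l * t]mulrC t_omega mulr1.
- by rewrite [om v _]omC !omZ [om w v]omC mulrN opprK.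
by rewrite omZ {1}/om form_cons2 // mulr0.
Qed.

Lemma L0_om v a b : L0 omega v ->
  v (om a b) = om (lie_bracket v a) b + om a (lie_bracket v b).
Proof.
move=> Lv; have := congr1 (fun F => F (cons_arg a (cons_arg b noarg))) Lv.
rewrite mul0r !lie_cons lie_lin0 /contract => /eqP.
by rewrite subr_eq0 subr_eq addrC => /eqP.
Qed.

(** A divergence-free v acts on Hamiltonian fields through their functions, so the
    field with Hamiltonian v g is the bracket of v with the one of g. *)
Lemma derived_flow v g : L0 omega v -> Dom (curl ((v g * t) *: l0) l1).
Proof.
move=> Lv; pose a := (g * t) *: l0.
have -> : v g = om (lie_bracket v a) l1 + om a (lie_bracket v l1).
  by rewrite -L0_om // om_t.
rewrite mulrDl scalerDl (curlDl frame_l form_omega t_omega) -!curl_om.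
rewrite -(lie_bracket_curl frame_l form_omega t_omega) //.
by apply: derived_bracket => //; exact: (L0_curl frame_l form_omega t_omega).
Qed.

Lemma derived_curl_surjective (D : vfield A) : right_inv D ->
  (forall f, exists g, f = D g) -> forall a b, Dom (curl a b).
Proof.
move=> rD Dsurj a b; have [g gE] := Dsurj (om a b * omega l).
rewrite curl_om (_ : om a b = (t *: D) g).
  exact/derived_flow/(right_inv_L0 volX frame_l left_l t_omega).
by rewrite vscaleE -gE mulrCA t_omega mulr1.
Qed.

(** Here om D E is invertible and t om D E is constant, because D and E commute and
    preserve t omega. So each constant c has the form omega (p, q) / t, where p and
    q are constant multiples of the divergence-free fields t D and t E, and the
    Hamiltonian field of t c is the bracket of p and q. *)
Lemma derived_curl_abelian (D E : vfield A) (pf : pair_frame D E) tau' :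
  right_inv D -> right_inv E -> lie_bracket D E = 0 -> tau' * om D E = 1 ->
  (forall f, exists g0 g1 c, is_const c /\ f = D g0 + E g1 + c) ->
  forall a b, Dom (curl a b).
Proof.
move=> rD rE DE tau1 dec a b.
have LD := right_inv_L0 volX frame_l left_l t_omega rD.
have LE := right_inv_L0 volX frame_l left_l t_omega rE.
have ED : lie_bracket E D = 0 by rewrite bracketC DE oppr0.
have om0 F : om F F = 0 by exact: form_cons2.
have omN u v : om (- u) v = - om u v by rewrite /om form_consN.
have cD : D (t * om D E) = 0.
  have := L0_om D E LD; rewrite vscaleE !bracketZl bracketvv DE !scaler0 !add0r.
  rewrite omN [om D (- _)]omC omN !omZ om0 mulr0 oppr0 oppr0 addr0 vfM => h.
  by rewrite h addrN.
have cE : E (t * om D E) = 0.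
  have := L0_om D E LE; rewrite vscaleE !bracketZl bracketvv ED !scaler0 !add0r.
  rewrite omN [om D (- _)]omC omN !omZ om0 mulr0 oppr0 opprK add0r vfM => h.
  by rewrite h [om E D]omC mulrN addrN.
pose i := omega l * tau'.
have iE : i * (t * om D E) = 1.
  by rewrite /i mulrACA [omega l * t]mulrC t_omega tau1 mulr1.
have ci : is_const i.
  have inv0 (F : vfield A) : F (t * om D E) = 0 -> F i = 0.
    move=> F0; have := congr1 F iE; rewrite vfM F0 mulr0 addr0 vf1 => h.
    by rewrite -[F i]mulr1 -iE [i * _]mulrC mulrA h mul0r.
  by apply: (pair_const pf); apply: inv0.
have [g0 [g1 [c [cc fE]]]] := dec (om a b * omega l).
pose p := (c * i) *: (t *: D); pose q := t *: E.
have Lp : L0 omega p.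
  apply/(L0P frame_l form_omega t_omega); rewrite (divgZ frame_l form_omega t_omega).
  have /(L0P frame_l form_omega t_omega) -> := LD.
  by rewrite mulr0 add0r; apply: constM.
have omab : om a b = (t *: D) g0 + (t *: E) g1 + om p q.
  rewrite !vscaleE /p /q !omZ [om _ (_ *: _)]omC omZ [om E D]omC !mulrN opprK.
  have -> : om a b = t * (om a b * omega l) by rewrite mulrCA t_omega mulr1.
  rewrite fE !mulrDr; congr (_ + _).
  transitivity (t * c * (i * (t * om D E))); last by ring.
  by rewrite iE mulr1.
rewrite curl_om omab !mulrDl !scalerDl !(curlDl frame_l form_omega t_omega) -curl_om.
apply: derivedD; first by apply: derivedD; apply: derived_flow.
by rewrite (curl_L0 frame_l form_omega t_omega Lp LE); apply: derived_bracket.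
Qed.

End Surfaces.

Lemma derived_eq_LJ_two (K : numClosedFieldType) (m : nat) (X : linAlgGroup K m)
    (omega : cochain (coordRing X) 2) :
  infinite_fibre K -> has_dimension X 2 -> volume_form omega ->
  derived (L0 omega) = LJ omega.
Proof.
move=> unc dimX volX.
have [l [co [fl left_l _]]] := left_invariant_frame unc dimX.
have [t tom] := volume_unit unc volX fl.
have fr := vconj_frame fl; have pf := frame_pair fr.
have rr i : right_inv (vconj (l i)) by exact: vconj_left.
apply: (derived_eq_LJ fl volX.1 tom).
case: (two_dim_cases unc pf (rr _) (rr _)) => [[D rD Dsurj]|[br dec]].
  exact: (derived_curl_surjective volX fl left_l tom rD Dsurj).
have [t' t'om] := volume_unit unc volX fr.
apply: (derived_curl_abelian volX fl left_l tom pf (tau' := t') (rr _) (rr _) br) => //.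
rewrite -t'om; congr (_ * omega _).
apply: cons_arg_ext => [|i]; rewrite ?cons_arg0 // cons_argS (ord1 i) cons_arg0.
by [].
Qed.

(** * Uncountability of the complex numbers, and conclusion *)

Section Uncountable.
Variable R : realType.

Lemma split_interval (p : (R * R) * R) : exists I : R * R, p.1.1 < p.1.2 ->
  [/\ p.1.1 <= I.1, I.1 < I.2, I.2 <= p.1.2 & (p.2 < I.1) || (I.2 < p.2)].
Proof.
case: p => [[a b] x] /=; pose d := (b - a) / 3%:R.
have bE : b = a + d + d + d by rewrite /d; field.
have [xa|xa] := ltP x (a + d + d).
  by exists (a + d + d, b) => /= ab; split; lra.
by exists (a, a + d) => /= ab; split; lra.
Qed.

(** Nested intervals, the next one avoiding the next value of e. *)
Lemma real_not_enumerable (e : nat -> R) : exists x, forall n, e n != x.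
Proof.
have [next nextP] := choice split_interval.
pose I := fix I n := if n is k.+1 then next (I k, e k) else (0, 1).
have I_lt n : (I n).1 < (I n).2.
  by elim: n => [|n IH]; [exact: ltr01 | have [] := nextP (I n, e n) IH].
have low_mono : {homo (fun n => (I n).1) : n k / (n <= k)%N >-> n <= k}.
  by apply: homo_leq => // [y x z|n]; [exact: le_trans | have [] := nextP (I n, e n) (I_lt n)].
have up_mono : {homo (fun n => (I n).2) : n k / (n <= k)%N >-> k <= n}.
  apply: homo_leq => // [y x z xy yz|n]; first exact: le_trans yz xy.
  by have [] := nextP (I n, e n) (I_lt n).
have low_up n k : (I n).1 <= (I k).2.
  apply: (le_trans (low_mono _ _ (leq_maxl n k))).
  exact: le_trans (ltW (I_lt _)) (up_mono _ _ (leq_maxr n k)).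
pose E := [set (I n).1 | n in [set: nat]].
exists (sup E) => n; apply/eqP => en.
have Ele : sup E <= (I n.+1).2.
  by apply: ge_sup => [|_ [k _ <-]]; [exists (I 0).1; exists 0%N | exact: low_up].
have leE : (I n.+1).1 <= sup E.
  apply: ub_le_sup; last by exists n.+1.
  by exists (I 0).2 => _ [k _ <-]; exact: low_up.
have [_ _ _ out] := nextP (I n, e n) (I_lt n).
have : (e n < (I n.+1).1) || ((I n.+1).2 < e n) by [].
by rewrite en !ltNge leE Ele.
Qed.

(** Were all fibres of kappa finite, R would be enumerated by the pairs of a
    natural number v and a position in a list of the fibre over v. *)
Lemma infinite_fibre_real : infinite_fibre R.
Proof.
move=> kappa; apply: contrapT => nv.
have /choice[N NP] v : exists N, forall s : seq R, uniq s ->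
    (forall c, c \in s -> kappa c = v) -> (size s <= N)%N.
  apply: contrapT => nN; apply: nv; exists v => N.
  have [s [us sN sv]] : exists s : seq R, [/\ uniq s, (N < size s)%N &
      forall c, c \in s -> kappa c = v].
    apply: contrapT => ns; apply: nN; exists N => s us sv.
    by rewrite leqNgt; apply/negP => sN; apply: ns; exists s.
  exists (take N s); split; first exact: take_uniq.
    by rewrite size_take sN.
  by move=> c /mem_take; exact: sv.
have /choice[s sP] v : exists s : seq R, forall c, kappa c = v -> c \in s.
  apply: contrapT => ns.
  have ext k : exists s : seq R, [/\ uniq s, size s = k & forall c, c \in s -> kappa c = v].
    elim: k => [|k [s [us sk sv]]]; first by exists [::].
    have [c [cv cs]] : exists c, kappa c = v /\ c \notin s.
      apply: contrapT => nc; apply: ns; exists s => c cv.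
      by apply: contrapT => /negP cs; apply: nc; exists c.
    exists (c :: s); split; rewrite /= ?cs ?sk // => d.
    by rewrite inE => /orP[/eqP->|/sv].
  have [s [us sk sv]] := ext (N v).+1.
  by have := NP v s us sv; rewrite sk ltnn.
have [x xP] := real_not_enumerable
  (fun n => if unpickle n is Some (v, i) then nth 0 (s v) i else 0).
have := xP (pickle (kappa x, index x (s (kappa x)))).
by rewrite pickleK nth_index ?eqxx // sP.
Qed.

End Uncountable.

Lemma infinite_fibre_inj (T U : eqType) (f : T -> U) : injective f ->
  infinite_fibre T -> infinite_fibre U.
Proof.
move=> fI infT kappa; have [v vP] := infT (kappa \o f).
exists v => N; have [s [us sN sv]] := vP N; exists (map f s); split.
- by rewrite map_inj_uniq.
- by rewrite size_map.
by move=> _ /mapP[c /sv <- ->].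
Qed.

Lemma infinite_fibre_complex (R : realType) : infinite_fibre R[i].
Proof.
have inj : injective (fun x : R => (x%:C)%C) by move=> x y [].
exact: infinite_fibre_inj inj (infinite_fibre_real (R := R)).
Qed.

Theorem theorem6 (R : realType) (m n : nat) (X : linAlgGroup R[i] m)
    (dimX : has_dimension X n.+2)
    (omega : cochain (coordRing X) n.+2) (volX : volume_form omega) :
  derived (L0 omega) = LJ omega.
Proof.
have unc := @infinite_fibre_complex R.
case: n dimX omega volX => [|n] dimX omega volX.
  exact: (derived_eq_LJ_two unc dimX volX).
exact: (derived_eq_LJ_high unc dimX volX).
Qed.
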